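(* Let $D\subset\mathbb{C}^n$ be a bounded $\mathcal{C}^1$-smooth domain. (i) If $\ell_D$ satisfies a quasi triangle inequality, then for all $m\in\mathbb{N}$ the functions $\ell_D^{(m)}$ and $l_D^{(m)}$ are continuous on $D\times D$. (ii) If $\kappa_D$ satisfies a quasi triangle inequality, then for all $m\in\mathbb{N}$ the function $\kappa_D^{(m)}$ is continuous on $D\times\mathbb{C}^n$, and $\hat\kappa_D$ is continuous on $D\times\mathbb{C}^n$.
   Context: $\mathbb{N}$ is the set of positive integers, $\mathbb{D}$ the open unit disc in $\mathbb{C}$, and $\mathcal{O}(\mathbb{D},D)$ the set of holomorphic maps $\mathbb{D}\to D$. For $z,w\in D$, $X\in\mathbb{C}^n$: $\ell_D(z,w):=\inf\{|\alpha|:\alpha\in\mathbb{D},\ \exists\varphi\in\mathcal{O}(\mathbb{D},D),\ \varphi(0)=z,\ \varphi(\alpha)=w\}$; $l_D:=\tanh^{-1}\ell_D$; $\kappa_D(z;X):=\inf\{|\alpha|:\alpha\in\mathbb{C},\ \exists\varphi\in\mathcal{O}(\mathbb{D},D),\ \varphi(0)=z,\ \alpha\varphi'(0)=X\}$. For $m\in\mathbb{N}$: $l_D^{(m)}(z,w):=\inf\{\sum_{j=0}^{m-1}l_D(y_j,y_{j+1}): y_0,\dots,y_m\in D,\ y_0=z,\ y_m=w\}$; $\ell_D^{(m)}$ is defined in the same way with $\ell_D$ in place of $l_D$; $\kappa_D^{(m)}(z;X):=\inf\{\sum_{j=1}^m\kappa_D(z;X_j): X_j\in\mathbb{C}^n,\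 \sum_{j=1}^mX_j=X\}$; and $\hat\kappa_D(z;X):=\inf_{m\in\mathbb{N}}\kappa_D^{(m)}(z;X)$. The function $\ell_D$ satisfies a quasi triangle inequality if there is $C\ge1$ with $\ell_D(x,z)\le C(\ell_D(x,y)+\ell_D(y,z))$ for all $x,y,z\in D$. The pseudometric $\kappa_D$ satisfies a quasi triangle inequality if there is $C>0$ with $\kappa_D(z;X+Y)\le C(\kappa_D(z;X)+\kappa_D(z;Y))$ for all $z\in D$, $X,Y\in\mathbb{C}^n$. *)

(* Defs.v *)
From HB Require Import structures.
From mathcomp Require Import all_boot all_order all_algebra.
From mathcomp Require Import complex.
From mathcomp Require Import all_classical all_reals all_analysis.

Set Implicit Arguments.
Unset Strict Implicit.
Unset Printing Implicit Defensive.

Import Order.TTheory GRing.Theory Num.Theory.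
Import numFieldNormedType.Exports.

Local Open Scope classical_set_scope.
Local Open Scope ring_scope.

(* Packing R[i] as a numFieldType gives it, and 'rV[Cplx R]_n, the norm and
   topology of MathComp-Analysis.  [derivable] and [derive1] for functions on
   Cplx R are then complex differentiability and the complex derivative. *)
Definition Cplx (R : realType) : numFieldType := R[i].

(* The norm `|z| lives in R[i]; this is the same modulus with values in R. *)
Definition modulus (R : realType) (z : Cplx R) : R :=
  ComplexField.Normc.normc (z : R[i]).

Definition unit_disc (R : realType) : set (Cplx R) := [set z | modulus z < 1].

Section Domains.
Variables (R : realType) (n : nat).
Local Notation Cn := 'rV[Cplx R]_n.
Local Notation R2n := 'rV[R]_(n + n).

Definition domain (D : set Cn) : Prop :=
  [/\ open D, connected D & D !=set0].

Definition realify (z : Cn) : R2n :=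
  row_mx (map_mx (fun c : Cplx R => complex.Re c) z)
         (map_mx (fun c : Cplx R => complex.Im c) z).

(* In finite dimension, continuity of x |-> 'd r x v for every v is continuity
   of x |-> 'd r x in operator norm. *)
Definition C1_on (U : set R2n) (r : R2n -> R) : Prop :=
  (forall x, U x -> differentiable r x) /\
  (forall v x, U x -> {for x, continuous (fun y : R2n => 'd r y v : R)}).

(* Every boundary point has a neighbourhood U with a C^1 local defining
   function r: D is {r < 0} inside U, and dr does not vanish on U. *)
Definition C1_smooth (D : set Cn) : Prop :=
  forall p : Cn, (closure D `\` D°) p ->
  exists (U : set R2n) (r : R2n -> R),
    [/\ open U, U (realify p), C1_on U r,
        (forall x, U x -> exists v : R2n, 'd r x v != 0 :> R) &
        (forall z : Cn, U (realify z) -> (D z <-> r (realify z) < 0))].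

Definition holo_disc (D : set Cn) (phi : Cplx R -> Cn) : Prop :=
  forall t, unit_disc t -> derivable phi t 1 /\ D (phi t).

(* All infima below are infima in R.  For D a domain they are over nonempty
   sets (bounded below by 0) at the arguments of interest, so that the
   convention inf set0 = 0 plays no role, and ell D z w < 1. *)
Definition ell (D : set Cn) (z w : Cn) : R :=
  inf [set modulus a | a in [set a : Cplx R | unit_disc a /\
    exists phi : Cplx R -> Cn,
      [/\ holo_disc D phi, phi 0 = z & phi a = w]]].

Definition artanh (t : R) : R := ln ((1 + t) / (1 - t)) / 2.

Definition lempert (D : set Cn) (z w : Cn) : R := artanh (ell D z w).

Definition kappa (D : set Cn) (z X : Cn) : R :=
  inf [set modulus a | a in [set a : Cplx R |
    exists phi : Cplx R -> Cn,
      [/\ holo_disc D phi, phi 0 = z & a *: derive1 phi 0 = X]]].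

(* Only the values y 0, ..., y m of the sequence y matter. *)
Definition chain_inf (D : set Cn) (f : Cn -> Cn -> R) (m : nat) (z w : Cn) : R :=
  inf [set \sum_(j < m) f (y j) (y j.+1) | y in [set y : nat -> Cn |
    [/\ (forall j, (j <= m)%N -> D (y j)), y 0%N = z & y m = w]]].

Definition ell_m (m : nat) (D : set Cn) : Cn -> Cn -> R :=
  chain_inf D (ell D) m.

Definition lempert_m (m : nat) (D : set Cn) : Cn -> Cn -> R :=
  chain_inf D (lempert D) m.

Definition kappa_m (m : nat) (D : set Cn) (z X : Cn) : R :=
  inf [set \sum_(j < m) kappa D z (Y j) | Y in [set Y : 'I_m -> Cn |
    \sum_(j < m) Y j = X]].

Definition kappa_hat (D : set Cn) (z X : Cn) : R :=
  inf [set kappa_m m D z X | m in [set m : nat | (0 < m)%N]].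

Definition ell_quasi_triangle (D : set Cn) : Prop :=
  exists C : R, 1 <= C /\
    forall x y z : Cn, D x -> D y -> D z ->
      ell D x z <= C * (ell D x y + ell D y z).

Definition kappa_quasi_triangle (D : set Cn) : Prop :=
  exists C : R, 0 < C /\
    forall z X Y : Cn, D z ->
      kappa D z (X + Y) <= C * (kappa D z X + kappa D z Y).

End Domains.

(* Main.v *)
Require Import Defs.
From mathcomp Require Import all_boot all_order all_algebra.
From mathcomp Require Import complex ring lra.
From mathcomp Require Import all_classical all_reals all_analysis.

Set Implicit Arguments.
Unset Strict Implicit.
Unset Printing Implicit Defensive.

(** Call D taut when every holomorphic map of the unit disc into the closure of
    D that meets D at the origin stays in D.  The proof has two halves: each
    quasi triangle inequality makes D taut, and in a taut bounded domain all the
    functions of the statement are continuous because extremal discs have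
    limits that are again discs in D.

    Quasi triangle inequality implies taut.  Suppose D is not taut.  Some disc
    in the closure of D starts in D and leaves it.  Pushing it inwards along a
    normal direction nu and minimizing a weighted gap over an annulus
    (minimizer, minimal_exit_touches, touching_disc) produces a disc phi that
    meets the boundary at one point p = phi 0 with quadratic room: D contains
    phi h + mu nu for |mu| < c |h|^2.  Consequently, for small s, both discs
    phi h + (s^2 + c' s h) nu and phi h + (s^2 - c' s h) nu lie in D
    (contact_discs).  They start at the same point z = p + s^2 nu, within
    s^2 |nu| of the boundary, and their derivatives differ by 2 c' s nu.
    A quasi triangle inequality combines the first derivative with the opposite
    of the second into one disc of D near z whose derivative has a component of
    order s along nu.  That is impossible: such a disc stays in D, hence almost
    on one side of the complex tangent hyperplane at p, and the
    Borel-Caratheodory inequality on a disc of radius m s with m large makes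
    its normal speed o(s) (normal_speed).  For kappa the combination is
    immediate (kappa_quasi_taut); for ell one joins the points with parameter
    s^2 of the two discs through z (ell_quasi_taut).

    Taut implies continuous.  Upper semicontinuity of ell and kappa follows by
    shrinking and shearing a competing disc (ell_usc, kappa_usc).  Lower
    semicontinuity is Montel's theorem (limit_disc) combined with tautness
    (ell_limit, kappa_limit).  For the chain functions, intermediate points of
    almost minimal chains have limits in the closure of D; since ell < 1 on D,
    tautness keeps these limits in D one after the other, whence
    chain_inf_ucont.  For kappa_m the intermediate vectors are bounded by the
    Cauchy estimate (kappa_m_ucont), and for kappa_hat, where the number of
    summands is unbounded, one uses that the lower semicontinuity of kappa is
    uniform in the direction (kappa_unif).

    The infima defining ell are over nonempty sets because any two points of a
    domain lie on a common disc (disc_through): join them by an entire curve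
    that stays in D over [0,1], and precompose with a map of the disc into a
    thin neighbourhood of [0,1] built from iterated square roots.

    The complex analysis needed is the Cauchy estimate, with its consequences
    of Taylor and Borel-Caratheodory type and Montel's theorem.  It is obtained
    from midpoint sums along the sides of squares in place of integrals, and
    limits are taken along one free ultrafilter on the natural numbers, so that
    bounded sequences need no extraction of subsequences. *)

Import Order.TTheory GRing.Theory Num.Theory.
Import numFieldNormedType.Exports.
Local Open Scope classical_set_scope.
Local Open Scope ring_scope.

(** * The modulus and the l1 norm on C^n *)

Section Modulus.
Variable R : realType.
Local Notation C := (Cplx R).
Implicit Types z w : C.

Definition ofR (x : R) : C := Complex x 0.
Lemma ofR0 : ofR 0 = 0. Proof. by []. Qed.
Lemma ofR1 : ofR 1 = 1. Proof. by []. Qed.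
Lemma ofRD x y : ofR (x + y) = ofR x + ofR y.
Proof. exact: (rmorphD (real_complex R)). Qed.
Lemma ofRM x y : ofR (x * y) = ofR x * ofR y.
Proof. exact: (rmorphM (real_complex R)). Qed.
Lemma ofRN x : ofR (- x) = - ofR x.
Proof. exact: (rmorphN (real_complex R)). Qed.
Lemma ofRV x : ofR x^-1 = (ofR x)^-1.
Proof. exact: (fmorphV (real_complex R)). Qed.
Lemma ofR_nat k : ofR k%:R = k%:R.
Proof. exact: (rmorph_nat (real_complex R)). Qed.
Lemma le_ofR x y : (ofR x <= ofR y) = (x <= y).
Proof. exact: lecR. Qed.
Lemma lt_ofR x y : (ofR x < ofR y) = (x < y).
Proof. exact: ltcR. Qed.
Lemma md_ge0 z : 0 <= modulus z.
Proof. by case: z => a b; exact: sqrtr_ge0. Qed.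
Lemma md0 : modulus (0 : C) = 0. Proof. exact: ComplexField.Normc.normc0. Qed.
Lemma md1 : modulus (1 : C) = 1. Proof. exact: ComplexField.Normc.normc1. Qed.
Lemma mdM z w : modulus (z * w) = modulus z * modulus w.
Proof. exact: ComplexField.Normc.normcM. Qed.
Lemma mdV z : modulus z^-1 = (modulus z)^-1.
Proof. exact: ComplexField.Normc.normcV. Qed.
Lemma mdN z : modulus (- z) = modulus z.
Proof. by case: z => a b; rewrite /modulus /= !sqrrN. Qed.
Lemma mdX z k : modulus (z ^+ k) = modulus z ^+ k.
Proof. by elim: k => [|k IH]; rewrite ?expr0 ?md1// !exprS mdM IH. Qed.
Lemma norm_md z : `|z| = ofR (modulus z).
Proof. by case: z. Qed.
Lemma md_eq0 z : (modulus z == 0) = (z == 0).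
Proof.
apply/eqP/eqP => [|->]; last exact: md0.
exact: ComplexField.Normc.eq0_normc.
Qed.
Lemma md_gt0 z : (0 < modulus z) = (z != 0).
Proof. by rewrite lt_def md_ge0 andbT md_eq0. Qed.
Lemma mdD z w : modulus (z + w) <= modulus z + modulus w.
Proof.
by have := ler_normD z w; rewrite !norm_md -ofRD le_ofR.
Qed.
Lemma mdB z w : modulus (z - w) = modulus (w - z).
Proof. by rewrite -mdN opprB. Qed.
Lemma mdBl z w : modulus z - modulus w <= modulus (z - w).
Proof. by rewrite lerBlDr (le_trans _ (mdD _ _))// subrK. Qed.
Lemma md_real (x : R) : modulus (ofR x) = `|x|.
Proof. by rewrite /modulus /= expr0n addr0 sqrtr_sqr. Qed.
Lemma sqr_md (z : C) : modulus z ^+ 2 = complex.Re z ^+ 2 + complex.Im z ^+ 2.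
Proof.
case: z => a b; rewrite /modulus /= sqr_sqrtr //.
by rewrite addr_ge0 ?sqr_ge0.
Qed.
Lemma Re_le_md z : `|complex.Re z| <= modulus z.
Proof.
by rewrite -(ler_pXn2r (n:=2)) ?nnegrE ?md_ge0 ?normr_ge0// sqr_md real_normK ?num_real//
  lerDl sqr_ge0.
Qed.
Lemma Im_le_md z : `|complex.Im z| <= modulus z.
Proof.
by rewrite -(ler_pXn2r (n:=2)) ?nnegrE ?md_ge0 ?normr_ge0// sqr_md real_normK ?num_real//
  lerDr sqr_ge0.
Qed.
Lemma md_le_ReIm z : modulus z <= `|complex.Re z| + `|complex.Im z|.
Proof.
rewrite -(ler_pXn2r (n:=2)) ?nnegrE ?md_ge0 ?addr_ge0 ?normr_ge0// sqr_md.
rewrite sqrrD !real_normK ?num_real// lerD2r lerDl.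
by rewrite mulrn_wge0// mulr_ge0.
Qed.
Lemma cReD z w : complex.Re (z + w) = complex.Re z + complex.Re w.
Proof. by case: z; case: w. Qed.
Lemma cImD z w : complex.Im (z + w) = complex.Im z + complex.Im w.
Proof. by case: z; case: w. Qed.
Lemma cReN z : complex.Re (- z) = - complex.Re z. Proof. by case: z. Qed.
Lemma cImN z : complex.Im (- z) = - complex.Im z. Proof. by case: z. Qed.
Lemma cReM z w : complex.Re (z * w) =
  complex.Re z * complex.Re w - complex.Im z * complex.Im w.
Proof. by case: z; case: w. Qed.
Lemma cImM z w : complex.Im (z * w) =
  complex.Re z * complex.Im w + complex.Im z * complex.Re w.
Proof. by case: z; case: w. Qed.
Lemma CE z w : complex.Re z = complex.Re w -> complex.Im z = complex.Im w -> z = w.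
Proof. by case: z; case: w => a b c d /= -> ->. Qed.
Lemma md_sum (I : Type) (r : seq I) (P : pred I) (F : I -> C) :
  modulus (\sum_(i <- r | P i) F i) <= \sum_(i <- r | P i) modulus (F i).
Proof.
elim/big_rec2 : _ => [|i y1 y2 _ H]; first by rewrite md0.
by apply: (le_trans (mdD _ _)); rewrite lerD2l.
Qed.

Lemma exists_half_pow_lt (c e : R) : 0 < e -> exists k, c * 2^-1 ^+ k < e.
Proof.
move=> e0; have : (fun k => c * 2^-1 ^+ k) @ \oo --> (0 : R).
  rewrite -[X in _ --> X](mulr0 c); apply: cvgMr.
  by apply: cvg_expr; rewrite ger0_norm// invf_lt1// ltr1n.
move=> /cvgr0Pnorm_lt /(_ _ e0)[k _ /(_ k (leqnn _)) H].
by exists k; apply: le_lt_trans H; exact: ler_norm.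
Qed.

Section Vec.
Variable n : nat.
Local Notation Cn := 'rV[C]_n.
Implicit Types u v : Cn.
(** The norm of C^n takes values in C; this equivalent norm takes values in R,
    so that estimates can be closed by real arithmetic. *)
Definition nrm (v : Cn) : R := \sum_(j < n) modulus (v 0 j).
Lemma nrm_ge0 v : 0 <= nrm v.
Proof. by apply: sumr_ge0 => i _; exact: md_ge0. Qed.
Lemma nrm0 : nrm 0 = 0.
Proof. by rewrite /nrm big1// => i _; rewrite mxE md0. Qed.
Lemma nrmD v (w : Cn) : nrm (v + w) <= nrm v + nrm w.
Proof.
rewrite /nrm -big_split; apply: ler_sum => i _ /=.
by rewrite mxE mdD.
Qed.
Lemma nrmZ a v : nrm (a *: v) = modulus a * nrm v.
Proof. by rewrite /nrm mulr_sumr; apply: eq_bigr => i _; rewrite mxE mdM. Qed.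
Lemma nrmN v : nrm (- v) = nrm v.
Proof. by apply: eq_bigr => i _; rewrite mxE mdN. Qed.
Lemma nrmB v (w : Cn) : nrm (v - w) = nrm (w - v).
Proof. by rewrite -nrmN opprB. Qed.
Lemma nrm_tri u v (w : Cn) : nrm (u - w) <= nrm (u - v) + nrm (v - w).
Proof. by apply: le_trans (nrmD _ _); rewrite addrA subrK. Qed.
Lemma md_le_nrm v j : modulus (v 0 j) <= nrm v.
Proof.
rewrite /nrm (bigD1 j)//= lerDl; apply: sumr_ge0 => i _; exact: md_ge0.
Qed.
Lemma nrm_eq0 v : nrm v = 0 -> v = 0.
Proof.
move=> v0; apply/rowP => j; rewrite mxE; apply/eqP; rewrite -md_eq0.
by rewrite eq_le md_ge0 andbT -v0 md_le_nrm.
Qed.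
Lemma nrm_gt0 v : v != 0 -> 0 < nrm v.
Proof. by move=> v0; rewrite lt_def nrm_ge0 andbT; apply: contra v0 => /eqP/nrm_eq0->. Qed.

Lemma nrm_le v e : (forall j, modulus (v 0 j) <= e) -> nrm v <= n%:R * e.
Proof.
move=> H; apply: (le_trans (ler_sum _ _)) => [i _|]; first exact: H.
by rewrite sumr_const card_ord mulr_natl.
Qed.

Lemma mxnorm_lt (v : Cn) (e : R) : 0 < e ->
  (`|v| < ofR e) <-> forall j, modulus (v 0 j) < e.
Proof.
move=> e0; rewrite /Num.norm/= mx_normE; split.
  move=> H j; have [ij ->] : exists ij : 'I_1 * 'I_n, j = ij.2 by exists (0, j).
  have := le_lt_trans _ H; move=> /(_ `|v ij.1 ij.2|).
  rewrite norm_md lt_ofR (ord1 ij.1); apply.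
  have -> : ofR (modulus (v 0 ij.2)) = (widen_itv `|v ij.1 ij.2|%:itv : {nonneg C})%:num.
    by rewrite /= norm_md (ord1 ij.1).
  rewrite num_le; exact: (le_bigmax _ (fun i : 'I_1 * 'I_n => (widen_itv `|v i.1 i.2|%:itv : {nonneg C})) ij).
move=> H.
elim/big_ind : _ => //=.
- by rewrite lt_ofR.
- by move=> x y Hx Hy; rewrite maxEge; case: ifP.
- by move=> [i j] _ /=; rewrite norm_md lt_ofR (ord1 i).
Qed.

Lemma ltc_pos (e : C) : 0 < e -> exists2 d : R, 0 < d & e = ofR d.
Proof.
case: e => a b; rewrite ltcE /= => /andP[/eqP b0 a0]; exists a => //.
by rewrite b0.
Qed.

Lemma nbhs_nrm (x : Cn) (A : set Cn) :
  nbhs x A <-> exists2 e : R, 0 < e & forall y, nrm (y - x) < e -> A y.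
Proof.
split.
  move=> /nbhs_normP[e /= e0 H].
  have [d d0 ed] := ltc_pos e0.
  exists d => // y yx; apply: H => /=; rewrite ed distrC.
  apply/mxnorm_lt => // j; apply: le_lt_trans yx; exact: md_le_nrm.
move=> [e e0 H]; apply: (nbhs_normP x A).2.
exists (ofR (e / n.+1%:R)) => /=; first by rewrite lt_ofR divr_gt0.
move=> y /=; rewrite distrC => /mxnorm_lt H'; apply: H.
have {}H' : forall j, modulus ((y - x) 0 j) <= e / n.+1%:R.
  by move=> j; apply/ltW/H'; rewrite divr_gt0.
apply: (le_lt_trans (nrm_le H')).
rewrite mulrCA -[ltRHS]mulr1 ltr_pM2l// ltr_pdivrMr// mul1r ltr_nat.
exact: leqnn.
Qed.

End Vec.

Lemma nbhs_md (x : C) (A : set C) :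
  nbhs x A <-> exists2 e : R, 0 < e & forall y, modulus (y - x) < e -> A y.
Proof.
split.
  move=> /(@nbhs_normP C (C : normedModType C))[e /= e0 H].
  have [d d0 ed] := ltc_pos e0.
  exists d => // y yx; apply: H => /=; rewrite ed distrC norm_md.
  by rewrite lt_ofR.
move=> [e e0 H]; apply: (@nbhs_normP C (C : normedModType C) x A).2.
exists (ofR e) => /=; first by rewrite lt_ofR.
move=> y /=; rewrite distrC norm_md lt_ofR; exact: H.
Qed.
End Modulus.

(** * Complex derivatives *)

Section Deriv.
Variable R : realType.
Local Notation C := (Cplx R).
Implicit Types (f g : C -> C) (z w d e : C).

(** Complex differentiability at z in terms of real radii: limits in C itself
    would quantify over complex epsilon. *)
Definition hasder f z d := forall e : R, 0 < e -> exists2 r : R, 0 < r &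
  forall w, modulus (w - z) < r ->
    modulus (f w - f z - d * (w - z)) <= e * modulus (w - z).

Lemma hasder_loclip f z d : hasder f z d -> exists2 r : R, 0 < r &
  forall w, modulus (w - z) < r ->
    modulus (f w - f z) <= (modulus d + 1) * modulus (w - z).
Proof.
move=> /(_ 1 ltr01)[r r0 H]; exists r => // w /H{}H.
have -> : f w - f z = (f w - f z - d * (w - z)) + d * (w - z) by rewrite subrK.
apply: (le_trans (mdD _ _)); rewrite mdM mul1r in H *.
by rewrite mulrDl mul1r addrC lerD2l.
Qed.

Lemma hasder_cont f z d : hasder f z d -> forall e : R, 0 < e ->
  exists2 r : R, 0 < r & forall w, modulus (w - z) < r -> modulus (f w - f z) < e.
Proof.
move=> /hasder_loclip[r r0 H] e e0.
have d1 : 0 < modulus d + 1 by rewrite ltr_wpDl ?md_ge0.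
exists (Num.min r (e / (modulus d + 1))); first by rewrite lt_min r0 divr_gt0.
move=> w; rewrite lt_min => /andP[/H wr we]; apply: (le_lt_trans wr).
by rewrite mulrC -ltr_pdivlMr.
Qed.

Lemma hasder_cst (c : C) z : hasder (fun=> c) z 0.
Proof.
move=> e e0; exists 1 => // w _; rewrite mul0r subrr subr0 md0.
by rewrite mulr_ge0 ?md_ge0// ltW.
Qed.

Lemma hasder_id z : hasder id z 1.
Proof.
move=> e e0; exists 1 => // w _; rewrite mul1r subrr md0.
by rewrite mulr_ge0 ?md_ge0// ltW.
Qed.

Lemma hasderD f g z d d' : hasder f z d -> hasder g z d' ->
  hasder (fun w => f w + g w) z (d + d').
Proof.
move=> Hf Hg e e0; have e2 : 0 < e / 2 by rewrite divr_gt0.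
have [r r0 {}Hf] := Hf _ e2; have [s s0 {}Hg] := Hg _ e2.
exists (Num.min r s); first by rewrite lt_min r0.
move=> w; rewrite lt_min => /andP[/Hf {}Hf /Hg {}Hg].
have -> : f w + g w - (f z + g z) - (d + d') * (w - z) =
  (f w - f z - d * (w - z)) + (g w - g z - d' * (w - z)) by ring.
apply: (le_trans (mdD _ _)); apply: le_trans (lerD Hf Hg) _.
by rewrite -mulrDl -splitr.
Qed.

Lemma hasderM f g z d d' : hasder f z d -> hasder g z d' ->
  hasder (fun w => f w * g w) z (d * g z + f z * d').
Proof.
move=> Hf Hg e e0.
have [t t0 Hl] := hasder_loclip Hf.
set A := modulus d + 1 in Hl.
have A0 : 0 < A by rewrite ltr_wpDl ?md_ge0.
have Gz : 0 < modulus (g z) + 1 by rewrite ltr_wpDl ?md_ge0.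
have Fz : 0 < modulus (f z) + 1 by rewrite ltr_wpDl ?md_ge0.
have [r r0 Hf'] := Hf (e / 3 / (modulus (g z) + 1)) ltac:(by rewrite !divr_gt0).
have [s s0 Hg'] := Hg (e / 3 / (modulus (f z) + 1)) ltac:(by rewrite !divr_gt0).
have [u u0 Hc] := hasder_cont Hg (e := e / 3 / A) ltac:(by rewrite !divr_gt0).
exists (Num.min (Num.min r s) (Num.min t u)); first by rewrite !lt_min r0 s0 t0.
move=> w; rewrite !lt_min => /andP[/andP[/Hf' F /Hg' G] /andP[/Hl L /Hc {}Hc]].
have -> : f w * g w - f z * g z - (d * g z + f z * d') * (w - z) =
  (f w - f z - d * (w - z)) * g z + f z * (g w - g z - d' * (w - z))
  + (f w - f z) * (g w - g z) by ring.
have m0 := md_ge0 (w - z).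
apply: (le_trans (mdD _ _)); have -> : e * modulus (w - z) =
  e / 3 * modulus (w - z) + e / 3 * modulus (w - z) + e / 3 * modulus (w - z) by lra.
have e3 : 0 < e / 3 by rewrite divr_gt0.
have H1 (x y : R) : 0 < y -> 0 <= x -> x <= y -> e / 3 / y * modulus (w - z) * x <= e / 3 * modulus (w - z).
  move=> y0 x0 xy; rewrite -[leRHS]mulr1.
  have -> : e / 3 / y * modulus (w - z) * x = (e / 3 * modulus (w - z)) * (x / y) by ring.
  apply: ler_wpM2l; first by rewrite mulr_ge0 ?(ltW e3).
  by rewrite ler_pdivrMr// mul1r.
apply: lerD; [apply: (le_trans (mdD _ _)); apply: lerD|].
- rewrite mdM; apply: le_trans (ler_wpM2r (md_ge0 _) F) _.
  by apply: H1; rewrite ?md_ge0// lerDl.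
- rewrite mdM mulrC; apply: le_trans (ler_wpM2r (md_ge0 _) G) _.
  by apply: H1; rewrite ?md_ge0// lerDl.
- rewrite mdM; apply: le_trans (ler_pM (md_ge0 _) (md_ge0 _) L (ltW Hc)) _.
  have -> : A * modulus (w - z) * (e / 3 / A) = e / 3 / A * modulus (w - z) * A by ring.
  by apply: H1 => //; exact: ltW.
Qed.

Lemma hasder_comp f g z d d' : hasder f (g z) d -> hasder g z d' ->
  hasder (fun w => f (g w)) z (d * d').
Proof.
move=> Hf Hg e e0.
have [t t0 Hl] := hasder_loclip Hg.
set A := modulus d' + 1 in Hl.
have A0 : 0 < A by rewrite ltr_wpDl ?md_ge0.
have D0 : 0 < modulus d + 1 by rewrite ltr_wpDl ?md_ge0.
have [r r0 Hf'] := Hf (e / 2 / A) ltac:(by rewrite !divr_gt0).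
have [s s0 Hg'] := Hg (e / 2 / (modulus d + 1)) ltac:(by rewrite !divr_gt0).
have [u u0 Hc] := hasder_cont Hg r0.
exists (Num.min (Num.min s t) u); first by rewrite !lt_min s0 t0.
move=> w; rewrite !lt_min => /andP[/andP[/Hg' G /Hl L] /Hc /Hf' F].
have -> : f (g w) - f (g z) - d * d' * (w - z) =
  (f (g w) - f (g z) - d * (g w - g z)) + d * (g w - g z - d' * (w - z)) by ring.
have m0 := md_ge0 (w - z).
apply: (le_trans (mdD _ _)); rewrite [e in leRHS]splitr mulrDl; apply: lerD.
  apply: (le_trans F); apply: le_trans (ler_wpM2l _ L) _; first by rewrite !divr_ge0// ltW.
  by rewrite mulrA divfK ?gt_eqF.
rewrite mdM; apply: le_trans (ler_wpM2l (md_ge0 _) G) _.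
rewrite mulrA ler_wpM2r// mulrCA -[leRHS]mulr1 ler_wpM2l ?divr_ge0 ?(ltW e0)//.
by rewrite ler_pdivrMr// mul1r lerDl.
Qed.

Lemma hasder_inv z : z != 0 -> hasder (fun w => w^-1) z (- (z ^- 2)).
Proof.
move=> z0 e e0; have mz : 0 < modulus z by rewrite md_gt0.
exists (Num.min (modulus z / 2) (e * modulus z ^+ 3 / 2)).
  by rewrite lt_min !divr_gt0// mulr_gt0// exprn_gt0.
move=> w; rewrite lt_min => /andP[w1 w2].
have mw : modulus z / 2 <= modulus w.
  have := mdBl z w; rewrite mdB; move: w1; lra.
have w0 : w != 0 by rewrite -md_gt0; apply: lt_le_trans mw; rewrite divr_gt0.
have -> : w^-1 - z^-1 - - z ^- 2 * (w - z) = (w - z) ^+ 2 * (w^-1 * z ^- 2).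
  by field; rewrite z0 w0.
rewrite !mdM !mdV !mdX; set a := modulus (w - z) in w1 w2 *.
set b := modulus w in mw *; set c := modulus z in mz mw w1 w2 *.
have b0 : 0 < b by apply: lt_le_trans mw; rewrite divr_gt0.
have -> : a ^+ 2 * (b^-1 * c ^- 2) = (a / (b * c ^+ 2)) * a.
  by field; rewrite !gt_eqF.
apply: ler_wpM2r; first exact: md_ge0.
rewrite ler_pdivrMr ?mulr_gt0 ?exprn_gt0//; apply: (le_trans (ltW w2)).
rewrite -mulrA; apply: ler_wpM2l; first exact: ltW.
have -> : c ^+ 3 / 2 = c / 2 * c ^+ 2 by ring.
by apply: ler_wpM2r => //; rewrite exprn_ge0// ltW.
Qed.

Lemma hasder_ext f g z d : (forall w, f w = g w) -> hasder f z d -> hasder g z d.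
Proof. by move=> H; have -> : g = f by apply/funext. Qed.

Lemma hasder_eq f z d d' : d = d' -> hasder f z d -> hasder f z d'.
Proof. by move=> ->. Qed.

Lemma hasderX k z : hasder (fun w => w ^+ k) z (k%:R * z ^+ k.-1).
Proof.
elim: k => [|k IH]; first by rewrite mul0r; exact: hasder_cst.
apply: (hasder_ext (f := fun w => w * w ^+ k)) => [w|]; first by rewrite exprS.
apply: hasder_eq (hasderM (hasder_id z) IH).
rewrite mul1r; case: k {IH} => [|k] /=; first by rewrite !expr0 mul0r mulr0 addr0 mulr1.
by rewrite mulrCA -exprS -[in RHS]addn1 natrD mulrDl mul1r addrC.
Qed.

Lemma hasder_aff f z d a b : hasder f (a + b * z) d ->
  hasder (fun w => f (a + b * w)) z (d * b).
Proof.
move=> Hf; apply: (hasder_comp (g := fun w => a + b * w)) => //.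
apply: hasder_eq (hasderD (hasder_cst a z) (hasderM (hasder_cst b z) (hasder_id z))).
by rewrite mul0r !add0r mulr1.
Qed.

Section Vec.
Variable n : nat.
Local Notation Cn := 'rV[C]_n.

Definition vder (f : C -> Cn) z (d : Cn) :=
  forall j, hasder (fun w => f w 0 j) z (d 0 j).

Lemma vder_nrm (f : C -> Cn) z (d : Cn) : vder f z d <->
  forall e : R, 0 < e -> exists2 r : R, 0 < r & forall w, modulus (w - z) < r ->
    nrm (f w - f z - (w - z) *: d) <= e * modulus (w - z).
Proof.
split=> [H e e0|H j e e0].
  have en : 0 < e / n.+1%:R by rewrite divr_gt0.
  pose r j := sval (cid2 (H j _ en)).
  have rP j : 0 < r j /\ forall w, modulus (w - z) < r j ->
     modulus (f w 0 j - f z 0 j - d 0 j * (w - z)) <= e / n.+1%:R * modulus (w - z).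
    by rewrite /r; case: cid2.
  exists (\big[Num.min/1]_j r j).
    by elim/big_ind : _ => // [x y x0 y0|j _]; [rewrite lt_min x0|case: (rP j)].
  move=> w wr; have m0 := md_ge0 (w - z).
  apply: (le_trans (nrm_le (e := e / n.+1%:R * modulus (w - z)) _)) => [j|].
    have [_ /(_ w)] := rP j; rewrite !mxE mulrC; apply.
    by apply: lt_le_trans wr _; exact: bigmin_le.
  rewrite mulrA ler_wpM2r// mulrCA -[leRHS]mulr1 ler_wpM2l ?(ltW e0)//.
  by rewrite ler_pdivrMr// mul1r ler_nat.
have [r r0 {}H] := H _ e0; exists r => // w /H{}H; apply: le_trans H.
have := md_le_nrm (f w - f z - (w - z) *: d) j.
by rewrite !mxE mulrC.
Qed.

(** The coordinatewise form amounts to the limit of difference quotients, which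
    ties the estimates below to derivable and derive1. *)
Lemma vder_cvg (f : C -> Cn) z (d : Cn) : vder f z d <->
  (h^-1 *: ((f \o shift z) (h *: 1) - f z) @[h --> 0^'] --> d).
Proof.
rewrite vder_nrm; split=> [H A /nbhs_nrm[e e0 HA]|H e e0].
  have [r r0 Hr] := H _ (divr_gt0 e0 (ltr0Sn _ 1)).
  rewrite /nbhs /= /dnbhs /within /=; apply/nbhs_md; exists r => // h.
  rewrite subr0 => hr h0; apply: HA => /=.
  have mh : 0 < modulus h by rewrite md_gt0.
  rewrite [h%:A]mulr1.
  have -> : h^-1 *: (f (h + z) - f z) - d = h^-1 *: (f (h + z) - f z - h *: d).
    by rewrite [in RHS]scalerBr scalerA mulVf// scale1r.
  rewrite nrmZ mdV mulrC ltr_pdivrMr//.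
  have /Hr : modulus (h + z - z) < r by rewrite addrK.
  rewrite addrK => H1; apply: (le_lt_trans H1).
  by rewrite ltr_pM2r// ltr_pdivrMr// ltr_pMr// ltr1n.
have : nbhs d [set y | nrm (y - d) < e] by apply/nbhs_nrm; exists e.
move=> /H; rewrite /nbhs /= /dnbhs /within /= => /nbhs_md[r r0 Hr].
exists r => // w wr.
have [->|wz] := eqVneq w z; first by rewrite !subrr scale0r subr0 nrm0 md0 mulr0.
have wz0 : w - z != 0 by rewrite subr_eq0.
have := Hr (w - z); rewrite subr0 => /(_ wr wz0) /ltW.
rewrite [_%:A]mulr1 subrK.
have -> : (w - z)^-1 *: (f w - f z) - d = (w - z)^-1 *: (f w - f z - (w - z) *: d).
  by rewrite [in RHS]scalerBr scalerA mulVf// scale1r.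
by rewrite nrmZ mdV mulrC ler_pdivrMr// md_gt0.
Qed.

Lemma derivable_vder (f : C -> Cn) z : derivable f z 1 -> vder f z (derive1 f z).
Proof. by move=> H; rewrite derive1E; apply/vder_cvg; exact: H. Qed.

Lemma vder_derivable (f : C -> Cn) z (d : Cn) : vder f z d -> derivable f z 1.
Proof. by move=> /vder_cvg H; apply/cvg_ex; exists d. Qed.

Lemma vder_derive1 (f : C -> Cn) z (d : Cn) : vder f z d -> derive1 f z = d.
Proof. by move=> /vder_cvg H; rewrite derive1E; exact: cvg_lim H. Qed.

End Vec.
End Deriv.

(** * Midpoint sums round squares *)

Section Cauchy.
Variable R : realType.
Local Notation C := (Cplx R).
Implicit Types (f g : C -> C) (p v w z : C) (N : nat).

Definition iC : C := Complex 0 1.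
Lemma iC2 : iC * iC = -1.
Proof. by apply: CE; rewrite /iC ?ReM ?ImM /=; ring. Qed.

(** The nodes are the midpoints of the N equal pieces of [0,1].  This choice
    makes midsum exact on affine functions and compatible with halving. *)
Definition midnode N k : R := (k%:R + 2^-1) / N%:R.
Definition midsum f N p v : C := \sum_(k < N) f (p + ofR (midnode N k) * v) * (v / N%:R).

Lemma midnode_itv N (k : 'I_N) : 0 <= midnode N k <= 1.
Proof.
have N0 : (0 : R) < N%:R by rewrite ltr0n (leq_ltn_trans _ (ltn_ord k)).
rewrite /midnode divr_ge0 ?addr_ge0// ?ler_pdivrMr// ?ltW// mul1r.
have : (k.+1%:R : R) <= N%:R by rewrite ler_nat.
rewrite -addn1 natrD; lra.
Qed.

(** The 2N pieces of a segment are the N pieces of each of its halves: the sums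
    are additive under bisection with no error term. *)
Lemma midsum_double f N p v : (0 < N)%N ->
  midsum f (N + N) p v = midsum f N p (v / 2) + midsum f N (p + v / 2) (v / 2).
Proof.
move=> N0; rewrite /midsum big_split_ord /=.
have NR : (N%:R : R) != 0 by rewrite pnatr_eq0 -lt0n.
have NC : (N%:R : C) != 0 by rewrite pnatr_eq0 -lt0n.
have NN : v / (N + N)%:R = v / 2 / N%:R.
  by rewrite natrD; field; rewrite NC /= -mulr2n mulrn_eq0 /= NC.
have two : ofR (2^-1 : R) = 2^-1 by rewrite ofRV -(ofR_nat R 2).
congr (_ + _); apply: eq_bigr => k _; rewrite NN; congr (f _ * _).
  have -> : midnode (N + N) k = midnode N k * 2^-1.
    by rewrite /midnode natrD; field; rewrite NR /= -mulr2n mulrn_eq0 /= NR.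
  by rewrite ofRM two; ring.
have -> : midnode (N + N) (N + k) = 2^-1 + midnode N k * 2^-1.
  by rewrite /midnode !natrD; field; rewrite NR /= -mulr2n mulrn_eq0 /= NR.
by rewrite ofRD ofRM two; ring.
Qed.

Lemma midsum_rev f N p v : midsum f N (p + v) (- v) = - midsum f N p v.
Proof.
rewrite /midsum (reindex_inj rev_ord_inj) /= -sumrN; apply: eq_bigr => k _.
have NR : (N%:R : R) != 0.
  by rewrite pnatr_eq0 -lt0n (leq_ltn_trans _ (ltn_ord k)).
rewrite mulNr mulrN; congr (- (f _ * _)).
have -> : midnode N (N - k.+1) = 1 - midnode N k.
  by rewrite /midnode natrB// -[k.+1]addn1 natrD; field.
by rewrite ofRD ofRN ofR1; ring.
Qed.

Lemma midnode_sum N : (0 < N)%N -> \sum_(k < N) ofR (midnode N k) = N%:R / 2.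
Proof.
move=> N0; have NR : (N%:R : R) != 0 by rewrite pnatr_eq0 -lt0n.
have H M : \sum_(k < M) ((k%:R : R) + 2^-1) = M%:R ^+ 2 / 2.
  elim: M => [|M IH]; first by rewrite big_ord0 expr0n /= mul0r.
  by rewrite big_ord_recr /= IH -[M.+1]addn1 natrD; field.
have -> : \sum_(k < N) ofR (midnode N k) = ofR (\sum_(k < N) midnode N k).
  by elim/big_rec2 : _ => // k y1 y2 _ ->; rewrite ofRD.
rewrite -mulr_suml H -[2]/(2%:R) -!ofR_nat -ofRV -ofRM; congr ofR.
by field.
Qed.

(** The midpoint rule integrates affine functions exactly; this is what replaces
    the existence of primitives. *)
Lemma midsum_aff N p v (a b : C) : (0 < N)%N ->
  midsum (fun w => a + b * w) N p v = v * (a + b * (p + v / 2)).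
Proof.
move=> N0; have NR : (N%:R : C) != 0 by rewrite pnatr_eq0 -lt0n.
rewrite /midsum -mulr_suml.
rewrite (eq_bigr (fun k : 'I_N => (a + b * p) + ofR (midnode N k) * (b * v))); last first.
  by move=> k _; ring.
rewrite big_split /= sumr_const card_ord -mulr_suml.
have -> : \sum_(i < N) ofR (midnode N i) = N%:R / 2 by exact: midnode_sum.
by rewrite -[X in X + _]mulr_natl; field.
Qed.

Lemma midsum_bound f N p v (M : R) :
  (forall t : R, 0 <= t <= 1 -> modulus (f (p + ofR t * v)) <= M) ->
  0 <= M -> modulus (midsum f N p v) <= M * modulus v.
Proof.
move=> H M0; case: (posnP N) => [->|N0].
  by rewrite /midsum big_ord0 md0 mulr_ge0 ?md_ge0.
have NR : (N%:R : R) != 0 by rewrite pnatr_eq0 -lt0n.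
apply: (le_trans (md_sum _ _ _)).
apply: (le_trans (ler_sum _ (G := fun=> M * (modulus v / N%:R)) _)) => [k _|].
  rewrite mdM mdM mdV -ofR_nat md_real ger0_norm// ler_pM ?md_ge0//.
    by rewrite mulr_ge0 ?md_ge0// invr_ge0.
  by apply: H; exact: midnode_itv.
by rewrite sumr_const card_ord -[leLHS]mulr_natl le_eqVlt; apply/orP; left; apply/eqP; field.
Qed.

Lemma midsumD f g N p v : midsum (fun w => f w + g w) N p v = midsum f N p v + midsum g N p v.
Proof. by rewrite /midsum -big_split; apply: eq_bigr => k _; rewrite mulrDl. Qed.

(** The sides are run through counterclockwise from the corner p, with edge
    vector v; for v real the square has horizontal and vertical sides. *)
Definition sqsum f N p v : C := midsum f N p v + midsum f N (p + v) (iC * v)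
  + midsum f N (p + v + iC * v) (- v) + midsum f N (p + iC * v) (- (iC * v)).

Lemma sqsumD f g N p v : sqsum (fun w => f w + g w) N p v = sqsum f N p v + sqsum g N p v.
Proof. by rewrite /sqsum !midsumD; ring. Qed.

Lemma sqsum_aff N p v a b : (0 < N)%N -> sqsum (fun w => a + b * w) N p v = 0.
Proof.
move=> N0; rewrite /sqsum !midsum_aff//.
by set i := iC; field.
Qed.

(** Each inner side occurs twice with opposite orientations and cancels by
    midsum_rev. *)
Lemma sqsum_split f N p v : (0 < N)%N -> sqsum f (N + N) p v =
  sqsum f N p (v / 2) + sqsum f N (p + v / 2) (v / 2) +
  sqsum f N (p + iC * (v / 2)) (v / 2) + sqsum f N (p + v / 2 + iC * (v / 2)) (v / 2).
Proof.
move=> N0; rewrite /sqsum !midsum_double//; set i := iC; set h := v / 2.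
have vE : v = h + h by rewrite -splitr.
have -> : i * v / 2 = i * h by rewrite /h mulrA.
have -> : - v / 2 = - h by rewrite mulNr.
have -> : - (i * v) / 2 = - (i * h) by rewrite mulNr /h mulrA.
rewrite vE.
have r1 : midsum f N (p + h + i * h) (- h) = - midsum f N (p + i * h) h.
  by rewrite -midsum_rev; congr (midsum f N _ _); ring.
have r2 : midsum f N (p + h + i * h) (- (i * h)) = - midsum f N (p + h) (i * h).
  by rewrite -midsum_rev; congr (midsum f N _ _); ring.
have -> : midsum f N (p + h + h + i * h) (- h) = - midsum f N (p + h + i * h) h.
  by rewrite -midsum_rev; congr (midsum f N _ _); ring.
have -> : midsum f N (p + i * h + i * h) (- (i * h)) = - midsum f N (p + i * h) (i * h).
  by rewrite -midsum_rev; congr (midsum f N _ _); ring.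
have -> : midsum f N (p + h + i * h + i * h) (- (i * h)) = - midsum f N (p + h + i * h) (i * h).
  by rewrite -midsum_rev; congr (midsum f N _ _); ring.
have -> : midsum f N (p + h + i * h + h + i * h) (- h) = - midsum f N (p + h + i * h + i * h) h.
  by rewrite -midsum_rev; congr (midsum f N _ _); ring.
rewrite r1 r2.
have e1 : p + i * h + h = p + h + i * h by ring.
have e2 : p + (h + h) = p + h + h by ring.
have e3 : p + (h + h) + i * (h + h) - h = p + h + i * h + i * h by ring.
have e4 : p + i * (h + h) - i * h = p + i * h by ring.
have e5 : p + h + h + i * h = p + h + i * h + h by ring.
have r3 : midsum f N (p + (h + h) + i * (h + h)) (- h) = - midsum f N (p + h + i * h + i * h) h.
  by rewrite -midsum_rev; congr (midsum f N _ _); ring.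
have r4 : midsum f N (p + i * (h + h)) (- (i * h)) = - midsum f N (p + i * h) (i * h).
  by rewrite -midsum_rev; congr (midsum f N _ _); ring.
by rewrite r3 r4 e3 e4 e2 e5 e1; ring.
Qed.
End Cauchy.

(** * Goursat's bisection *)

Section Goursat.
Variable R : realType.
Local Notation C := (Cplx R).
Implicit Types (f g : C -> C) (p v w z : C) (N : nat).
Local Notation Re := complex.Re.
Local Notation Im := complex.Im.

Lemma mdD4 (a b c d : C) (x y z t : R) : modulus a <= x -> modulus b <= y ->
  modulus c <= z -> modulus d <= t -> modulus (a + b + c + d) <= x + y + z + t.
Proof.
move=> Ha Hb Hc Hd; do 2 (apply: (le_trans (mdD _ _)); apply: lerD => //).
by apply: (le_trans (mdD _ _)); apply: lerD.
Qed.

Definition in_square p (s : R) w := (Re p <= Re w <= Re p + s) && (Im p <= Im w <= Im p + s).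
Definition on_square_bd p (s : R) w := in_square p s w /\
  [\/ Re w = Re p, Re w = Re p + s, Im w = Im p | Im w = Im p + s].

Lemma sqsum_bound f N p (s M : R) : 0 <= s -> 0 <= M ->
  (forall w, on_square_bd p s w -> modulus (f w) <= M) ->
  modulus (sqsum f N p (ofR s)) <= 4 * (M * s).
Proof.
move=> s0 M0 H.
have ms : modulus (ofR s) = s by rewrite md_real ger0_norm.
have mi : modulus (iC R) = 1 by rewrite /modulus /= expr0n expr1n add0r sqrtr1.
have b v (q : C) : modulus v = s -> (forall t : R, 0 <= t <= 1 -> on_square_bd p s (q + ofR t * v)) ->
    modulus (midsum f N q v) <= M * s.
  by move=> vs Hq; rewrite -[in leRHS]vs; apply: midsum_bound => // t /Hq/H.
have -> : 4 * (M * s) = M * s + M * s + M * s + M * s by ring.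
have ts (t : R) : 0 <= t <= 1 -> 0 <= t * s <= s.
  by move=> /andP[t0 t1]; rewrite mulr_ge0//= ler_piMl.
apply: mdD4.
- apply: b => // t /ts tt; split; last by apply: Or43; rewrite !(cReD, cImD, cReM, cImM) /=; ring.
  by rewrite /in_square !(cReD, cImD, cReM, cImM) /=; lra.
- apply: b => [|t /ts tt]; first by rewrite mdM mi mul1r.
  split; last by apply: Or42; rewrite !(cReD, cImD, cReM, cImM) /=; ring.
  by rewrite /in_square !(cReD, cImD, cReM, cImM) /=; lra.
- apply: b => [|t /ts tt]; first by rewrite mdN.
  split; last by apply: Or44; rewrite !(cReD, cImD, cReM, cImM) /=; ring.
  by rewrite /in_square !(cReD, cImD, cReM, cImM) /=; lra.
- apply: b => [|t /ts tt]; first by rewrite mdN mdM mi mul1r.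
  split; last by apply: Or41; rewrite !(cReD, cImD, cReM, cImM, cReN, cImN) /=; ring.
  by rewrite /in_square !(cReD, cImD, cReM, cImM, cReN, cImN) /=; lra.
Qed.

Lemma in_square_dist p (s : R) w z : in_square p s w -> in_square p s z -> modulus (w - z) <= 2 * s.
Proof.
rewrite /in_square => h1 h2; apply: (le_trans (md_le_ReIm _)).
rewrite cReD cImD cReN cImN mulr2n mulrDl mul1r.
by apply: lerD; rewrite ler_norml; lra.
Qed.

(** The affine part of f contributes nothing, and the remainder is at most
    e/8 times the diameter on a boundary of length 4 s. *)
Lemma sqsum_small f p (s : R) z d e : hasder f z d -> 0 < e ->
  exists2 r : R, 0 < r & forall p s, 0 <= s -> 2 * s < r -> in_square p s z ->
    forall N, (0 < N)%N -> modulus (sqsum f N p (ofR s)) <= e * s ^+ 2.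
Proof.
move=> Hf e0; have [r r0 Hr] := Hf (e / 8) ltac:(by rewrite divr_gt0).
exists r => // {}p {}s s0 sr zs N N0.
pose g w := f w - f z - d * (w - z).
have -> : sqsum f N p (ofR s) = sqsum g N p (ofR s).
  have -> : f = fun w => ((f z - d * z) + d * w) + g w.
    by apply/funext => w; rewrite /g; ring.
  by rewrite sqsumD sqsum_aff// add0r; congr sqsum; apply/funext => w; rewrite /g; ring.
have -> : e * s ^+ 2 = 4 * (e / 8 * (2 * s) * s) by field.
apply: sqsum_bound => //; first by rewrite !mulr_ge0// ltW.
move=> w [ws _]; have wz := in_square_dist ws zs.
apply: (le_trans (Hr _ _)); first exact: le_lt_trans sr.
by rewrite ler_wpM2l// divr_ge0// ltW.
Qed.

(** Only powers of two occur as numbers of nodes, since bisecting the square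
    halves the number of nodes on each side. *)
Definition sqsum_vanishes f e p (s : R) := exists K0, forall K, (K0 <= K)%N ->
  modulus (sqsum f (2 ^ K) p (ofR s)) <= e * s ^+ 2.

Lemma sqsum_vanishes_split f e p (s : R) :
  let h := ofR (s / 2) in
  sqsum_vanishes f e p (s / 2) -> sqsum_vanishes f e (p + h) (s / 2) -> sqsum_vanishes f e (p + iC R * h) (s / 2) ->
  sqsum_vanishes f e (p + h + iC R * h) (s / 2) -> sqsum_vanishes f e p s.
Proof.
move=> h [k1 H1] [k2 H2] [k3 H3] [k4 H4].
exists (maxn (maxn k1 k2) (maxn k3 k4)).+1 => [[//|K]]; rewrite ltnS !geq_max.
move=> /andP[/andP[/H1{}H1 /H2{}H2] /andP[/H3{}H3 /H4{}H4]].
rewrite expnS mul2n -addnn sqsum_split ?expn_gt0//.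
have -> : ofR s / 2 = h by rewrite /h ofRM ofRV -(ofR_nat R 2).
have -> : e * s ^+ 2 = e * (s / 2) ^+ 2 + e * (s / 2) ^+ 2 + e * (s / 2) ^+ 2 + e * (s / 2) ^+ 2.
  by field.
exact: mdD4.
Qed.

(** If the sums did not vanish on a square, then they would not vanish, relative to
    area, on one of its quarters.  The nested bad squares shrink to a point z,
    and differentiability at z contradicts sqsum_small. *)
Lemma goursat f p (s : R) : 0 < s ->
  (forall z, in_square p s z -> exists d, hasder f z d) ->
  forall e : R, 0 < e -> sqsum_vanishes f e p s.
Proof.
move=> s0 Hf e e0; apply: contrapT => bad.
pose child (p : C) (s : R) (q : C) := [/\ Re p <= Re q, Re q + s / 2 <= Re p + s,
  Im p <= Im q & Im q + s / 2 <= Im p + s].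
have step q t : 0 < t -> ~ sqsum_vanishes f e q t -> exists q', child q t q' /\ ~ sqsum_vanishes f e q' (t / 2).
  move=> t0 b; apply: contrapT => /forallNP H; apply: b.
  by apply: sqsum_vanishes_split; apply: contrapT => b;
    apply: H (conj _ b); rewrite /child ?(cReD, cImD, cReM, cImM) /=; split; lra.
pose t k := s / 2 ^+ k.
have t0 k : 0 < t k by rewrite divr_gt0// exprn_gt0.
have tS k : t k.+1 = t k / 2.
  rewrite /t exprS; field; rewrite expf_eq0 /= (_ : (2 : R) == 0 = false) ?andbF//.
  by apply/negbTE.
pose nx k q := xget q [set q' | child q (t k) q' /\ ~ sqsum_vanishes f e q' (t k.+1)].
pose P := fix P k := if k is k'.+1 then nx k' (P k') else p.
have nxP k q : ~ sqsum_vanishes f e q (t k) -> child q (t k) (nx k q) /\ ~ sqsum_vanishes f e (nx k q) (t k.+1).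
  move=> b; apply: (@xgetPex _ q [set q' | child q (t k) q' /\ ~ sqsum_vanishes f e q' (t k.+1)]).
  by have [q' H] := step _ _ (t0 _) b; exists q'; rewrite /= tS.
have Pbad k : ~ sqsum_vanishes f e (P k) (t k).
  elim: k => [|k IH]; first by rewrite /= /t expr0 divr1.
  by have [_] := nxP _ _ IH.
have Pch k : child (P k) (t k) (P k.+1) by have [] := nxP _ _ (Pbad k).
have mono j k : (j <= k)%N -> [/\ Re (P j) <= Re (P k), Re (P k) + t k <= Re (P j) + t j,
   Im (P j) <= Im (P k) & Im (P k) + t k <= Im (P j) + t j].
  move=> /subnKC <-; elim: (k - j)%N => [|m [a b c d]]; first by rewrite addn0.
  rewrite addnS; have [a' b' c' d'] := Pch (j + m)%N; rewrite tS.
  by split; lra.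
have mono2 j k : Re (P j) <= Re (P k) + t k /\ Im (P j) <= Im (P k) + t k.
  have := t0 j; have := t0 k; case: (leqP j k) => [/mono|/ltnW/mono] []; lra.
pose x := sup (range (fun k => Re (P k))); pose y := sup (range (fun k => Im (P k))).
have xP k : Re (P k) <= x <= Re (P k) + t k.
  apply/andP; split.
    apply: ub_le_sup; last by exists k.
    by exists (Re (P k) + t k) => _ [j _ <-]; have [] := mono2 j k.
  apply: ge_sup; first by exists (Re (P 0%N)), 0%N.
  by move=> _ [j _ <-]; have [] := mono2 j k.
have yP k : Im (P k) <= y <= Im (P k) + t k.
  apply/andP; split.
    apply: ub_le_sup; last by exists k.
    by exists (Im (P k) + t k) => _ [j _ <-]; have [] := mono2 j k.
  apply: ge_sup; first by exists (Im (P 0%N)), 0%N.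
  by move=> _ [j _ <-]; have [] := mono2 j k.
have zP k : in_square (P k) (t k) (Complex x y) by rewrite /in_square xP yP.
have [d Hd] : exists d, hasder f (Complex x y) d.
  by apply: Hf; have := zP 0%N; rewrite /= /t expr0 divr1.
have [r r0 Hr] := sqsum_small p s Hd e0.
have [k kr] : exists k, 2 * t k < r.
  have [k H] := exists_half_pow_lt (2 * s) r0.
  by exists k; move: H; rewrite /t exprVn mulrA.
apply: (Pbad k); exists 0%N => K _; apply: Hr => //; first exact: ltW.
by rewrite expn_gt0.
Qed.

End Goursat.

(** * The Cauchy estimate at the centre of a disc *)

Section CauchyEst.
Variable R : realType.
Local Notation C := (Cplx R).
Implicit Types (f g F : C -> C) (p v w z : C) (N : nat).
Local Notation Re := complex.Re.
Local Notation Im := complex.Im.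

Lemma sqsum_split_xy F N (a b h : R) : (0 < N)%N ->
  sqsum F (N + N) (Complex a b) (ofR (2 * h)) =
  sqsum F N (Complex a b) (ofR h) + sqsum F N (Complex (a + h) b) (ofR h) +
  sqsum F N (Complex a (b + h)) (ofR h) + sqsum F N (Complex (a + h) (b + h)) (ofR h).
Proof.
move=> N0; rewrite sqsum_split//.
have -> : ofR (2 * h) / 2 = ofR h.
  by rewrite ofRM (ofR_nat R 2) mulrC mulKf// pnatr_eq0.
by congr (_ + _ + _ + _); congr sqsum; apply: CE; rewrite !(cReD, cImD, cReM, cImM) /=; ring.
Qed.

(** The contour is centred at the origin, where the functions to be summed have
    an isolated singularity. *)
Definition csqsum F N (r : R) : C := sqsum F N (Complex (- r) (- r)) (ofR (2 * r)).

(** Cutting the large square into sixteen squares of side h, the twelve outer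
    ones avoid the origin, so that goursat applies to them, and the four inner
    ones form the small square. *)
Lemma csqsum_radius_step F (h e : R) : 0 < h -> 0 < e ->
  (forall z, in_square (Complex (- (2 * h)) (- (2 * h))) (4 * h) z -> z != 0 -> exists d, hasder F z d) ->
  exists K0, forall K, (K0 <= K)%N ->
    modulus (csqsum F (2 ^ K.+2) (2 * h) - csqsum F (2 ^ K.+1) h) <= e.
Proof.
move=> h0 e0 HF.
pose e' := e / 12 / h ^+ 2.
have e'0 : 0 < e' by rewrite !divr_gt0// exprn_gt0.
have G a b : (-(2 * h) <= a <= h) -> (-(2 * h) <= b <= h) ->
   [|| a == -(2 * h), a == h, b == -(2 * h) | b == h] ->
   \forall K \near \oo, modulus (sqsum F (2 ^ K) (Complex a b) (ofR h)) <= e / 12.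
  move=> ha hb hab.
  have [z|K0 HK0] := @goursat R F (Complex a b) h h0 _ e' e'0.
    rewrite /in_square /= => hz; apply: HF; first by rewrite /in_square /=; lra.
    apply: contraTneq hz => -> /=.
    by case/or4P : hab => /eqP ?; lra.
  exists K0 => // K /= /HK0; rewrite /e' divfK// gt_eqF ?exprn_gt0//.
have R1 : - (2 * h) <= - (2 * h) <= h by move: h0; clear; lra.
have R2 : - (2 * h) <= - h <= h by move: h0; clear; lra.
have R3 : - (2 * h) <= 0 <= h by move: h0; clear; lra.
have R4 : - (2 * h) <= h <= h by move: h0; clear; lra.
have e12 : e = e/12+e/12+e/12+e/12+e/12+e/12+e/12+e/12+e/12+e/12+e/12+e/12 by lra.
suff [K0 _ H] : \forall K \near \oo, modulus (csqsum F (2 ^ K.+2) (2 * h) - csqsum F (2 ^ K.+1) h) <= e.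
  by exists K0.
near=> K.
rewrite /csqsum.
rewrite -[X in (2 ^ X.+2)%N]add0n [(2 ^ (0+K).+2)%N]expnS mul2n -addnn.
rewrite sqsum_split_xy ?expn_gt0// add0n [(2 ^ K.+1)%N]expnS mul2n -addnn.
rewrite !sqsum_split_xy ?expn_gt0//.
have c1 : - (2 * h) + h = - h by ring.
have c2 : - (2 * h) + 2 * h = 0 by ring.
have c3 : - h + h = 0 :> R by ring.
have c4 : 0 + h = h by ring.
rewrite !(c1, c2, c3, c4).
pose c a b : C := sqsum F (2 ^ K) (Complex a b) (ofR h).
have md_le (x y : C) : x = y -> modulus y <= e -> modulus x <= e by move=> ->.
apply: (md_le _ (c (-(2*h)) (-(2*h)) + c (-h) (-(2*h)) + c (-(2*h)) (-h)
  + c 0 (-(2*h)) + c h (-(2*h)) + c h (-h)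
  + c (-(2*h)) 0 + c (-(2*h)) h + c (-h) h
  + c h 0 + c 0 h + c h h)); first by rewrite /c; ring.
rewrite [leRHS]e12 {md_le}; do 11 (apply: (le_trans (mdD _ _)); apply: lerD; last first;
  [rewrite /c; near: K; apply: G; by rewrite ?(R1, R2, R3, R4) ?eqxx ?orbT|]).
rewrite /c; near: K; apply: G; by rewrite ?(R1, R2, R3, R4) ?eqxx ?orbT.
Unshelve. all: by end_near.
Qed.

(** The discrete form of the independence of the contour: halving j times the
    contour round an isolated singularity at 0 changes the sums by little. *)
Lemma csqsum_radius F (h e : R) j : 0 < h -> 0 < e ->
  (forall z, in_square (Complex (- h) (- h)) (2 * h) z -> z != 0 -> exists d, hasder F z d) ->
  exists K0, forall K, (K0 <= K)%N ->
    modulus (csqsum F (2 ^ (K + j)) h - csqsum F (2 ^ K) (h / 2 ^+ j)) <= e.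
Proof.
move=> h0 + HF; elim: j e => [|j IH] e e0.
  by exists 0%N => K _; rewrite addn0 expr0 divr1 subrr md0 ltW.
have e2 : 0 < e / 2 by rewrite divr_gt0.
have [K1 H1] := IH _ e2.
pose h' := h / 2 ^+ j / 2.
have h'0 : 0 < h' by rewrite !divr_gt0// exprn_gt0.
have p2 : (1 : R) <= 2 ^+ j by rewrite exprn_ege1// ler1n.
have h'E : 2 * h' = h / 2 ^+ j by rewrite /h'; field; rewrite gt_eqF// (lt_le_trans ltr01).
have hh : 2 * h' <= h by rewrite h'E ler_pdivrMr ?(lt_le_trans ltr01)// ler_peMr// ltW.
have [z hz|K2 H2] := @csqsum_radius_step F h' _ h'0 e2.
  by apply: HF; move: hz; rewrite /in_square /=; lra.
exists (maxn K1 K2.+1) => [[|K]]; rewrite geq_max ?ltn0 ?andbF// ltnS => /andP[k1 k2].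
have -> : h / 2 ^+ j.+1 = h' by rewrite /h' exprSr; field; rewrite gt_eqF// (lt_le_trans ltr01).
have -> : csqsum F (2 ^ (K.+1 + j.+1)) h - csqsum F (2 ^ K.+1) h' =
  (csqsum F (2 ^ (K.+2 + j)) h - csqsum F (2 ^ K.+2) (h / 2 ^+ j)) +
  (csqsum F (2 ^ K.+2) (2 * h') - csqsum F (2 ^ K.+1) h').
  by rewrite h'E addnS addSn; ring.
rewrite [e]splitr; apply: (le_trans (mdD _ _)); apply: lerD; last exact: H2.
by apply: H1; rewrite (leq_trans k1).
Qed.

Lemma csqsum_bound F N (h M : R) : 0 < h -> 0 <= M ->
  (forall w, h <= modulus w <= 2 * h -> modulus (F w) <= M) ->
  modulus (csqsum F N h) <= 8 * (M * h).
Proof.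
move=> h0 M0 H; have -> : 8 * (M * h) = 4 * (M * (2 * h)) by ring.
apply: sqsum_bound => //; first by rewrite mulr_ge0// ltW.
move=> w [hw bw]; apply: H; apply/andP; split; last first.
  apply: (le_trans (md_le_ReIm _)); rewrite mulr2n mulrDl mul1r.
  by move: hw; rewrite /in_square /= => hw; apply: lerD; rewrite ler_norml; lra.
have : h <= `|Re w| \/ h <= `|Im w|.
  have hE : - h + 2 * h = h by ring.
  by case: bw => /= ->; [left|left|right|right]; rewrite ?hE ?normrN gtr0_norm.
case=> /le_trans; apply; [exact: Re_le_md|exact: Im_le_md].
Qed.

Lemma Im_inv (x y : R) : y != 0 ->
  Im ((Complex x y : C)^-1) = - y / (x ^+ 2 + y ^+ 2).
Proof.
move=> y0; have n0 : x ^+ 2 + y ^+ 2 != 0.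
  by rewrite gt_eqF// ltr_wpDl ?sqr_ge0// exprn_even_gt0.
have w0 : (Complex x y : C) != 0.
  by apply: contraNneq y0 => -[_ ->].
suff -> : (Complex x y : C)^-1 = Complex (x / (x ^+ 2 + y ^+ 2)) (- y / (x ^+ 2 + y ^+ 2)) by [].
apply: (mulfI w0); rewrite divff//; apply: CE; rewrite ?cReM ?cImM /=; field => //.
Qed.

(** The discrete counterpart of the winding number.  The four sides contribute
    equally because 1/z dz is invariant under rotation by a right angle, and on
    the lower side the imaginary part of each term is at least 1/N. *)
Lemma csqsum_inv N (h : R) : (0 < N)%N -> 0 < h -> 4 <= modulus (csqsum (fun w => w^-1) N h).
Proof.
move=> N0 h0; rewrite /csqsum; set p : C := Complex (- h) (- h); set v := ofR (2 * h).
have i2 := iC2 R.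
have i0 : iC R != 0 by rewrite -md_eq0 /modulus /= expr0n expr1n add0r sqrtr1 oner_eq0.
pose m := midsum (fun w => w^-1) N.
have rot q u : m (iC R * q) (iC R * u) = m q u.
  apply: eq_bigr => k _.
  have -> : iC R * q + ofR (midnode R N k) * (iC R * u) = iC R * (q + ofR (midnode R N k) * u) by ring.
  set X := q + _; rewrite invfM.
  have -> : (iC R)^-1 * X^-1 * (iC R * u / N%:R) = ((iC R)^-1 * iC R) * (X^-1 * (u / N%:R)) by ring.
  by rewrite mulVf// mul1r.
have -> : sqsum (fun w => w^-1) N p v = 4 * m p v.
  rewrite /sqsum -!/(m _ _).
  have -> : p + v = iC R * p.
    by apply: CE; rewrite ?(cReD, cImD, cReM, cImM) /=; ring.
  have -> : iC R * p + iC R * v = iC R * (iC R * p).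
    by apply: CE; rewrite ?(cReD, cImD, cReM, cImM) /=; ring.
  have -> : p + iC R * v = iC R * (iC R * (iC R * p)).
    by apply: CE; rewrite ?(cReD, cImD, cReM, cImM) /=; ring.
  have e1 : - v = iC R * (iC R * v) by rewrite mulrA i2 mulN1r.
  have e2 : - (iC R * v) = iC R * (iC R * (iC R * v)).
    by rewrite [RHS]mulrA i2 mulN1r.
  by rewrite e2 e1 !rot; ring.
rewrite mdM -(ofR_nat R 4) md_real ger0_norm// -[leLHS]mulr1 ler_wpM2l//.
apply: le_trans (Im_le_md _); apply: le_trans (ler_norm _).
have ImS (F : 'I_N -> C) : Im (\sum_(k < N) F k) = \sum_(k < N) Im (F k).
  by elim/big_rec2 : _ => // k y1 y2 _ <-; rewrite cImD.
rewrite /m /midsum ImS.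
have NR : (0 : R) < N%:R by rewrite ltr0n.
apply: (@le_trans _ _ (\sum_(k < N) N%:R^-1)).
  by rewrite sumr_const card_ord -[leRHS]mulr_natl divff// gt_eqF.
apply: ler_sum => k _.
have /andP[t0 t1] := midnode_itv R k; set t := midnode R N k in t0 t1 *.
have -> : p + ofR t * v = Complex ((2 * t - 1) * h) (- h).
  by apply: CE; rewrite ?(cReD, cImD, cReM, cImM) /=; ring.
have -> : v / N%:R = ofR (2 * h / N%:R) by rewrite -ofR_nat -ofRV -ofRM.
rewrite cImM Im_inv ?oppr_eq0 ?gt_eqF//= mulr0 add0r opprK sqrrN.
have -> : h / (((2 * t - 1) * h) ^+ 2 + h ^+ 2) * (2 * h / N%:R) =
  (2 / ((2 * t - 1) ^+ 2 + 1)) / N%:R.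
  have n0 : (2 * t - 1) ^+ 2 + 1 != 0 by rewrite gt_eqF// ltr_wpDl ?sqr_ge0.
  field; rewrite n0 !gt_eqF//= ?andbT.
  by rewrite ltr_wpDl ?sqr_ge0// exprn_gt0.
rewrite -[X in X <= _]mul1r; apply: ler_wpM2r; first by rewrite invr_ge0 ltW.
rewrite ler_pdivlMr; first by nra.
by rewrite ltr_wpDl ?sqr_ge0.
Qed.

(** The function F(z) = (f z - f 0)/z^2 behaves like d/z at 0.  Its sums round
    a tiny square are close to d times those of 1/z, hence of modulus at least
    almost 4 |d|; by csqsum_radius they are also the sums round the square of
    half-side r/3, where |F| is at most 2 B (3/r)^2. *)
Lemma cauchy_estimate0 f (r B : R) d : 0 < r ->
  (forall z, modulus z < r -> exists d, hasder f z d) ->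
  (forall z, modulus z < r -> modulus (f z) <= B) ->
  hasder f 0 d -> modulus d <= 12 * B / r.
Proof.
move=> r0 Hf HB H0.
have B0 : 0 <= B by apply: le_trans (md_ge0 (f 0)) _; apply: HB; rewrite md0.
pose h := r / 3.
have h0 : 0 < h by rewrite divr_gt0.
pose F z := (f z - f 0) * z ^- 2.
have HF z : in_square (Complex (- h) (- h)) (2 * h) z -> z != 0 -> exists d, hasder F z d.
  move=> hz z0; have zr : modulus z < r.
    apply: (le_lt_trans (md_le_ReIm _)); have -> : r = h + h + h by rewrite /h; field.
    apply: (@le_lt_trans _ _ (h + h)); last by rewrite ltrDl.
    by move: hz; rewrite /in_square /= => hz; apply: lerD; rewrite ler_norml; lra.
  have [d1 Hd1] := Hf _ zr.
  have z2 : z ^+ 2 != 0 by rewrite expf_neq0.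
  eexists; apply: hasderM; first exact: (hasderD Hd1 (hasder_cst (- f 0) _)).
  exact: (hasder_comp (f := fun w => w^-1) (g := fun w => w ^+ 2) (hasder_inv z2) (hasderX 2 z)).
apply/ler_addgt0Pr => e e0.
have e3 : 0 < e / 9 by rewrite divr_gt0.
have [s s0 Hs] := H0 _ e3.
have [j jP] : exists j, 2 * (h / 2 ^+ j) < s.
  have [k H] := exists_half_pow_lt (2 * h) s0.
  by exists k; move: H; rewrite exprVn mulrA.
have [K /(_ _ (leqnn _)) HK] := csqsum_radius j h0 e0 HF.
set N := (2 ^ K)%N in HK; have N0 : (0 < N)%N by rewrite expn_gt0.
set hj := h / 2 ^+ j in jP HK.
have hj0 : 0 < hj by rewrite divr_gt0// exprn_gt0.
have big : modulus (csqsum F (2 ^ (K + j)) h) <= 16 * B / h.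
  have -> : 16 * B / h = 8 * ((2 * B / h ^+ 2) * h) by field; rewrite gt_eqF.
  apply: csqsum_bound => //; first by rewrite divr_ge0 ?sqr_ge0// mulr_ge0.
  move=> w /andP[w1 w2]; rewrite mdM mdV mdX.
  have fw : modulus (f w - f 0) <= 2 * B.
    apply: (le_trans (mdD _ _)); rewrite mdN mulr2n mulrDl mul1r.
    apply: lerD; apply: HB; rewrite ?md0//.
    by apply: (le_lt_trans w2); rewrite /h; lra.
  apply: ler_pM => //; rewrite ?md_ge0 ?invr_ge0 ?exprn_ge0 ?md_ge0//.
  have mw := lt_le_trans h0 w1.
  rewrite lef_pV2 ?posrE ?exprn_gt0//.
  by rewrite lerXn2r ?nnegrE ?md_ge0 ?(ltW h0).
(* On the tiny square F differs from d/z by at most (e/9)/hj. *)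
have small : 4 * modulus d <= modulus (csqsum F N hj) + 8 * (e / 9).
  pose g z := F z - d * z^-1.
  have FE : csqsum F N hj = csqsum (fun w => d * w^-1) N hj + csqsum g N hj.
    rewrite /csqsum -sqsumD; congr (sqsum _ _ _ _); apply/funext => w.
    by rewrite /g addrC subrK.
  have dE : csqsum (fun w => d * w^-1) N hj = d * csqsum (fun w => w^-1) N hj.
    have mE q u : midsum (fun w => d * w^-1) N q u = d * midsum (fun w => w^-1) N q u.
      by rewrite /midsum mulr_sumr; apply: eq_bigr => k _; ring.
    by rewrite /csqsum /sqsum !mE; ring.
  have gb : modulus (csqsum g N hj) <= 8 * (e / 9).
    have -> : e / 9 = (e / 9 / hj) * hj by rewrite divfK// gt_eqF.
    apply: csqsum_bound => //; first by rewrite divr_ge0 ?(ltW hj0)// ltW.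
    move=> w /andP[w1 w2].
    have w0 : w != 0 by rewrite -md_gt0 (lt_le_trans hj0).
    have := Hs w; rewrite subr0 => /(_ (le_lt_trans w2 jP)) H.
    have -> : g w = (f w - f 0 - d * w) * w ^- 2 by rewrite /g /F; field.
    rewrite mdM mdV mdX.
    have mw : 0 < modulus w by rewrite md_gt0.
    rewrite ler_pdivrMr ?exprn_gt0//; apply: (le_trans H).
    have -> : e / 9 / hj * modulus w ^+ 2 = (e / 9 * modulus w) * (modulus w / hj) by ring.
    rewrite ler_peMr//; first by rewrite mulr_ge0 ?(ltW e3) ?md_ge0.
    by rewrite ler_pdivlMr// mul1r.
  have H4 : 4 * modulus d <= modulus (csqsum (fun w => d * w^-1) N hj).
    by rewrite dE mdM mulrC ler_wpM2l ?md_ge0// csqsum_inv.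
  apply: (le_trans H4); have -> : csqsum (fun w => d * w^-1) N hj = csqsum F N hj - csqsum g N hj.
    by rewrite FE addrK.
  by apply: (le_trans (mdD _ _)); rewrite mdN lerD2l.
have FN : modulus (csqsum F N hj) <= 16 * B / h + e.
  have -> : csqsum F N hj = csqsum F (2 ^ (K + j)) h - (csqsum F (2 ^ (K + j)) h - csqsum F N hj) by ring.
  by apply: (le_trans (mdD _ _)); rewrite mdN; apply: lerD.
have hE : 16 * B / h = 48 * (B / r) by rewrite /h; field; rewrite gt_eqF.
have -> : 12 * B / r = 12 * (B / r) by rewrite mulrA.
rewrite hE in FN; lra.
Qed.
End CauchyEst.

(** * Taylor and Borel-Caratheodory estimates *)

Section Taylor.
Variable R : realType.
Local Notation C := (Cplx R).
Implicit Types (f g : C -> C) (z w d : C).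
Local Notation Re := complex.Re.
Local Notation Im := complex.Im.

(** Cousin's lemma: if P 0 1 failed, then by gluing it would fail on one half of
    [0,1], and so on; the bad intervals shrink to a point x, where P holds on
    every short interval. *)
Lemma interval_induction (P : R -> R -> Prop) :
  (forall x, 0 <= x <= 1 -> exists2 r : R, 0 < r &
     forall s t, 0 <= s -> t <= 1 -> s <= x <= t -> t - s < r -> P s t) ->
  (forall s m t, s <= m -> m <= t -> P s m -> P m t -> P s t) -> P 0 1.
Proof.
move=> loc glue; apply: contrapT => bad.
pose t k : R := 2^-1 ^+ k.
have t0 k : 0 < t k by rewrite exprn_gt0.
have tS k : t k.+1 = t k / 2 by rewrite /t exprSr.
pose nx k s := if asbool (P s (s + t k.+1)) then s + t k.+1 else s.
pose S := fix S k := if k is k'.+1 then nx k' (S k') else 0.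
have SS k : S k.+1 = nx k (S k) by [].
have Sbad k : ~ P (S k) (S k + t k).
  elim: k => [|k IH]; first by rewrite /t expr0 add0r.
  rewrite SS /nx; case: asboolP => // H H'; apply: IH.
  apply: (glue _ _ _ _ _ H); rewrite ?lerDl ?(ltW (t0 _))//.
    by rewrite lerD2l tS; have := t0 k; lra.
  by move: H'; rewrite -addrA [t k.+1 + _](_ : _ = t k)// tS; lra.
have Sch k : S k <= S k.+1 /\ S k.+1 + t k.+1 <= S k + t k.
  rewrite SS /nx; have := t0 k; case: ifP; rewrite tS => _; lra.
have mono j k : (j <= k)%N -> S j <= S k /\ S k + t k <= S j + t j.
  move=> /subnKC <-; elim: (k - j)%N => [|m [a b]]; first by rewrite addn0.
  by rewrite addnS; have [a' b'] := Sch (j + m)%N; split; lra.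
have mono2 j k : S j <= S k + t k.
  have := t0 j; have := t0 k; case: (leqP j k) => [/mono|/ltnW/mono] []; lra.
pose x := sup (range S).
have xP k : S k <= x <= S k + t k.
  apply/andP; split.
    apply: ub_le_sup; last by exists k.
    by exists (S k + t k) => _ [j _ <-]; exact: mono2.
  apply: ge_sup; first by exists (S 0%N), 0%N.
  by move=> _ [j _ <-]; exact: mono2.
have [r r0 Hr] : exists2 r : R, 0 < r &
     forall s t, 0 <= s -> t <= 1 -> s <= x <= t -> t - s < r -> P s t.
  by apply: loc; have := xP 0%N; rewrite /= /t expr0 add0r.
have [k kr] : exists k, t k < r.
  by have [k] := exists_half_pow_lt 1 r0; rewrite mul1r; exists k.
apply: (Sbad k); apply: Hr => //; last by rewrite addrAC subrr add0r.
  by have [] := mono 0%N k (leq0n _).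
by have [_] := mono 0%N k (leq0n _); rewrite /= /t expr0 add0r.
Qed.

(** By interval_induction the increment over [s,t] is at most
    (M + e) |v| (t - s): locally by the definition of the derivative, and the
    bound is additive. *)
Lemma mvt_ineq f (M : R) z v :
  (forall t : R, 0 <= t <= 1 ->
     exists2 d, hasder f (z + ofR t * v) d & modulus d <= M) ->
  modulus (f (z + v) - f z) <= M * modulus v.
Proof.
move=> H; apply/ler_addgt0Pr => e e0.
pose g (t : R) := f (z + ofR t * v).
have m0 := md_ge0 v.
pose e' := e / (modulus v + 1).
have m1 : 0 < modulus v + 1 by lra.
have e'0 : 0 < e' by rewrite divr_gt0.
have v1 : e' * modulus v <= e.
  by rewrite /e' mulrAC ler_pdivrMr// ler_wpM2l ?(ltW e0)// lerDl.
have : modulus (g 1 - g 0) <= (M + e') * modulus v * (1 - 0).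
  apply: (@interval_induction (fun s t => modulus (g t - g s) <= (M + e') * modulus v * (t - s))).
    move=> x /H[d Hd dM]; have [r r0 Hr] := Hd _ e'0.
    exists (r / (modulus v + 1)); first by rewrite divr_gt0.
    have key (u : R) : `|u - x| < r / (modulus v + 1) ->
        modulus (g u - g x) <= (M + e') * modulus v * `|u - x|.
      move=> ux; rewrite /g.
      have E : z + ofR u * v - (z + ofR x * v) = ofR (u - x) * v.
        by rewrite ofRD ofRN; ring.
      have := Hr (z + ofR u * v); rewrite E mdM md_real => Hu.
      have lt : `|u - x| * modulus v < r.
        move: ux; rewrite ltr_pdivlMr//; apply: le_lt_trans.
        by rewrite ler_wpM2l// lerDl.
      have -> : f (z + ofR u * v) - f (z + ofR x * v) =
         (f (z + ofR u * v) - f (z + ofR x * v) - d * (ofR (u - x) * v)) + d * (ofR (u - x) * v).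
        by rewrite subrK.
      apply: (le_trans (mdD _ _)).
      have -> : (M + e') * modulus v * `|u - x| = e' * (`|u - x| * modulus v) + M * (`|u - x| * modulus v) by ring.
      apply: lerD; first exact: Hu.
      by rewrite !mdM md_real ler_wpM2r// mulr_ge0.
    move=> s t s0 t1 /andP[sx xt] ts.
    have -> : g t - g s = (g t - g x) - (g s - g x) by ring.
    apply: (le_trans (mdD _ _)); rewrite mdN.
    have -> : (M + e') * modulus v * (t - s) = (M + e') * modulus v * `|t - x| + (M + e') * modulus v * `|s - x|.
      by rewrite ger0_norm ?subr_ge0// ler0_norm ?subr_le0//; ring.
    by apply: lerD; apply: key; [rewrite ger0_norm ?subr_ge0//|rewrite ler0_norm ?subr_le0//]; lra.
  move=> s m t sm mt H1 H2.
  have -> : g t - g s = (g m - g s) + (g t - g m) by ring.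
  apply: (le_trans (mdD _ _)).
  have -> : (M + e') * modulus v * (t - s) = (M + e') * modulus v * (m - s) + (M + e') * modulus v * (t - m) by ring.
  exact: lerD.
rewrite /g ofR0 ofR1 mul0r mul1r addr0 subr0 mulr1 => /le_trans; apply.
by rewrite mulrDl lerD2l.
Qed.

Definition holo_on f z (r : R) := forall w, modulus (w - z) < r -> exists d, hasder f w d.

Lemma cauchy_estimate f z (r B : R) d : 0 < r -> holo_on f z r ->
  (forall w, modulus (w - z) < r -> modulus (f w) <= B) ->
  hasder f z d -> modulus d <= 12 * B / r.
Proof.
move=> r0 Hf HB Hd.
have zz w : z + 1 * w - z = w by ring.
apply: (@cauchy_estimate0 R (fun w => f (z + 1 * w))) => //.
- move=> w wr; have [|d' Hd'] := Hf (z + 1 * w); first by rewrite zz.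
  by exists (d' * 1); exact: hasder_aff.
- by move=> w wr; apply: HB; rewrite zz.
- apply: hasder_eq (hasder_aff (z := 0) (a := z) (b := 1) (d := d) _); rewrite ?mulr1//.
  by rewrite mulr0 addr0.
Qed.

(** The Cauchy estimate applied to w |-> f(w + a) - f(w), which is O(|a|) by
    mvt_ineq, shows that f' is Lipschitz at 0; integrating f' - d along [0,z]
    by mvt_ineq gives the quadratic bound.  For |z| > 1/4 the bound is
    trivial. *)
Lemma taylor2 f (B : R) d z : holo_on f 0 1 ->
  (forall w, modulus w < 1 -> modulus (f w) <= B) -> hasder f 0 d ->
  modulus z < 1 -> modulus (f z - f 0 - d * z) <= (24 * 48) * B * modulus z ^+ 2.
Proof.
move=> Hf HB Hd z1.
have B0 : 0 <= B by apply: le_trans (md_ge0 (f 0)) _; apply: HB; rewrite md0.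
have dB : modulus d <= 12 * B.
  rewrite -[leRHS]divr1; apply: cauchy_estimate Hd => // w; rewrite subr0; exact: HB.
have m0 := md_ge0 z.
have Bm : 0 <= B * modulus z by rewrite mulr_ge0.
have [z4|z4] := lerP (modulus z) (1/4); last first.
  apply: (@le_trans _ _ (14 * B)).
    apply: (le_trans (mdD _ _)); rewrite mdN mdM.
    have : modulus (f z - f 0) <= B + B.
      by apply: (le_trans (mdD _ _)); rewrite mdN; apply: lerD; apply: HB; rewrite ?md0.
    have : modulus d * modulus z <= 12 * B by apply: le_trans dB; rewrite ler_piMr ?md_ge0// ltW.
    lra.
  have : (1/4) ^+ 2 <= modulus z ^+ 2 by rewrite lerXn2r ?nnegrE ?md_ge0// ltW.
  by move=> /(ler_wpM2l B0); nra.
have der w dw : modulus w <= 3/4 -> hasder f w dw -> modulus dw <= 48 * B.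
  move=> w3 Hw; have -> : 48 * B = 12 * B / (1/4) by field.
  have w1 u : modulus (u - w) < 1/4 -> modulus u < 1.
    by move=> uw; have := mdBl u w; lra.
  apply: cauchy_estimate Hw => //; first by move=> u /w1 u1; apply: Hf; rewrite subr0.
  by move=> u /w1/HB.
have seg u (t : R) : 0 <= t <= 1 -> modulus (ofR t * u) <= modulus u.
  move=> /andP[t0 t1]; rewrite mdM md_real ger0_norm// ler_piMl ?md_ge0//.
have der2 (a da : C) : modulus a <= 1/4 -> hasder f a da -> modulus (da - d) <= (24 * 48) * B * modulus a.
  move=> a4 Ha; have -> : (24 * 48) * B * modulus a = 12 * (48 * B * modulus a) / (1/2) by field.
  have w1 w : modulus (w - 0) < 1/2 -> modulus (a + w) <= 3/4.
    by rewrite subr0 => ?; apply: (le_trans (mdD _ _)); lra.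
  apply: (@cauchy_estimate (fun w => f (a + 1 * w) + (-1) * f w) 0) => //.
  - move=> w w2; have [|d1 H1] := Hf (a + 1 * w).
      by rewrite mul1r subr0; apply: (le_lt_trans (w1 _ w2)); lra.
    have [|d2 H2] := Hf w; first by move: w2; rewrite !subr0; lra.
    eexists; apply: hasderD; first exact: hasder_aff H1.
    exact: (hasderM (hasder_cst _ _) H2).
  - move=> w w2; have -> : f (a + 1 * w) + -1 * f w = f (w + a) - f w.
      by rewrite mul1r mulN1r [a + w]addrC.
    apply: mvt_ineq => t t01.
    have H3 : modulus (w + ofR t * a) <= 3/4.
      have := seg a t t01; move: w2; rewrite subr0.
      by move=> ? ?; apply: (le_trans (mdD _ _)); lra.
    have [|d' Hd'] := Hf (w + ofR t * a); first by rewrite subr0; lra.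
    by exists d' => //; exact: der Hd'.
  - have := hasderD (hasder_aff (f := f) (z := 0) (a := a) (b := 1) (d := da) _) (hasderM (hasder_cst (-1) 0) Hd).
    rewrite mulr0 addr0 => /(_ Ha); apply: hasder_eq; ring.
have := @mvt_ineq (fun w => f w + (- d) * w) ((24 * 48) * B * modulus z) 0 z.
rewrite add0r mulr0 addr0.
have -> : f z + - d * z - f 0 = f z - f 0 - d * z by ring.
have -> : (24 * 48) * B * modulus z * modulus z = (24 * 48) * B * modulus z ^+ 2 by ring.
apply => t t01; rewrite add0r.
have sz := seg z t t01.
have [|d' Hd'] := Hf (ofR t * z); first by rewrite subr0; lra.
exists (d' - d).
  have := hasderD Hd' (hasderM (hasder_cst (- d) _) (hasder_id (ofR t * z))).
  by apply: hasder_eq; ring.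
apply: (le_trans (der2 _ _ _ Hd')); first by lra.
by rewrite ler_wpM2l// mulr_ge0.
Qed.

Lemma taylor2_at f z (r B : R) d w : 0 < r -> holo_on f z r ->
  (forall w, modulus (w - z) < r -> modulus (f w) <= B) -> hasder f z d ->
  modulus (w - z) < r -> modulus (f w - f z - d * (w - z)) <= (24 * 48) * B / r ^+ 2 * modulus (w - z) ^+ 2.
Proof.
move=> r0 Hf HB Hd wr.
have rC : ofR r != 0 by rewrite -md_eq0 md_real normr_eq0 gt_eqF.
pose g u := f (z + ofR r * u).
have gr u : modulus u < 1 -> modulus (z + ofR r * u - z) < r.
  have -> : z + ofR r * u - z = ofR r * u by ring.
  by move=> u1; rewrite mdM md_real gtr0_norm// gtr_pMr.
have Hg : hasder g 0 (d * ofR r) by apply: hasder_aff; rewrite mulr0 addr0.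
have wE : z + ofR r * ((w - z) / ofR r) = w by rewrite mulrC divfK// addrC subrK.
have m1 : modulus ((w - z) / ofR r) = modulus (w - z) / r by rewrite mdM mdV md_real gtr0_norm.
have := @taylor2 g B (d * ofR r) ((w - z) / ofR r) _ _ Hg.
rewrite /g wE mulr0 addr0 m1.
have -> : d * ofR r * ((w - z) / ofR r) = d * (w - z) by field.
have -> : (24 * 48) * B * (modulus (w - z) / r) ^+ 2 = (24 * 48) * B / r ^+ 2 * modulus (w - z) ^+ 2.
  by field; rewrite gt_eqF.
apply.
- move=> u; rewrite subr0 => /gr/Hf[d' Hd']; exists (d' * ofR r); exact: hasder_aff.
- by move=> u /gr/HB.
- by rewrite ltr_pdivrMr// mul1r.
Qed.

(** The Moebius map w |-> (w - g 0)/(w + conj (g 0)) carries the right half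
    plane to the unit disc, so that the Cauchy estimate applies to its
    composition with g, whose derivative at 0 is d/(2 Re (g 0)). *)
Lemma borel_caratheodory g (r : R) d : 0 < r -> holo_on g 0 r ->
  (forall w, modulus w < r -> 0 < Re (g w)) -> hasder g 0 d ->
  modulus d <= 24 * Re (g 0) / r.
Proof.
move=> r0 Hg Hpos Hd.
have g0 : 0 < Re (g 0) by apply: Hpos; rewrite md0.
pose c : C := Complex (Re (g 0)) (- Im (g 0)).
have cE : g 0 + c = ofR (2 * Re (g 0)).
  by apply: CE; rewrite ?cReD ?cImD /=; ring.
have nz w : modulus w < r -> g w + c != 0.
  move=> /Hpos Hw; apply: contraTneq Hw => gw0; have := cReD (g w) c; rewrite gw0 /= => H.
  by rewrite -leNgt; move: H g0; lra.
have two : ofR (2 * Re (g 0)) != 0 by rewrite -cE; apply: nz; rewrite md0.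
pose h w := (g w - g 0) * (g w + c)^-1.
have Hh w dw : modulus w < r -> hasder g w dw ->
    hasder h w (dw * (g w + c)^-1 + (g w - g 0) * (- (g w + c) ^- 2 * dw)).
  move=> wr Hw; apply: hasderM.
    by apply: hasder_eq (hasderD Hw (hasder_cst _ _)); rewrite addr0.
  apply: (hasder_comp (f := fun u => u^-1) (g := fun u => g u + c)).
    by apply: hasder_inv; exact: nz.
  by apply: hasder_eq (hasderD Hw (hasder_cst _ _)); rewrite addr0.
have : modulus (d / ofR (2 * Re (g 0))) <= 12 * 1 / r.
  apply: (@cauchy_estimate h 0) => //.
  - move=> w wr; have [dw Hw] := Hg _ wr; eexists; apply: Hh Hw.
    by move: wr; rewrite subr0.
  - move=> w; rewrite subr0 => wr; rewrite mdM mdV ler_pdivrMr ?mul1r ?md_gt0 ?nz//.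
    rewrite -(ler_pXn2r (n:=2)) ?nnegrE ?md_ge0// !sqr_md !(cReD, cImD, cReN, cImN) /=.
    by have := Hpos _ wr; nra.
  - have := Hh 0 d; rewrite md0 cE subrr mul0r addr0; apply => //.
rewrite mdM mdV md_real gtr0_norm ?mulr_gt0// ler_pdivrMr ?mulr_gt0//.
have -> : 12 * 1 / r * (2 * Re (g 0)) = 24 * Re (g 0) / r by ring.
by [].
Qed.
End Taylor.

(** * Ultralimits and normal families *)

(** A free ultrafilter gives a limit to every bounded sequence, all at once and
    compatibly with sums; pointwise limits of discs then exist without a
    diagonal argument. *)
Lemma exists_ultra : exists U : set_system nat, UltraFilter U /\ \oo `<=` U.
Proof. exact: ultraFilterLemma. Qed.
Definition free_uf : set_system nat := sval (cid exists_ultra).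
#[global] Instance free_uf_ultra : UltraFilter free_uf.
Proof. by rewrite /free_uf; case: cid => /= ? []. Qed.
#[global] Instance free_uf_proper : ProperFilter free_uf.
Proof. exact: ultra_proper. Qed.
Lemma free_uf_oo : \oo `<=` free_uf.
Proof. by rewrite /free_uf; case: cid => /= ? []. Qed.

Section Ultra.
Variable R : realType.
Local Notation C := (Cplx R).
Implicit Types (d : nat -> R).

(** The d k stand for distances, whence the absence of absolute values. *)
Definition ulim0 d := forall e : R, 0 < e -> \forall k \near free_uf, d k < e.

Lemma ulim0_le d d' : (\forall k \near free_uf, d k <= d' k) -> ulim0 d' -> ulim0 d.
Proof.
move=> H H' e e0; near=> k; apply: (@le_lt_trans _ _ (d' k)); first by near: k.
by near: k; exact: H'.
Unshelve. all: by end_near. Qed.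

Lemma ulim0_le_all d d' : (forall k, d k <= d' k) -> ulim0 d' -> ulim0 d.
Proof. by move=> H; apply: ulim0_le; near=> k. Unshelve. all: by end_near. Qed.

Lemma ulim0D d d' : ulim0 d -> ulim0 d' -> ulim0 (fun k => d k + d' k).
Proof.
move=> H H' e e0; have e2 : 0 < e / 2 by rewrite divr_gt0.
near=> k; rewrite [e]splitr; apply: ltrD; near: k; [exact: H|exact: H'].
Unshelve. all: by end_near. Qed.

Lemma ulim0Z (c : R) d : 0 <= c -> ulim0 d -> ulim0 (fun k => c * d k).
Proof.
move=> c0 H e e0; have c1 : 0 < c + 1 by lra.
have H' := H _ (divr_gt0 e0 c1); near=> k.
have : d k < e / (c + 1) by near: k; exact: H'.
have [d0|d0] := ltrP (d k) 0.
  by move=> _; apply: le_lt_trans e0; rewrite mulr_ge0_le0// ltW.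
rewrite ltr_pdivlMr//; apply: le_lt_trans; rewrite mulrC ler_wpM2l//; lra.
Unshelve. all: by end_near. Qed.

Lemma ulim0_cst : ulim0 (fun=> 0).
Proof. by move=> e e0; near=> k. Unshelve. all: by end_near. Qed.

Lemma ulim0_inv : ulim0 (fun k => k.+1%:R^-1).
Proof.
move=> e e0; apply: free_uf_oo.
have : (fun k => (k.+1%:R^-1 : R)) @ \oo --> (0 : R) by exact: cvg_harmonic.
move=> /cvgr0Pnorm_lt /(_ _ e0); apply: filterS => k /=.
by rewrite ger0_norm.
Qed.

Lemma ulim0_close d (l c : R) : (forall k, 0 <= d k) -> ulim0 d -> (forall k, l <= c + d k) -> l <= c.
Proof.
move=> d0 H H'; apply/ler_addgt0Pr => e /H He.
have /filter_ex[k dk] := He.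
by apply: (le_trans (H' k)); rewrite lerD2l ltW.
Qed.

(** Compactness of [-M, M] gives a cluster point, and for an ultrafilter a cluster
    point is a limit. *)
Lemma ulim_real (x : nat -> R) (M : R) : (\forall k \near free_uf, `|x k| <= M) ->
  exists l, ulim0 (fun k => `|x k - l|).
Proof.
move=> xM; have := @segment_compact R (- M) M.
move=> /(_ (x @ free_uf) _) [].
  by apply: filterS xM => k /=; rewrite in_itv /= ler_norml.
move=> l [_ /= xl]; exists l => e e0.
have [//|He] := in_ultra_setVsetC [set k | `|x k - l| < e] free_uf_ultra.
have /xl : (x @ free_uf) [set y | ~ (`|y - l| < e)] by exact: He.
move=> /(_ (ball l e) (nbhsx_ballx _ _ e0))[y [/= yl]].
by rewrite /ball /= distrC.
Qed.

Lemma ulim_cplx (x : nat -> C) (M : R) : (\forall k \near free_uf, modulus (x k) <= M) ->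
  exists l, ulim0 (fun k => modulus (x k - l)).
Proof.
move=> xM.
have [a Ha] : exists l, ulim0 (fun k => `|complex.Re (x k) - l|).
  by apply: (ulim_real (M := M)); apply: filterS xM => k; apply: le_trans (Re_le_md _).
have [b Hb] : exists l, ulim0 (fun k => `|complex.Im (x k) - l|).
  by apply: (ulim_real (M := M)); apply: filterS xM => k; apply: le_trans (Im_le_md _).
exists (Complex a b); apply: ulim0_le_all (ulim0D Ha Hb) => k.
by apply: (le_trans (md_le_ReIm _)); rewrite cReD cReN cImD cImN.
Qed.

Lemma ulim0_sum n (d : 'I_n -> nat -> R) : (forall j, ulim0 (d j)) -> ulim0 (fun k => \sum_j d j k).
Proof.
elim: n d => [|n IH] d H.
  by apply: ulim0_le_all ulim0_cst => k; rewrite big_ord0.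
apply: ulim0_le_all (ulim0D (H ord0) (IH (fun j => d (lift ord0 j)) _)) => [k|j]; last exact: H.
by rewrite big_ord_recl.
Qed.

Section Vec.
Variable n : nat.
Local Notation Cn := 'rV[C]_n.

Lemma ulim_vec (x : nat -> Cn) (M : R) : (\forall k \near free_uf, nrm (x k) <= M) ->
  exists l, ulim0 (fun k => nrm (x k - l)).
Proof.
move=> xM.
have H j : {l | ulim0 (fun k => modulus (x k 0 j - l))}.
  apply: cid; apply: (ulim_cplx (M := M)); apply: filterS xM => k; exact/le_trans/md_le_nrm.
exists (\row_j sval (H j)).
apply: ulim0_le_all (ulim0_sum (fun j => svalP (H j))) => k.
by rewrite /nrm le_eqVlt; apply/orP; left; apply/eqP; apply: eq_bigr => j _; rewrite !mxE.
Qed.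

Lemma ulim0_uniq (x : nat -> Cn) l l' : ulim0 (fun k => nrm (x k - l)) ->
  ulim0 (fun k => nrm (x k - l')) -> l = l'.
Proof.
move=> H H'; apply/eqP; rewrite -subr_eq0; apply/eqP/nrm_eq0/eqP.
rewrite eq_le nrm_ge0 andbT.
apply: (ulim0_close (d := fun k => nrm (x k - l) + nrm (x k - l'))) => [k||k].
- by rewrite addr_ge0// nrm_ge0.
- exact: ulim0D.
- by rewrite add0r; apply: (le_trans (nrm_tri _ (x k) _)); rewrite lerD2r nrmB.
Qed.

Definition hdisc (D : set Cn) (phi : C -> Cn) :=
  forall z, modulus z < 1 -> (exists d : Cn, vder phi z d) /\ D (phi z).

(** The discs of the definitions are those of the estimates. *)
Lemma hdiscP D phi : holo_disc D phi <-> hdisc D phi.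
Proof.
split=> H z z1.
  by have [/derivable_vder ? ?] := H z z1; split => //; eexists; eassumption.
by have [[d /vder_derivable ?] ?] := H z z1.
Qed.

Lemma hdisc_vder D phi z : hdisc D phi -> modulus z < 1 -> vder phi z (derive1 phi z).
Proof. by move=> H /H[[d Hd] _]; rewrite (vder_derive1 Hd). Qed.

Variables (D : set Cn) (B : R).
Hypothesis DB : forall z, D z -> nrm z <= B.

Lemma hdisc_der phi z : hdisc D phi -> modulus z < 1 ->
  nrm (derive1 phi z) <= n%:R * (12 * B / (1 - modulus z)).
Proof.
move=> H z1; apply: nrm_le => j.
have r0 : 0 < 1 - modulus z by rewrite subr_gt0.
have w1 w : modulus (w - z) < 1 - modulus z -> modulus w < 1.
  by move=> ?; have := mdBl w z; lra.
apply: (cauchy_estimate r0 (f := fun w => phi w 0 j) (z := z)).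
- by move=> w /w1/H[[d /(_ j)]]; exists (d 0 j).
- by move=> w /w1/H[_ /DB]; apply: le_trans; exact: md_le_nrm.
- exact: (hdisc_vder H z1).
Qed.

Lemma hdisc_taylor phi z w : hdisc D phi -> modulus z < 1 ->
  modulus (w - z) < 1 - modulus z ->
  nrm (phi w - phi z - (w - z) *: derive1 phi z) <=
    n%:R * (24 * 48 * B / (1 - modulus z) ^+ 2 * modulus (w - z) ^+ 2).
Proof.
move=> H z1 wz; apply: nrm_le => j.
have r0 : 0 < 1 - modulus z by rewrite subr_gt0.
have w1 u : modulus (u - z) < 1 - modulus z -> modulus u < 1.
  by move=> ?; have := mdBl u z; lra.
have -> : (phi w - phi z - (w - z) *: derive1 phi z) 0 j =
  phi w 0 j - phi z 0 j - (derive1 phi z) 0 j * (w - z) by rewrite !mxE; ring.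
apply: (taylor2_at r0 (f := fun w => phi w 0 j)) => //.
- by move=> u /w1/H[[d /(_ j)]]; exists (d 0 j).
- by move=> u /w1/H[_ /DB]; apply: le_trans; exact: md_le_nrm.
- exact: (hdisc_vder H z1).
Qed.

Lemma hdisc_lip phi z w : hdisc D phi -> modulus z < 1 ->
  modulus (w - z) < 1 - modulus z ->
  nrm (phi w - phi z) <= n%:R * (24 * 49 * B / (1 - modulus z)) * modulus (w - z).
Proof.
move=> H z1 wz; have m0 := md_ge0 (w - z).
have r0 : 0 < 1 - modulus z by rewrite subr_gt0.
have B0 : 0 <= B by have [_ /DB] := H z z1; apply: le_trans; exact: nrm_ge0.
have -> : phi w - phi z = (phi w - phi z - (w - z) *: derive1 phi z) + (w - z) *: derive1 phi z.
  by rewrite subrK.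
apply: (le_trans (nrmD _ _)); rewrite nrmZ.
have H1 := hdisc_taylor H z1 wz; have H2 := hdisc_der H z1.
have n0 : (0 : R) <= n%:R by [].
set r := 1 - modulus z in r0 wz H1 H2 *; set m := modulus (w - z) in m0 wz H1 *.
apply: (@le_trans _ _ (n%:R * (24 * 48 * B / r * m) + n%:R * (12 * B / r) * m)).
  apply: lerD; last by rewrite mulrC ler_wpM2r.
  apply: (le_trans H1); apply: ler_wpM2l => //.
  have -> : 24 * 48 * B / r ^+ 2 * m ^+ 2 = 24 * 48 * B / r * m * (m / r) by field; rewrite gt_eqF.
  rewrite ler_piMr//; last by rewrite ler_pdivrMr// mul1r ltW.
  by rewrite mulr_ge0// divr_ge0 ?(ltW r0)// mulr_ge0.
have -> : n%:R * (24 * 49 * B / r) * m = n%:R * (24 * 48 * B / r * m) + n%:R * (12 * B / r) * m + n%:R * (12 * B / r) * m.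
  by ring.
by rewrite lerDl mulr_ge0// mulr_ge0// divr_ge0 ?(ltW r0)// mulr_ge0.
Qed.

(** Montel's theorem.  The pointwise limit Phi exists because D is bounded.  The
    remainder in hdisc_taylor is bounded uniformly in k, so that it passes to the
    limit: Phi is differentiable, with derivative the limit of the
    derivatives.  Uniform Lipschitz bounds allow the evaluation points to move. *)
Lemma limit_disc (phi : nat -> C -> Cn) : (forall k, hdisc D (phi k)) ->
  exists Phi : C -> Cn,
  [/\ forall z, modulus z < 1 -> exists d : Cn, vder Phi z d,
      forall z, modulus z < 1 -> ulim0 (fun k => nrm (derive1 (phi k) z - derive1 Phi z)) &
      forall (a : nat -> C) z, modulus z < 1 -> ulim0 (fun k => modulus (a k - z)) ->
        ulim0 (fun k => nrm (phi k (a k) - Phi z)) ].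
Proof.
move=> H.
have L z : exists l, modulus z < 1 -> ulim0 (fun k => nrm (phi k z - l)).
  have [z1|z1] := pselect (modulus z < 1); last by exists 0 => /z1.
  have [l Hl] : exists l, ulim0 (fun k => nrm (phi k z - l)).
    by apply: (ulim_vec (M := B)); near=> k; apply: DB; have [] := H k z z1.
  by exists l.
have {L} [Phi HPhi] := choice L.
exists Phi.
have L' z : modulus z < 1 -> exists l, ulim0 (fun k => nrm (derive1 (phi k) z - l)).
  move=> z1; apply: (ulim_vec (M := n%:R * (12 * B / (1 - modulus z)))).
  by near=> k; exact: hdisc_der.
have P1 z (d : Cn) : modulus z < 1 -> ulim0 (fun k => nrm (derive1 (phi k) z - d)) -> vder Phi z d.
  move=> z1 Hd; apply/vder_nrm => e e0.
  have r0 : 0 < 1 - modulus z by rewrite subr_gt0.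
  have B0 : 0 <= B by have [_ /DB] := H 0%N z z1; apply: le_trans; exact: nrm_ge0.
  set K : R := n%:R * (24 * 48 * B / (1 - modulus z) ^+ 2).
  have K0 : 0 <= K.
    by rewrite /K; apply: mulr_ge0 => //; apply: divr_ge0; [apply: mulr_ge0|rewrite exprn_ge0// ltW].
  exists (Num.min (1 - modulus z) (e / (K + 1))).
    by rewrite lt_min r0 divr_gt0//; lra.
  move=> w; rewrite lt_min => /andP[wz wK].
  have w1 : modulus w < 1 by have := mdBl w z; lra.
  apply: (@le_trans _ _ (K * modulus (w - z) ^+ 2)); last first.
    rewrite expr2 mulrA ler_wpM2r ?md_ge0//.
    move: wK; rewrite ltr_pdivlMr; last by lra.
    move=> /ltW; apply: le_trans; rewrite mulrC ler_wpM2l ?md_ge0//; lra.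
  apply: (ulim0_close (d := fun k => nrm (phi k w - Phi w) + nrm (phi k z - Phi z) +
      modulus (w - z) * nrm (derive1 (phi k) z - d))).
  - by move=> k; rewrite !addr_ge0 ?mulr_ge0 ?nrm_ge0 ?md_ge0.
  - by apply: ulim0D; [apply: ulim0D; exact: HPhi|apply: ulim0Z => //; exact: md_ge0].
  - move=> k; have := hdisc_taylor (H k) z1 wz; rewrite mulrA -/K => T.
    have -> : Phi w - Phi z - (w - z) *: d =
      (phi k w - phi k z - (w - z) *: derive1 (phi k) z) +
      ((Phi w - phi k w) + (phi k z - Phi z) + (w - z) *: (derive1 (phi k) z - d)).
      by apply/rowP => j; rewrite !mxE; ring.
    apply: (le_trans (nrmD _ _)); apply: lerD => //.
    apply: (le_trans (nrmD _ _)); rewrite nrmZ; apply: lerD => //.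
    apply: (le_trans (nrmD _ _)); rewrite lerD2r le_eqVlt; apply/orP; left; apply/eqP; exact: nrmB.
split.
- by move=> z z1; have [d Hd] := L' z z1; exists d; exact: P1.
- by move=> z z1; have [d Hd] := L' z z1; rewrite (vder_derive1 (P1 z d z1 Hd)).
move=> a z z1 Ha.
have r0 : 0 < 1 - modulus z by rewrite subr_gt0.
have B0 : 0 <= B by have [_ /DB] := H 0%N z z1; apply: le_trans; exact: nrm_ge0.
set K : R := n%:R * (24 * 49 * B / (1 - modulus z)).
have K0 : 0 <= K by rewrite /K; apply: mulr_ge0 => //; apply: divr_ge0; [apply: mulr_ge0|exact: ltW].
apply: ulim0_le (ulim0D (ulim0Z K0 Ha) (HPhi z z1)).
near=> k.
apply: (le_trans (nrm_tri _ (phi k z) _)); apply: lerD => //.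
apply: hdisc_lip => //; near: k; exact: Ha.
Unshelve. all: by end_near. Qed.

End Vec.
End Ultra.

(** * The boundary of a C^1 domain *)

Section Geometry.
Variable R : realType.
Local Notation C := (Cplx R).
Variable n : nat.
Local Notation Cn := 'rV[C]_n.
Local Notation R2n := 'rV[R]_(n + n).
Implicit Types (x y z v w : Cn).

(** By nbhs_nrm these are the points of the topological closure. *)
Definition clos (D : set Cn) x := forall e : R, 0 < e -> exists2 y, D y & nrm (y - x) < e.

Lemma realifyD v w : realify (v + w) = realify v + realify w.
Proof.
rewrite /realify add_row_mx; congr row_mx; apply/rowP => j; rewrite !mxE.
  exact: cReD.
exact: cImD.
Qed.
Lemma realifyB v w : realify (v - w) = realify v - realify w.
Proof.
have -> : realify v - realify w = realify (v - w + w) - realify w by rewrite subrK.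
by rewrite [in RHS]realifyD addrK.
Qed.
Lemma realifyZ (l : C) v : realify (l *: v) =
  complex.Re l *: realify v + complex.Im l *: realify (iC R *: v).
Proof.
rewrite /realify !scale_row_mx add_row_mx; congr row_mx; apply/rowP => j; rewrite !mxE.
  by rewrite !cReM /=; ring.
by rewrite !cImM /=; ring.
Qed.
Lemma norm_realify v : `|realify v| <= nrm v.
Proof.
rewrite /Num.norm /= mx_normrE.
apply/bigmax_leP; split; first exact: nrm_ge0.
move=> [i j] _ /=; rewrite /realify mxE; case: splitP => k _; rewrite mxE.
  by apply: (le_trans (Re_le_md _)); rewrite (ord1 i) md_le_nrm.
by apply: (le_trans (Im_le_md _)); rewrite (ord1 i) md_le_nrm.
Qed.

Lemma realify_surj (u : R2n) : exists v : Cn, realify v = u.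
Proof.
exists (\row_j Complex (lsubmx u 0 j) (rsubmx u 0 j)).
rewrite /realify -[RHS]hsubmxK; congr row_mx; apply/rowP => j; by rewrite !mxE.
Qed.

Lemma nbhs_real (u : R2n) (A : set R2n) : nbhs u A ->
  exists2 e : R, 0 < e & forall y : R2n, `|y - u| < e -> A y.
Proof.
by move=> /nbhs_normP[e /= e0 H]; exists e => // y yu; apply: H; rewrite /= distrC.
Qed.

(** The mean value theorem on the segment from u to u + w. *)
Lemma real_segment_decr (r : R2n -> R) (u w : R2n) :
  (forall s : R, 0 <= s <= 1 -> differentiable r (u + s *: w) /\ 'd r (u + s *: w) w < 0) ->
  r (u + w) < r u.
Proof.
move=> H; pose g (s : R) := r (u + s *: w).
have D (s : R) : 0 <= s <= 1 -> is_derive s 1 g ('d r (u + s *: w) w).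
  move=> /H[dr _]; have dw := diff_derivable (v := w) dr.
  have E : (fun h : R => h^-1 *: ((g \o shift (s : R^o)) (h *: (1 : R^o)) - g s : R^o)) =
           (fun h : R => h^-1 *: ((r \o shift (u + s *: w)) (h *: w) - r (u + s *: w) : R^o)).
    apply/funext => h /=; congr (_ *: (r _ - _)).
    by rewrite [h%:A]mulr1 scalerDl addrCA addrC -!addrA addrCA.
  apply: DeriveDef; first by rewrite /derivable E; exact: dw.
  by rewrite -deriveE// /derive E.
have [||c c01] := @MVT R g (fun s => 'd r (u + s *: w) w) 0 1 ltr01.
- by move=> s; rewrite in_itv /= => /andP[a b]; apply: D; rewrite !ltW.
- apply: derivable_within_continuous => s; rewrite in_itv /= => s01.
  by have := D s s01; case.
rewrite /g scale0r addr0 scale1r subr0 mulr1 => E.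
rewrite -subr_lt0 E; apply: (H c _).2.
by move: c01; rewrite in_itv /= => /andP[a b]; rewrite !ltW.
Qed.

Definition clinear (L : Cn -> C) := (forall v w, L (v + w) = L v + L w) /\
  (forall (a : C) v, L (a *: v) = a * L v).

Lemma clinear_bound (L : Cn -> C) : clinear L ->
  exists2 M : R, 0 <= M & forall v, modulus (L v) <= M * nrm v.
Proof.
move=> [LD LZ].
have L0 : L 0 = 0 by have := LZ 0 0; rewrite scale0r mul0r.
exists (\sum_j modulus (L (delta_mx 0 j))); first by apply: sumr_ge0 => j _; exact: md_ge0.
move=> v; rewrite [in leLHS](row_sum_delta v).
rewrite (big_morph L LD L0); apply: (le_trans (md_sum _ _ _)).
rewrite mulr_suml; apply: ler_sum => j _; rewrite LZ mdM mulrC.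
by rewrite ler_wpM2l ?md_ge0 ?md_le_nrm.
Qed.

(** A cone condition uniform over the points of the closure near p0: moving from
    them by l nu, with l in a sector around the positive reals, leads into D. *)
Definition cone_at (D : set Cn) (nu p0 : Cn) (rho kap : R) :=
  forall x (l : C), clos D x -> nrm (x - p0) < rho -> 0 < complex.Re l ->
    `|complex.Im l| <= kap * complex.Re l -> modulus l < rho -> D (x + l *: nu).

(** To first order at p, D lies on the side Re L >= 0, and nu is transverse to
    the complex hyperplane L = 0. *)
Definition normal_at (D : set Cn) (nu p : Cn) :=
  exists L : Cn -> C, [/\ clinear L, L nu != 0 &
    forall eta : R, 0 < eta -> exists2 tau : R, 0 < tau &
      forall x, D x -> nrm (x - p) < tau -> - (eta * nrm (x - p)) <= complex.Re (L (x - p))].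

Lemma clos_sub (D : set Cn) x : D x -> clos D x.
Proof. by move=> Dx e e0; exists x => //; rewrite subrr nrm0. Qed.

(** Let r be a local defining function.  A vector nu with dr(nu) < 0 at p0 has
    dr(nu) < -m nearby, while dr(i nu) stays bounded; in a narrow sector dr(l nu)
    is therefore negative along the segment from x to x + l nu and r decreases
    from r x <= 0.  At a boundary point p, where r vanishes, L is the
    complex-linear form whose real part is -dr. *)
Lemma C1_geom (D : set Cn) : open D -> C1_smooth D -> forall p0, clos D p0 -> ~ D p0 ->
  exists nu rho kap, [/\ 0 < rho, 0 < kap, cone_at D nu p0 rho kap &
    forall p, clos D p -> ~ D p -> nrm (p - p0) < rho -> normal_at D nu p].
Proof.
move=> oD sD p0 cp0 Np0.
have [|U [r [oU Up0 [dr cdr] nz HU]]] := sD p0.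
  split; last by rewrite (interior_id _).1.
  move=> B /nbhs_nrm[e e0 HB]; have [y Dy ye] := cp0 e e0.
  by exists y; split => //; apply: HB.
have [v0 v0nz] := nz _ Up0.
have [v1 v1neg] : exists v : R2n, 'd r (realify p0) v < 0.
  case: (ltrgtP ('d r (realify p0) v0) 0) => H; first by exists v0.
    by exists (- v0); rewrite linearN oppr_lt0.
  by rewrite H eqxx in v0nz.
have [nu nuE] := realify_surj v1; rewrite -nuE in v1neg.
set a := realify nu in v1neg; set b := realify (iC R *: nu).
pose m := - 'd r (realify p0) a / 2.
have m0 : 0 < m by rewrite divr_gt0// oppr_gt0.
pose M := `|'d r (realify p0) b| + 1.
have M0 : 0 < M by rewrite ltr_wpDl.
have [e e0 He] : exists2 e : R, 0 < e & forall y : R2n, `|y - realify p0| < e ->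
   [/\ U y, 'd r y a < - m & `|'d r y b| < M].
  apply: nbhs_real; near=> y; split; near: y.
  - exact: open_nbhs_nbhs.
  - have := cdr a _ Up0; move=> /(_ [set t : R | t < - m]); apply.
    by apply: open_nbhs_nbhs; split; [exact: open_lt|rewrite /= /m; lra].
  - have := cdr b _ Up0; move=> /(_ [set t : R | `|t| < M]); apply.
    apply: open_nbhs_nbhs; split; last by rewrite /= /M ltrDl.
    rewrite (_ : [set _ | _] = ball (0 : R) M); first exact: ball_open.
    by apply/seteqP; split => t /=; rewrite /ball /= sub0r normrN.
have near_p0 x : nrm (x - p0) < e -> `|realify x - realify p0| < e.
  by rewrite -realifyB; apply: le_lt_trans; exact: norm_realify.
have rcont x : nrm (x - p0) < e -> clos D x -> r (realify x) <= 0.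
  move=> /near_p0/He[Ux _ _] cx; rewrite leNgt; apply/negP => rx.
  have rc := differentiable_continuous (dr _ Ux).
  have : nbhs (realify x) [set y | U y /\ 0 < r y].
    near=> y; split; near: y; first exact: open_nbhs_nbhs.
    apply: (rc [set t : R | 0 < t]); apply: open_nbhs_nbhs; split => //; exact: open_gt.
  move=> /nbhs_real[d d0 Hd]; have [y Dy yx] := cx d d0.
  have [|Uy] := Hd (realify y).
    by rewrite -realifyB; apply: le_lt_trans yx; exact: norm_realify.
  by move: Dy => /(HU _ Uy) y1; rewrite ltNge ltW.
have K0 : 0 < nrm nu + 1 by rewrite ltr_wpDl ?nrm_ge0.
pose rho := e / 2 / (nrm nu + 1).
have rho0 : 0 < rho by rewrite !divr_gt0.
have rhoe : rho <= e / 2.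
  by rewrite /rho ler_pdivrMr// ler_peMr ?divr_ge0 ?(ltW e0)// lerDr nrm_ge0.
have rhonu : rho * nrm nu <= e / 2.
  by rewrite /rho mulrAC ler_pdivrMr// ler_wpM2l ?divr_ge0 ?(ltW e0)// lerDl.
exists nu, rho, (m / (2 * M)); split => //; first by rewrite divr_gt0// mulr_gt0.
- move=> x l cx xp l0 lk lr.
  have xe : nrm (x - p0) < e by apply: lt_trans xp _; lra.
  have rx := rcont x xe cx.
  have lnu : modulus l * nrm nu <= rho * nrm nu by rewrite ler_wpM2r ?nrm_ge0// ltW.
  have seg (s : R) : 0 <= s <= 1 -> `|realify x + s *: realify (l *: nu) - realify p0| < e.
    move=> /andP[s0 s1]; rewrite addrAC; apply: (le_lt_trans (ler_normD _ _)).
    have H1 : `|realify x - realify p0| < rho.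
      by rewrite -realifyB; apply: le_lt_trans xp; exact: norm_realify.
    have H2 : `|s *: realify (l *: nu)| <= e / 2.
      rewrite normrZ ger0_norm//; apply: (@le_trans _ _ (nrm (l *: nu))).
        by apply: le_trans (norm_realify _); rewrite ler_piMl.
      by rewrite nrmZ; move: lnu rhonu; clear; lra.
    by move: H1 H2 rhoe; clear; lra.
  have Ux1 : U (realify (x + l *: nu)).
    have [|//] := He (realify (x + l *: nu)).
    by have := seg 1; rewrite scale1r realifyD; apply; rewrite ler01 lexx.
  apply/(HU _ Ux1); apply: lt_le_trans rx; rewrite realifyD.
  apply: real_segment_decr => s /seg/He[Us da db]; split; first exact: dr.
  have -> : 'd r (realify x + s *: realify (l *: nu)) (realify (l *: nu)) =
      complex.Re l * 'd r (realify x + s *: realify (l *: nu)) a +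
      complex.Im l * 'd r (realify x + s *: realify (l *: nu)) b :> R.
    by rewrite [X in 'd r _ X]realifyZ linearD !linearZ.
  set da' := ('d r _ a : R) in da *; set db' := ('d r _ b : R) in db *.
  have H1 : complex.Im l * db' <= (m / (2 * M) * complex.Re l) * M.
    by apply: (le_trans (ler_norm _)); rewrite normrM; apply: ler_pM => //; exact: ltW.
  have H2 : m / (2 * M) * complex.Re l * M = m / 2 * complex.Re l by field; rewrite gt_eqF.
  have H3 : complex.Re l * da' < complex.Re l * (- m) by rewrite ltr_pM2l.
  have H4 : 0 < complex.Re l * m by rewrite mulr_gt0.
  clear - H1 H2 H3 H4; lra.
- move=> p cp Np pp0.
  have pe : nrm (p - p0) < e by apply: lt_trans pp0 _; lra.
  have [Up da db] := He _ (near_p0 _ pe).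
  have rp : r (realify p) = 0.
    apply/eqP; rewrite eq_le rcont//= leNgt; apply/negP => /(HU _ Up); exact: Np.
  pose d v : R := 'd r (realify p) (realify v).
  have dD v w : d (v + w) = d v + d w by rewrite /d realifyD linearD.
  have dZ l v : d (l *: v) = complex.Re l * d v + complex.Im l * d (iC R *: v).
    by rewrite /d realifyZ linearD !linearZ.
  exists (fun v => Complex (- d v) (d (iC R *: v))); split.
  + split=> [v w|l v]; first by apply: CE; rewrite ?cReD ?cImD /= ?scalerDr dD; ring.
    have dii : d (iC R *: (iC R *: v)) = - d v by rewrite scalerA iC2 dZ /=; ring.
    apply: CE; rewrite ?cReM ?cImM /=; first by rewrite dZ; ring.
    by rewrite scalerA mulrC -scalerA dZ dii; ring.
  + apply/eqP => /(congr1 (@complex.Re R)) /= dnu.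
    have {}dnu : - d nu = 0 := dnu.
    have dn : d nu < - m := da.
    by clear - dnu dn m0; lra.
  + move=> eta eta0; have := diff_locally (dr _ Up) => /eqaddoP /(_ _ eta0).
    move=> /nbhs_real[tau tau0 Ht].
    exists (Num.min tau (e - nrm (p - p0))); first by rewrite lt_min tau0 subr_gt0.
    move=> x Dx; rewrite lt_min => /andP[xt xe].
    have xt' : `|realify (x - p) - 0| < tau.
      by rewrite subr0; apply: le_lt_trans xt; exact: norm_realify.
    have := Ht _ xt'; rewrite /= !fctE /= rp => H.
    have rx : r (realify (x - p) + realify p) < 0.
      rewrite -realifyD subrK; apply/(HU _ _) => //.
      have [|//] := He (realify x); apply: near_p0.
      by move: (nrm_tri x p p0) xe; clear; lra.
    have H2 := norm_realify (x - p).
    have {}H := le_trans H (ler_wpM2l (ltW eta0) H2).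
    move: H; rewrite ler_norml -/(d (x - p)) => /andP[H _].
    have {}H : - (eta * nrm (x - p)) <= r (realify (x - p) + realify p) - (0 + d (x - p)) := H.
    by clear - H rx; move: (d _) (r _) (eta * _) H rx => A E F; lra.
Unshelve. all: by end_near. Qed.
End Geometry.

(** * Discs that touch the boundary to second order *)

Section ExitPoint.
Variable R : realType.
Local Notation C := (Cplx R).
Variable n : nat.
Local Notation Cn := 'rV[C]_n.
Local Notation Re := complex.Re.
Local Notation Im := complex.Im.

Lemma open_nrm (D : set Cn) x : open D -> D x ->
  exists2 e : R, 0 < e & forall y, nrm (y - x) < e -> D y.
Proof. by move=> oD Dx; apply/nbhs_nrm; exact: open_nbhs_nbhs. Qed.

Lemma vder_cont (f : C -> Cn) z (d : Cn) : vder f z d -> forall e : R, 0 < e ->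
  exists2 r : R, 0 < r & forall w, modulus (w - z) < r -> nrm (f w - f z) < e.
Proof.
move=> /vder_nrm /(_ 1 ltr01)[r r0 Hr] e e0.
have d1 : 0 < nrm d + 1 by rewrite ltr_wpDl ?nrm_ge0.
exists (Num.min r (e / (nrm d + 1))); first by rewrite lt_min r0 divr_gt0.
move=> w; rewrite lt_min => /andP[/Hr H]; rewrite ltr_pdivlMr//.
apply: le_lt_trans; have -> : f w - f z = (f w - f z - (w - z) *: d) + (w - z) *: d.
  by rewrite subrK.
apply: (le_trans (nrmD _ _)); rewrite nrmZ mulrDr mulr1 addrC lerD2l.
by rewrite mul1r in H.
Qed.

(** Interval induction along [0, z1]: if no such z0 existed then, near each point of
    the segment, Phi would stay in D or stay outside D. *)
Lemma exit_point (D : set Cn) (Phi : C -> Cn) z1 : open D ->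
  (forall z, modulus z < 1 -> exists d : Cn, vder Phi z d) ->
  D (Phi 0) -> modulus z1 < 1 -> ~ D (Phi z1) ->
  exists z0, [/\ modulus z0 < 1, ~ D (Phi z0) &
    forall e : R, 0 < e -> exists z, modulus (z - z0) < e /\ D (Phi z)].
Proof.
move=> oD hol D0 z11 N1; apply: contrapT => no.
apply: N1; suff : D (Phi (ofR 0 * z1)) -> D (Phi (ofR 1 * z1)).
  by rewrite ofR0 ofR1 mul0r mul1r; exact.
apply: (@interval_induction R (fun s t => D (Phi (ofR s * z1)) -> D (Phi (ofR t * z1)))); last first.
  by move=> s m t _ _ H1 H2 /H1/H2.
have Z : 0 < modulus z1 + 1 by rewrite ltr_wpDl ?md_ge0.
move=> x /andP[x0 x1].
have xz : modulus (ofR x * z1) < 1.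
  by rewrite mdM md_real ger0_norm//; apply: le_lt_trans z11; rewrite ler_piMl ?md_ge0.
have [d Hd] := hol _ xz.
have dist (s r : R) : `|s - x| < r / (modulus z1 + 1) -> modulus (ofR s * z1 - ofR x * z1) < r.
  rewrite ltr_pdivlMr//; apply: le_lt_trans.
  rewrite -mulrBl -ofRN -ofRD mdM md_real; apply: ler_wpM2l => //; by rewrite lerDl.
have [Dx|Nx] := pselect (D (Phi (ofR x * z1))).
  have [e e0 He] := open_nrm oD Dx; have [r r0 Hr] := vder_cont Hd e0.
  exists (r / (modulus z1 + 1)); first by rewrite divr_gt0.
  move=> s t s0 t1 /andP[sx xt] ts _; apply/He/Hr/dist.
  by rewrite ger0_norm ?subr_ge0//; lra.
have [e e0 He] : exists2 e : R, 0 < e & forall z, modulus (z - ofR x * z1) < e -> ~ D (Phi z).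
  apply: contrapT => H; apply: no; exists (ofR x * z1); split => // e e0.
  by apply: contrapT => H'; apply: H; exists e => // z ze Dz; apply: H'; exists z.
exists (e / (modulus z1 + 1)); first by rewrite divr_gt0.
move=> s t s0 t1 /andP[sx xt] ts Ds; exfalso; apply: He Ds; apply: dist.
by rewrite ler0_norm ?subr_le0//; lra.
Qed.

(** The factor 1 + 2 w is chosen so that the weight 1 + eps s^2 grows faster than
    |1 + 2 w|: both have the same first order part 1 + 2 Re w, and the second order
    part gamma |h|^2 of the weight beats that of the modulus, which is small once
    4 gamma s1^2 <= 1. *)
Lemma weight_gain (v1 h : C) (eps : R) : 0 < eps ->
  let s1 := modulus v1 in let gam := eps / (1 + eps * s1 ^+ 2) in
  4 * (gam * s1 ^+ 2) <= 1 ->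
  modulus (1 + 2 * (ofR gam * conjc v1 * h)) + gam / 2 * modulus h ^+ 2 <=
  (1 + eps * modulus (v1 + h) ^+ 2) / (1 + eps * s1 ^+ 2).
Proof.
move=> e0 s1 gam g1; set w := ofR gam * conjc v1 * h.
have q0 : 0 < 1 + eps * s1 ^+ 2 by rewrite ltr_pwDl// mulr_ge0 ?sqr_ge0// ltW.
have gam0 : 0 < gam by rewrite divr_gt0.
have wm : modulus w ^+ 2 = gam * (gam * s1 ^+ 2) * modulus h ^+ 2.
  have -> : modulus w = gam * s1 * modulus h.
    rewrite /w !mdM md_real gtr0_norm//; congr (_ * _ * _).
    by rewrite /s1; case: (v1) => a b; rewrite /modulus /= sqrrN.
  by ring.
have H1 : modulus (1 + 2 * w) <= 1 + 2 * Re w + 2 * modulus w ^+ 2.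
  have : 2 * modulus (1 + 2 * w) <= 1 + modulus (1 + 2 * w) ^+ 2.
    by have := sqr_ge0 (modulus (1 + 2 * w) - 1); lra.
  have two : (2 : C) = ofR 2 by rewrite (ofR_nat R 2).
  rewrite two !sqr_md !(cReD, cImD, cReM, cImM) /=; lra.
have H2 : (1 + eps * modulus (v1 + h) ^+ 2) / (1 + eps * s1 ^+ 2) =
    1 + 2 * Re w + gam * modulus h ^+ 2.
  have qn : 1 + eps * s1 ^+ 2 != 0 by rewrite gt_eqF.
  have qn2 : 1 + eps * (Re v1 ^+ 2 + Im v1 ^+ 2) != 0 by rewrite -sqr_md; exact: qn.
  apply: (mulIf qn); rewrite divfK ?gt_eqF//.
  have -> : Re w = gam * (Re v1 * Re h + Im v1 * Im h).
    by rewrite /w; case: (v1) => a b; case: (h) => x y /=; ring.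
  rewrite /gam /s1 !sqr_md cReD cImD; field.
  exact: qn2.
have m0 := sqr_ge0 (modulus h).
have H3 : modulus w ^+ 2 <= gam / 4 * modulus h ^+ 2.
  rewrite wm ler_wpM2r// ler_wpM2l ?(ltW gam0)//; lra.
rewrite H2; lra.
Qed.

Lemma cvg_of_ulim0 (x : nat -> R) l : ulim0 (fun k => `|x k - l|) -> x @ free_uf --> l.
Proof.
move=> H; apply/cvgrPdist_lt => e e0; near=> k; rewrite distrC; near: k; exact: H.
Unshelve. all: by end_near. Qed.

Lemma ulim0_md (x : nat -> C) l a : ulim0 (fun k => modulus (x k - l)) ->
  (fun k => modulus (x k - a)) @ free_uf --> modulus (l - a).
Proof.
move=> H; apply: cvg_of_ulim0; apply: ulim0_le_all H => k; rewrite ler_norml.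
have := mdBl (x k - a) (l - a); have := mdBl (l - a) (x k - a).
have -> : x k - a - (l - a) = x k - l by ring.
have -> : l - a - (x k - a) = l - x k by ring.
rewrite [modulus (l - x k)]mdB; lra.
Qed.
End ExitPoint.

Section MinimalExit.
Variable R : realType.
Local Notation C := (Cplx R).
Variable n : nat.
Local Notation Cn := 'rV[C]_n.
Local Notation Re := complex.Re.
Local Notation Im := complex.Im.
Variables (D : set Cn) (Phi : C -> Cn) (nu : Cn) (zc : C) (a b t eps : R) (A : nat).
Hypotheses (oD : open D) (a0 : 0 < a) (eps0 : 0 < eps).
Hypothesis hol : forall z, a <= modulus (z - zc) <= b -> exists d : Cn, vder Phi z d.

(** The disc is first lifted by t nu, so that an exit point of Phi gives the
    exit pair with l = -t. *)
Definition exit_pair z (l : C) := a <= modulus (z - zc) <= b /\ ~ D (Phi z + (ofR t + l) *: nu).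
(** The power A repels minimizers from the outer circle of the annulus, and the
    convex denominator turns minimality into quadratic room. *)
Definition weighted_gap z (l : C) : R := modulus l * modulus (z - zc) ^+ A / (1 + eps * modulus (z - zc) ^+ 2).

Lemma weighted_gap_ge0 z l : 0 <= weighted_gap z l.
Proof.
by rewrite /weighted_gap divr_ge0 ?mulr_ge0 ?exprn_ge0 ?md_ge0// addr_ge0// mulr_ge0 ?sqr_ge0// ltW.
Qed.

(** Exit pairs of bounded weighted gap form a compact set, since D is open and the
    weight is bounded below on the annulus by a positive constant. *)
Lemma minimizer z0 l0 : exit_pair z0 l0 ->
  exists z1 l1, exit_pair z1 l1 /\ forall z l, exit_pair z l -> weighted_gap z1 l1 <= weighted_gap z l.
Proof.
move=> K0.
pose S := [set y | exists z l, exit_pair z l /\ y = weighted_gap z l].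
have Slb : lbound S 0 by move=> _ [z [l [_ ->]]]; exact: weighted_gap_ge0.
have S0 : has_inf S by split; [exists (weighted_gap z0 l0), z0, l0|exists 0].
have near_inf k : exists zl : C * C, exit_pair zl.1 zl.2 /\ weighted_gap zl.1 zl.2 < inf S + k.+1%:R^-1.
  have k0 : (0 : R) < k.+1%:R^-1 by rewrite invr_gt0.
  by have [_ [z [l [Kz ->]]] lt] := inf_adherent k0 S0; exists (z, l).
have [x Hx] := choice near_inf.
pose z k := (x k).1; pose l k := (x k).2.
have Kk k : exit_pair (z k) (l k) by have [] := Hx k.
have Fk k : weighted_gap (z k) (l k) < inf S + k.+1%:R^-1 by have [] := Hx k.
have [z1 Hz] : exists z1, ulim0 (fun k => modulus (z k - z1)).
  apply: (ulim_cplx (M := modulus zc + b)); apply: nearW => k; have [/andP[_ zb] _] := Kk k.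
  by have := mdBl (z k) zc; lra.
have b0 : 0 < b by have [/andP[h1 h2] _] := K0; exact: lt_le_trans a0 (le_trans h1 h2).
have q0 (s : R) : 0 < 1 + eps * s ^+ 2 by rewrite ltr_pwDl// mulr_ge0 ?sqr_ge0// ltW.
have [l1 Hl] : exists l1, ulim0 (fun k => modulus (l k - l1)).
  apply: (ulim_cplx (M := (inf S + 1) * (1 + eps * b ^+ 2) / a ^+ A)); apply: nearW => k.
  have [/andP[za zb] _] := Kk k.
  rewrite ler_pdivlMr ?exprn_gt0//.
  have : weighted_gap (z k) (l k) <= inf S + 1.
    by apply/ltW/(lt_le_trans (Fk k)); rewrite lerD2l invf_le1// ler1n.
  rewrite /weighted_gap ler_pdivrMr// => H.
  apply: (@le_trans _ _ (modulus (l k) * modulus (z k - zc) ^+ A)).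
    by rewrite ler_wpM2l ?md_ge0// lerXn2r ?nnegrE ?md_ge0// ltW.
  apply: (le_trans H); apply: ler_wpM2l.
    by rewrite addr_ge0//; apply: lb_le_inf; [case: S0|].
  by rewrite lerD2l ler_wpM2l ?(ltW eps0)// lerXn2r ?nnegrE ?md_ge0// ltW.
have sC := ulim0_md (a := zc) Hz.
have z1ab : a <= modulus (z1 - zc) <= b.
  apply/andP; split.
    apply: (cvgr_to_ge sC); apply: nearW => k; by have [/andP[]] := Kk k.
  apply: (cvgr_to_le sC); apply: nearW => k; by have [/andP[]] := Kk k.
exists z1, l1; split.
  split => // Dz; have [e e0 He] := open_nrm oD Dz.
  have [d Hd] := hol z1ab.
  have [r r0 Hr] := vder_cont Hd (divr_gt0 e0 (ltr0Sn _ 1)).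
  have nn : 0 < nrm nu + 1 by rewrite ltr_wpDl ?nrm_ge0.
  have r1 := Hz r r0; have l1' := Hl (e / 2 / (nrm nu + 1)) ltac:(by rewrite !divr_gt0).
  near free_uf => k; have [_] := Kk k; apply; apply: He.
  have -> : Phi (z k) + (ofR t + l k) *: nu - (Phi z1 + (ofR t + l1) *: nu) =
    (Phi (z k) - Phi z1) + (l k - l1) *: nu by apply/rowP => j; rewrite !mxE; ring.
  apply: (le_lt_trans (nrmD _ _)); rewrite nrmZ [e]splitr; apply: ltr_leD.
    by apply: Hr; near: k; exact: r1.
  have : modulus (l k - l1) < e / 2 / (nrm nu + 1) by near: k; exact: l1'.
  rewrite ltr_pdivlMr// => /ltW; apply: le_trans; rewrite ler_wpM2l ?md_ge0//; lra.
move=> y m Ky; apply: (@le_trans _ _ (inf S)); last first.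
  by apply: ge_inf; [exists 0|exists y, m].
have lC : (fun k => modulus (l k)) @ free_uf --> modulus l1.
  by have := ulim0_md (a := 0) Hl; rewrite subr0; under eq_fun do rewrite subr0.
have FC : (fun k => weighted_gap (z k) (l k)) @ free_uf --> weighted_gap z1 l1.
  rewrite /weighted_gap; apply: cvgM; first apply: cvgM => //.
    exact: (cvg_comp _ _ sC (@exprn_continuous R A _)).
  apply: cvgV; first by rewrite gt_eqF.
  apply: cvgD; first exact: cvg_cst.
  apply: cvgMr; exact: (cvg_comp _ _ sC (@exprn_continuous R 2 _)).
apply/ler_addgt0Pr => e e0; apply: (cvgr_to_le FC).
have He : \forall k \near free_uf, k.+1%:R^-1 < e by exact: ulim0_inv.
near=> k; apply/ltW/(lt_trans (Fk k)); rewrite ltrD2l; near: k; exact: He.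
Unshelve. all: by end_near. Qed.

(** Let G h = (v1/(v1 + h))^A (1 + 2 w), with w as in weight_gain.  Along
    l = l1 G h the weighted gap drops below its minimum by an amount of order
    |h|^2.  Hence (z1 + h, l1 G h + mu) is no exit pair for |mu| < c |h|^2, which
    means that the disc shifted by t + l1 G h enters D with quadratic room. *)
Lemma minimal_exit_touches z1 l1 : a < modulus (z1 - zc) < b -> l1 != 0 -> exit_pair z1 l1 ->
  (forall z l, exit_pair z l -> weighted_gap z1 l1 <= weighted_gap z l) -> 4 * (eps * b ^+ 2) <= 1 ->
  exists phi : C -> Cn, exists r c : R, [/\ 0 < r, 0 < c,
    phi 0 = Phi z1 + (ofR t + l1) *: nu,
    forall h, modulus h < r -> exists d : Cn, vder phi h d &
    forall h mu, modulus h < r -> modulus mu < c * modulus h ^+ 2 -> D (phi h + mu *: nu)].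
Proof.
move=> /andP[s1a s1b] l10 K1 Hmin eb.
set v1 := z1 - zc in s1a s1b; set s1 := modulus v1 in s1a s1b.
have s10 : 0 < s1 by exact: lt_trans s1a.
have v10 : v1 != 0 by rewrite -md_gt0.
pose gam := eps / (1 + eps * s1 ^+ 2).
have q0 (s : R) : 0 < 1 + eps * s ^+ 2 by rewrite ltr_pwDl// mulr_ge0 ?sqr_ge0// ltW.
have gam0 : 0 < gam by rewrite divr_gt0.
have gs : 4 * (gam * s1 ^+ 2) <= 1.
  apply: le_trans eb; rewrite ler_wpM2l//; apply: ler_pM => //; rewrite ?sqr_ge0 ?(ltW gam0)//.
    by rewrite /gam ler_pdivrMr// ler_peMr ?(ltW eps0)// lerDl mulr_ge0 ?sqr_ge0// ltW.
  by rewrite lerXn2r ?nnegrE ?ltW// (lt_trans s10).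
pose G h := (v1 * (v1 + h)^-1) ^+ A * (1 + 2 * (ofR gam * conjc v1 * h)).
pose r := Num.min (Num.min (s1 - a) (b - s1)) s1.
have r0 : 0 < r by rewrite /r !lt_min s10 !subr_gt0 s1a s1b.
have hr h : modulus h < r -> [/\ a <= modulus (z1 + h - zc) <= b, v1 + h != 0 & 2^-1 <= modulus (v1 * (v1 + h)^-1)].
  rewrite !lt_min => /andP[/andP[ha hb] hs].
  have -> : z1 + h - zc = v1 + h by rewrite /v1; ring.
  have vh0 : 0 < modulus (v1 + h).
    have := mdBl v1 (- h); rewrite opprK mdN -/s1; lra.
  split; last 1 first.
  - rewrite mdM mdV ler_pdivlMr//; have := mdD v1 h; rewrite -/s1; lra.
  - apply/andP; split; last by have := mdD v1 h; rewrite -/s1; lra.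
    by have := mdBl v1 (- h); rewrite opprK mdN -/s1; lra.
  - by rewrite -md_gt0.
pose c := modulus l1 * 2^-1 ^+ A * (gam / 2).
have c0 : 0 < c by rewrite /c mulr_gt0 ?divr_gt0// mulr_gt0 ?md_gt0// exprn_gt0 ?invr_gt0.
exists (fun h => Phi (z1 + h) + (ofR t + l1 * G h) *: nu), r, c; split => //.
- by rewrite /G !addr0 divff// expr1n !mulr0 addr0 !mulr1.
- move=> h /hr[hab vh _]; have [d Hd] := hol hab.
  have HG : exists g, hasder G h g.
    eexists; apply: hasderM; last first.
      apply: hasderD; first exact: hasder_cst.
      apply: hasderM; first exact: hasder_cst.
      apply: hasderM; [exact: hasder_cst|exact: hasder_id].
    apply: (hasder_comp (f := fun u => u ^+ A) (g := fun h => v1 * (v1 + h)^-1)); first exact: hasderX.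
    apply: hasderM; first exact: hasder_cst.
    apply: (hasder_comp (f := fun u => u^-1) (g := fun h => v1 + h)); first exact: hasder_inv.
    apply: hasderD; [exact: hasder_cst|exact: hasder_id].
  have [g Hg] := HG.
  exists (d + (l1 * g) *: nu) => j.
  apply: (hasder_ext (f := fun h => Phi (z1 + 1 * h) 0 j + (ofR t + l1 * G h) * nu 0 j)).
    by move=> w; rewrite !mxE mul1r.
  rewrite !mxE; apply: hasderD.
    have Hd' : vder Phi (z1 + 1 * h) d by rewrite mul1r.
    exact: hasder_eq (mulr1 _) (hasder_aff (f := fun z => Phi z 0 j) (Hd' j)).
  apply: hasder_eq (hasderM (hasderD (hasder_cst _ _) (hasderM (hasder_cst _ _) Hg)) (hasder_cst _ _)).
  ring.
- move=> h mu /[dup] hlt /hr[hab vh half] hmu; apply: contrapT => ND.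
  pose l := l1 * G h + mu.
  have Kl : exit_pair (z1 + h) l.
    split => //; move=> H; apply: ND; move: H.
    rewrite /l; congr (D _); apply/rowP => j; rewrite !mxE; ring.
  have := Hmin _ _ Kl; rewrite leNgt => /negP; apply.
  rewrite /weighted_gap.
  have zh : z1 + h - zc = v1 + h by rewrite /v1; ring.
  rewrite zh -/v1 -/s1.
  set s := modulus (v1 + h).
  have s0 : 0 < s by rewrite /s md_gt0.
  rewrite ltr_pdivrMr//.
  have W := weight_gain h eps0 gs; rewrite -/s1 -/gam -/s in W.
  set g1 := modulus (1 + 2 * _) in W.
  have lE : modulus l <= modulus l1 * (s1 / s) ^+ A * g1 + modulus mu.
    apply: (le_trans (mdD _ _)); rewrite lerD2r /G !mdM !mdX mdM mdV -/s1 -/s -/g1.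
    by rewrite mulrA.
  have muE : modulus mu < modulus l1 * (s1 / s) ^+ A * (gam / 2 * modulus h ^+ 2).
    have hh0 : 0 <= gam / 2 * modulus h ^+ 2.
      by apply: mulr_ge0; [rewrite divr_ge0// ltW|rewrite exprn_ge0 ?md_ge0].
    apply: (lt_le_trans hmu); rewrite /c -[X in X <= _]mulrA; apply: ler_wpM2r => //.
    apply: ler_wpM2l; first exact: md_ge0.
    rewrite lerXn2r ?nnegrE ?invr_ge0// ?divr_ge0 ?md_ge0//.
    by move: half; rewrite mdM mdV.
  have sA : 0 < (s1 / s) ^+ A by rewrite exprn_gt0 ?divr_gt0.
  have H1 : modulus l < modulus l1 * (s1 / s) ^+ A * ((1 + eps * s ^+ 2) / (1 + eps * s1 ^+ 2)).
    apply: (@lt_le_trans _ _ (modulus l1 * (s1 / s) ^+ A * (g1 + gam / 2 * modulus h ^+ 2))).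
      rewrite mulrDr; apply: (le_lt_trans lE); by rewrite ltrD2l.
    by apply: ler_wpM2l W; rewrite mulr_ge0 ?md_ge0// ltW.
  have : modulus l * s ^+ A < modulus l1 * (s1 / s) ^+ A * ((1 + eps * s ^+ 2) / (1 + eps * s1 ^+ 2)) * s ^+ A.
    by rewrite ltr_pM2r ?exprn_gt0.
  have sA0 : s ^+ A != 0 by rewrite expf_neq0// gt_eqF.
  have -> : modulus l1 * (s1 / s) ^+ A * ((1 + eps * s ^+ 2) / (1 + eps * s1 ^+ 2)) * s ^+ A =
      modulus l1 * s1 ^+ A / (1 + eps * s1 ^+ 2) * (1 + eps * s ^+ 2).
    by rewrite expr_div_n; field; rewrite sA0 gt_eqF.
  by [].
Unshelve. all: by end_near. Qed.
End MinimalExit.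

Section TouchingDisc.
Variable R : realType.
Local Notation C := (Cplx R).
Variable n : nat.
Local Notation Cn := 'rV[C]_n.
Local Notation Re := complex.Re.
Local Notation Im := complex.Im.

(** Let z0 be an exit point of Phi and let zc, at distance e from z0, be a
    nearby point with Phi zc in D.  On the annulus a <= |z - zc| <= 2 e the pair (z0, -t) is
    an exit pair, of weighted gap at most t e^A.  For suitable A and t a minimizer
    cannot lie on the outer circle, where the factor s^A is too large, nor on
    the inner circle, near which Phi is well inside D.  So it is interior and
    minimal_exit_touches applies. *)
Lemma touching_disc (D : set Cn) (Phi : C -> Cn) z1 : open D -> C1_smooth D ->
  (forall z, modulus z < 1 -> exists d : Cn, vder Phi z d) ->
  (forall z, modulus z < 1 -> clos D (Phi z)) ->
  D (Phi 0) -> modulus z1 < 1 -> ~ D (Phi z1) ->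
  exists (p nu : Cn) (phi : C -> Cn) (rho kap r c : R),
   [/\ clos D p /\ ~ D p, normal_at D nu p, cone_at D nu p rho kap &
    [/\ phi 0 = p, 0 < rho, 0 < kap, 0 < r & 0 < c] /\
    ((forall h, modulus h < r -> exists d : Cn, vder phi h d) /\
    forall h mu, modulus h < r -> modulus mu < c * modulus h ^+ 2 -> D (phi h + mu *: nu))].
Proof.
move=> oD sD hol cl D0 z11 N1.
have [z0 [z01 N0 acc]] := exit_point oD hol D0 z11 N1.
have [nu [rho [kap [rho0 kap0 cone nrml]]]] := C1_geom oD sD (cl _ z01) N0.
have [d0 Hd0] := hol _ z01.
have [r1 r10 Hr1] := vder_cont Hd0 (divr_gt0 rho0 (ltr0Sn _ 1)).
pose r2 := Num.min r1 (1 - modulus z0).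
have r20 : 0 < r2 by rewrite lt_min r10 subr_gt0.
have [zc [zc0 Dzc]] := acc (r2 / 3) (divr_gt0 r20 (ltr0Sn _ 2)).
set e := modulus (zc - z0) in zc0.
have e0 : 0 < e.
  rewrite /e md_gt0 subr_eq0; apply/eqP => E; by rewrite -E in N0.
have near z : modulus (z - zc) <= 2 * e -> modulus z < 1 /\ nrm (Phi z - Phi z0) < rho / 2.
  move=> zb; have : modulus (z - z0) < r2.
    have -> : z - z0 = (z - zc) + (zc - z0) by ring.
    by apply: (le_lt_trans (mdD _ _)); rewrite -/e; lra.
  rewrite lt_min => /andP[h1 h2]; split; last exact: Hr1.
  have := mdBl z z0; lra.
have [d d0' Hd] := open_nrm oD Dzc.
have [|dc Hdc] := hol zc; first by have [] := near zc ltac:(by rewrite subrr md0; lra).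
have [ra ra0 Hra] := vder_cont Hdc (divr_gt0 d0' (ltr0Sn _ 1)).
pose a := Num.min (ra / 2) (e / 2).
have a0 : 0 < a by rewrite lt_min !divr_gt0.
have ae : a < e by rewrite gt_min; apply/orP; right; lra.
have ara : a < ra by rewrite gt_min; apply/orP; left; lra.
pose N := nrm nu + 1.
have N0' : 0 < N by rewrite ltr_wpDl ?nrm_ge0.
pose c0 := kap / (1 + kap).
have k1 : 0 < 1 + kap by lra.
have c00 : 0 < c0 by rewrite divr_gt0.
have c01 : c0 = kap * (1 - c0) by rewrite /c0; field; rewrite gt_eqF.
have c0lt : c0 < 1 by rewrite /c0 ltr_pdivrMr//; lra.
(* Exit pairs have |l| > c0 t, so that their weighted gap on the outer circle
   exceeds c0 t (2 e)^A / 2. *)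
have [A HA] : exists A : nat, 2 < c0 * 2 ^+ A.
  have [k] := exists_half_pow_lt 2 c00.
  by rewrite exprVn ltr_pdivrMr ?exprn_gt0//; exists k.
(* The largest eps allowed by minimal_exit_touches. *)
pose eps := (4 * (2 * e) ^+ 2)^-1.
have eps0 : 0 < eps by rewrite invr_gt0 mulr_gt0// exprn_gt0// mulr_gt0.
have epsb : eps * (2 * e) ^+ 2 = 4^-1.
  by rewrite /eps; field; rewrite gt_eqF.
(* The four bounds on t: the cone condition applies to shifts of size 2 t; on
   the inner circle neither t nor l moves Phi z out of D (two bounds); the
   contact point stays within rho of Phi z0. *)
pose t := Num.min (Num.min (rho / 4) (d / (8 * N)))
  (Num.min (d * a ^+ A / (16 * N * e ^+ A)) (rho / (4 * N * (1 + 4 * e ^+ A / a ^+ A)))).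
have eA0 : 0 < e ^+ A by rewrite exprn_gt0.
have aA0 : 0 < a ^+ A by rewrite exprn_gt0.
have q0 (s : R) : 0 < 1 + eps * s ^+ 2 by rewrite ltr_pwDl// mulr_ge0 ?sqr_ge0// ltW.
have Q0 : 0 < 1 + 4 * e ^+ A / a ^+ A by rewrite ltr_pwDl// divr_ge0 ?ltW// mulr_gt0.
have t0 : 0 < t.
  by rewrite /t !lt_min !divr_gt0 //= ?mulr_gt0.
have [t1 t2 t3 t4] : [/\ t <= rho / 4, t <= d / (8 * N), t <= d * a ^+ A / (16 * N * e ^+ A) &
    t <= rho / (4 * N * (1 + 4 * e ^+ A / a ^+ A))].
  by rewrite /t !ge_min !lexx ?orbT.
(* By the cone condition every point lying above the disc by t + l with
   |l| <= c0 t is in D, so exit pairs have |l| > c0 t. *)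
have up z l : modulus (z - zc) <= 2 * e -> modulus l <= c0 * t -> D (Phi z + (ofR t + l) *: nu).
  move=> /near[z1' zr] lt; apply: cone; first exact: cl.
  - by move: zr rho0; clear; lra.
  - rewrite cReD /=; have := le_trans (Re_le_md l) lt; rewrite ler_norml => /andP[H _].
    have : c0 * t < t by rewrite gtr_pMl.
    by move: H; clear; lra.
  - rewrite cReD cImD /= add0r; apply: (le_trans (Im_le_md l)); apply: (le_trans lt).
    have := le_trans (Re_le_md l) lt; rewrite ler_norml => /andP[H _].
    rewrite {1}c01 -mulrA ler_wpM2l ?(ltW kap0)//; by move: H; clear; lra.
  - apply: (le_lt_trans (mdD _ _)); rewrite md_real gtr0_norm//.
    have : c0 * t < t by rewrite gtr_pMl.
    by move: lt t1 t0; clear; lra.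
pose K := exit_pair D Phi nu zc a (2 * e) t; pose F := @weighted_gap R zc eps A.
have ezc : modulus (z0 - zc) = e by rewrite mdB.
have K0 : K z0 (- ofR t).
  split; first by rewrite ezc (ltW ae) /=; move: e0; clear; lra.
  by rewrite subrr scale0r addr0.
have hol' z : a <= modulus (z - zc) <= 2 * e -> exists d : Cn, vder Phi z d.
  by move=> /andP[_ /near[/hol]].
have [z2 [l2 [K2 min2]]] := @minimizer R n D Phi nu zc a (2 * e) t eps A oD a0 eps0 hol' _ _ K0.
have [/andP[s2a s2b] N2] := K2.
have F0 : F z0 (- ofR t) <= t * e ^+ A.
  rewrite /F /weighted_gap ezc mdN md_real gtr0_norm// ler_pdivrMr// ler_peMr ?mulr_ge0 ?(ltW t0) ?(ltW eA0)//.
  by rewrite lerDl mulr_ge0 ?sqr_ge0// ltW.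
have F2 : F z2 l2 <= t * e ^+ A := le_trans (min2 _ _ K0) F0.
set s2 := modulus (z2 - zc) in s2a s2b.
have eps2 : 1 + eps * s2 ^+ 2 <= 2.
  have : eps * s2 ^+ 2 <= eps * (2 * e) ^+ 2.
    by rewrite ler_wpM2l ?(ltW eps0)// lerXn2r ?nnegrE ?md_ge0//; move: e0; clear; lra.
  by rewrite epsb; clear; lra.
have l2F : modulus l2 * s2 ^+ A <= 2 * (t * e ^+ A).
  move: F2; rewrite /F /weighted_gap -/s2 ler_pdivrMr// => /le_trans; apply.
  by rewrite mulrC ler_wpM2r// mulr_ge0 ?ltW.
have l2c : c0 * t < modulus l2.
  by rewrite ltNge; apply/negP => /(up z2 l2 s2b).
have s2A : a ^+ A <= s2 ^+ A by rewrite lerXn2r ?nnegrE ?md_ge0// ltW.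
have l2a : modulus l2 <= 2 * (t * e ^+ A) / a ^+ A.
  by rewrite ler_pdivlMr//; apply: le_trans l2F; rewrite ler_wpM2l ?md_ge0.
(* On the outer circle |l2| > c0 t and c0 2^A > 2 make the weighted gap
   exceed its value t e^A at (z0, -t). *)
have s2b' : s2 < 2 * e.
  rewrite lt_neqAle s2b andbT; apply/eqP => E.
  move: l2F; rewrite E exprMn leNgt => /negP; apply.
  apply: (@lt_le_trans _ _ (c0 * t * (2 ^+ A * e ^+ A))); last first.
    by apply: ler_wpM2r (ltW l2c); rewrite mulr_ge0 ?exprn_ge0 ?ltW.
  have -> : c0 * t * (2 ^+ A * e ^+ A) = (c0 * 2 ^+ A) * (t * e ^+ A) by ring.
  by rewrite ltr_pM2r// mulr_gt0.
(* On the inner circle the shift is too small to leave the ball round Phi zc. *)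
have s2a' : a < s2.
  rewrite lt_neqAle s2a andbT; apply/eqP => E.
  have PD : d / 2 <= (t + modulus l2) * N.
    rewrite leNgt; apply/negP => H; apply: N2; apply: Hd.
    have -> : Phi z2 + (ofR t + l2) *: nu - Phi zc = (Phi z2 - Phi zc) + (ofR t + l2) *: nu.
      by rewrite addrAC.
    apply: (le_lt_trans (nrmD _ _)); rewrite [d]splitr; apply: ltrD.
      by apply: Hra; rewrite -/s2 -E.
    rewrite nrmZ; apply: le_lt_trans H; apply: ler_pM; rewrite ?md_ge0 ?nrm_ge0//; last by rewrite /N lerDl.
    by apply: (le_trans (mdD _ _)); rewrite md_real gtr0_norm.
  have T2 : t * N <= d / 8.
    by move: t2; rewrite ler_pdivlMr ?mulr_gt0//; clear; lra.
  have T3 : modulus l2 * N <= d / 8.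
    have : modulus l2 * N <= 2 * (t * e ^+ A) / a ^+ A * N by rewrite ler_wpM2r// ltW.
    move=> /le_trans; apply.
    rewrite mulrAC ler_pdivrMr//; move: t3; rewrite ler_pdivlMr ?mulr_gt0//; clear; lra.
  by move: PD T2 T3 d0'; clear; lra.
have l20 : l2 != 0 by rewrite -md_gt0; apply: lt_trans l2c; rewrite mulr_gt0.
have [||phi [r [c [r0 cc0 phi0 hphi Dphi]]]] :=
   @minimal_exit_touches R n D Phi nu zc a (2 * e) t eps A a0 eps0 hol' z2 l2 _ l20 K2 min2 _.
- by rewrite s2a'.
- by rewrite epsb mulfV.
set p := Phi z2 + _ in phi0 N2.
have pp0 : nrm (p - Phi z0) < rho.
  have -> : p - Phi z0 = (Phi z2 - Phi z0) + (ofR t + l2) *: nu by rewrite addrAC.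
  apply: (le_lt_trans (nrmD _ _)).
  have [_ H] := near z2 s2b.
  suff : nrm ((ofR t + l2) *: nu) <= rho / 4 by move: H rho0; clear; lra.
  rewrite nrmZ; apply: (@le_trans _ _ ((t + modulus l2) * N)).
    apply: ler_pM; rewrite ?md_ge0 ?nrm_ge0//; last by rewrite /N lerDl.
    by apply: (le_trans (mdD _ _)); rewrite md_real gtr0_norm.
  apply: (@le_trans _ _ (t * (1 + 4 * e ^+ A / a ^+ A) * N)).
    apply: ler_wpM2r; first exact: ltW.
    rewrite mulrDr mulr1 lerD2l; apply: (le_trans l2a).
    have -> : t * (4 * e ^+ A / a ^+ A) = 2 * (t * e ^+ A) / a ^+ A + 2 * (t * e ^+ A) / a ^+ A by ring.
    by rewrite lerDl divr_ge0 ?mulr_ge0 ?ltW.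
  move: t4; rewrite ler_pdivlMr; last by rewrite !mulr_gt0.
  by clear; lra.
have clp : clos D p.
  move=> e1 e10; have [d1 Hd1] := hphi 0 ltac:(by rewrite md0).
  have [r3 r30 Hr3] := vder_cont Hd1 e10.
  pose h := ofR (Num.min r r3 / 2).
  have m0 : 0 < Num.min r r3 by rewrite lt_min r0.
  have mh : modulus h = Num.min r r3 / 2 by rewrite md_real gtr0_norm ?divr_gt0.
  have hlt : modulus h < Num.min r r3 by rewrite mh; move: m0; clear; lra.
  move: hlt; rewrite lt_min => /andP[hr hr3].
  exists (phi h); last by rewrite -phi0; apply: Hr3; rewrite subr0.
  rewrite -[phi h]addr0 -[X in _ + X](scale0r nu); apply: Dphi => //.
  by rewrite md0 mulr_gt0// exprn_gt0// mh divr_gt0.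
exists p, nu, phi, (rho - nrm (p - Phi z0)), kap, r, c; split => //.
- exact: nrml.
- move=> x l cx xp; move=> l0 lk lr; apply: cone => //.
    by have := nrm_tri x p (Phi z0); move: xp; clear; lra.
  by have := nrm_ge0 (p - Phi z0); move: lr; clear; lra.
- by split => //; split => //; rewrite subr_gt0.
Qed.

End TouchingDisc.

Section ContactDiscs.
Variable R : realType.
Local Notation C := (Cplx R).
Variable n : nat.
Local Notation Cn := 'rV[C]_n.
Local Notation Re := complex.Re.
Local Notation Im := complex.Im.

(** For |c' h| <= k s the shift s^2 + sg c' s h stays in the sector of the cone
    condition at phi h.  For larger h one has |c' s h| < c |h|^2, so that
    phi h + sg c' s h nu lies in D by the quadratic room, and s^2 nu then
    pushes it further inside. *)
Lemma contact_discs (D : set Cn) (p nu : Cn) (phi : C -> Cn) (rho kap r c : R) :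
  clos D p -> cone_at D nu p rho kap -> phi 0 = p -> 0 < rho -> 0 < kap -> 0 < r -> 0 < c ->
  (forall h, modulus h < r -> exists d : Cn, vder phi h d) ->
  (forall h mu, modulus h < r -> modulus mu < c * modulus h ^+ 2 -> D (phi h + mu *: nu)) ->
  exists r' c' s0 : R, [/\ 0 < r' <= r, 0 < c', 0 < s0 &
    forall s h sg, 0 < s < s0 -> modulus h < r' -> modulus sg = 1 ->
      D (phi h + (ofR (s ^+ 2) + sg * ofR (c' * s) * h) *: nu)].
Proof.
move=> clp cone phi0 rho0 kap0 r0 c0 hphi Dphi.
have [d1 Hd1] := hphi 0 ltac:(by rewrite md0).
have [r3 r30 Hr3] := vder_cont Hd1 (divr_gt0 rho0 (ltr0Sn _ 1)).
pose N := nrm nu + 1.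
have N0' : 0 < N by rewrite ltr_wpDl ?nrm_ge0.
pose k := kap / (1 + kap).
have k1 : 0 < 1 + kap by lra.
have k0 : 0 < k by rewrite divr_gt0.
have kE : k = kap * (1 - k) by rewrite /k; field; rewrite gt_eqF.
have klt : k < 1 by rewrite /k ltr_pdivrMr//; lra.
pose c' := Num.min 1 (c * k / 2).
have c'0 : 0 < c' by rewrite lt_min ltr01 divr_gt0// mulr_gt0.
have c'1 : c' <= 1 by rewrite ge_min lexx.
have c'2 : c' <= c * k / 2 by rewrite ge_min lexx orbT.
pose r' := Num.min (Num.min r r3) 1.
pose s0 := Num.min (Num.min 1 (rho / 4)) (rho / (2 * N)).
exists r', c', s0; split => //.
- by rewrite !lt_min r0 r30 ltr01 /= !ge_min lexx.
- by rewrite !lt_min ltr01 !divr_gt0// mulr_gt0.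
move=> s h sg /andP[s_gt0]; rewrite !lt_min => /andP[/andP[s1 sr] sN] /andP[/andP[hr hr3] h1] sg1.
have ss : s ^+ 2 < s by rewrite expr2 gtr_pMr.
have s20 : 0 < s ^+ 2 by rewrite exprn_gt0.
have ms : modulus (sg * ofR (c' * s) * h) = c' * s * modulus h.
  by rewrite !mdM sg1 mul1r md_real gtr0_norm// mulr_gt0.
have phin : nrm (phi h - p) < rho / 2 by rewrite -phi0; apply: Hr3; rewrite subr0.
have h0 := md_ge0 h.
have [H|H] := lerP (c' * modulus h) (k * s).
  have [->|hn] := eqVneq h 0.
    rewrite phi0 mulr0 addr0; apply: cone.
    - exact: clp.
    - by rewrite subrr nrm0.
    - exact: s20.
    - by rewrite normr0 mulr_ge0 ?ltW.
    - by rewrite md_real gtr0_norm//; lra.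
  have Dh : D (phi h).
    rewrite -[phi h]addr0 -[X in _ + X](scale0r nu); apply: Dphi => //.
    by rewrite md0 mulr_gt0// exprn_gt0// md_gt0.
  set l := sg * _ * h in ms *.
  have lk : modulus l <= k * s ^+ 2.
    rewrite ms expr2 mulrA [leRHS]mulrC; rewrite [k * s]mulrC in H *.
    have := ler_wpM2l (ltW s_gt0) H; clear; lra.
  have Hre : - (k * s ^+ 2) <= Re l.
    by have := le_trans (Re_le_md l) lk; rewrite ler_norml => /andP[].
  have ks : k * s ^+ 2 < s ^+ 2 by rewrite gtr_pMl.
  apply: cone; first exact: clos_sub.
  - by move: phin rho0; clear; lra.
  - by rewrite cReD /=; move: Hre ks; clear; lra.
  - rewrite cReD cImD /= add0r; apply: (le_trans (Im_le_md l)); apply: (le_trans lk).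
    rewrite {1}kE -mulrA ler_wpM2l ?(ltW kap0)//; by move: Hre; clear; lra.
  - apply: (le_lt_trans (mdD _ _)); rewrite md_real gtr0_norm//; by move: lk ks ss s1 sr rho0; clear; lra.
set mu := sg * _ * h in ms *.
have hpos : 0 < modulus h.
  rewrite lt_neqAle h0 andbT; apply/eqP => E; rewrite -E mulr0 in H.
  have ks : 0 < k * s := mulr_gt0 k0 s_gt0.
  by move: ks H; clear; move: (k * s) => y; lra.
have mun : modulus mu < c * modulus h ^+ 2.
  rewrite ms; have H1 : c' * s * k < c' * c' * modulus h.
    by rewrite -!mulrA [s * k]mulrC ltr_pM2l.
  have H2 : c' * c' <= c * k / 2.
    by apply: le_trans c'2; rewrite ler_piMl// ltW.
  have H3 : c' * c' * modulus h <= c * k / 2 * modulus h by rewrite ler_wpM2r.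
  have H4 : c' * s < c * modulus h.
    rewrite -(ltr_pM2r k0); apply: (lt_le_trans H1); apply: (le_trans H3).
    have := mulr_gt0 (mulr_gt0 c0 k0) hpos.
    by clear; lra.
  by rewrite expr2 mulrA ltr_pM2r.
have -> : phi h + (ofR (s ^+ 2) + mu) *: nu = (phi h + mu *: nu) + ofR (s ^+ 2) *: nu.
  by rewrite scalerDl [X in _ + X]addrC addrA.
apply: cone.
- by apply: clos_sub; exact: Dphi.
- have -> : phi h + mu *: nu - p = (phi h - p) + mu *: nu by rewrite addrAC.
  apply: (le_lt_trans (nrmD _ _)); rewrite nrmZ.
  have : modulus mu * nrm nu <= s * N.
    apply: ler_pM; rewrite ?md_ge0 ?nrm_ge0//; last by rewrite /N lerDl.
    rewrite ms; apply: (@le_trans _ _ (1 * s * 1)); last by rewrite mulr1 mul1r.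
    by apply: ler_pM => //; [rewrite mulr_ge0 ?ltW|rewrite ler_wpM2r// ltW|exact: ltW].
  move: sN; rewrite ltr_pdivlMr ?mulr_gt0//; move: phin; clear; lra.
- exact: s20.
- by rewrite normr0 mulr_ge0 ?ltW.
- by rewrite md_real gtr0_norm//; move: ss sr rho0; clear; lra.
Qed.
End ContactDiscs.

(** * A thin conformal image of the disc *)

Section IteratedRoots.
Variable R : realType.
Local Notation C := (Cplx R).
Local Notation Re := complex.Re.
Local Notation Im := complex.Im.

Definition hsqrt (z : C) : C := sqrtc (z : R[i]).
Lemma hsqrtK z : hsqrt z * hsqrt z = z.
Proof. by rewrite -expr2; exact: sqr_sqrtc. Qed.
Lemma hsqrt_Re_ge0 z : 0 <= Re (hsqrt z).
Proof. by case: z => a b; exact: sqrtr_ge0. Qed.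
Lemma hsqrt_Re_gt0 z : 0 < Re z -> 0 < Re (hsqrt z).
Proof.
move=> z0; rewrite lt_neqAle hsqrt_Re_ge0 andbT; apply/eqP => E.
have : Re (hsqrt z * hsqrt z) <= 0.
  by rewrite cReM -E mul0r sub0r oppr_le0 -expr2 sqr_ge0.
by rewrite hsqrtK leNgt z0.
Qed.
Lemma hsqrt_real (x : R) : 0 <= x -> hsqrt (ofR (x ^+ 2)) = ofR x.
Proof.
move=> x0; rewrite /hsqrt.
have := @sqrtc_sqrtr R (ofR (x ^+ 2)); rewrite lecE /= eqxx sqr_ge0 => ->//.
by rewrite sqrtr_sqr ger0_norm.
Qed.
Lemma hsqrt_md z : modulus (hsqrt z) ^+ 2 = modulus z.
Proof. by rewrite expr2 -mdM hsqrtK. Qed.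

(** From w - z = (S - y)(S + y) for the roots S and y of w and z, whose sum
    stays away from 0 because Re S >= 0 and Re y > 0. *)
Lemma hsqrt_der z : 0 < Re z -> exists d, hasder hsqrt z d.
Proof.
move=> z0; have y0 := hsqrt_Re_gt0 z0; set y := hsqrt z in y0.
have yn : 0 < modulus y by apply: lt_le_trans y0 _; apply: le_trans (Re_le_md y); exact: ler_norm.
have yC : y != 0 by rewrite -md_gt0.
exists (2 * y)^-1 => e e0.
exists (e * (2 * modulus y * Re y ^+ 2)); first by rewrite !mulr_gt0// exprn_gt0.
move=> w wz; set S := hsqrt w.
have S0 : 0 <= Re S := hsqrt_Re_ge0 w.
have Sy : Re y <= modulus (S + y).
  apply: le_trans (Re_le_md _); apply: le_trans (ler_norm _); rewrite cReD; lra.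
have Syn : 0 < modulus (S + y) := lt_le_trans y0 Sy.
have SyC : S + y != 0 by rewrite -md_gt0.
have wzE : w - z = (S - y) * (S + y).
  by rewrite -(hsqrtK w) -(hsqrtK z) -/S -/y; ring.
have -> : S - y - (2 * y)^-1 * (w - z) = - ((w - z) ^+ 2 / (2 * y * (S + y) ^+ 2)).
  by rewrite wzE; field; rewrite yC SyC.
have two : modulus (2 : C) = 2 by rewrite -(ofR_nat R 2) md_real ger0_norm.
rewrite mdN mdM mdV mdX mdM mdX mdM two.
set a := modulus (w - z) in wz *; set Y := modulus y in yn wz *; set Z := modulus (S + y) in Sy Syn *.
rewrite ler_pdivrMr; last by rewrite mulr_gt0 ?exprn_gt0// mulr_gt0.
have -> : e * a * (2 * Y * Z ^+ 2) = a * (e * (2 * Y * Z ^+ 2)) by ring.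
rewrite expr2; apply: ler_wpM2l; first exact: md_ge0.
apply: (le_trans (ltW wz)); apply: ler_wpM2l; first exact: ltW.
apply: ler_wpM2l; first by rewrite mulr_ge0// ltW.
by rewrite lerXn2r ?nnegrE ?(ltW y0) ?(ltW Syn).
Qed.

Definition iter_sqrt k (z : C) : C := iter k hsqrt z.

Lemma iter_sqrt_real k (x : R) : 0 <= x -> iter_sqrt k (ofR (x ^+ (2 ^ k))) = ofR x.
Proof.
move=> x0; elim: k => [|k IH]; first by rewrite expn0 expr1.
rewrite /iter_sqrt iterSr expnSr exprM hsqrt_real ?exprn_ge0//; exact: IH.
Qed.

(** Each root halves the excess of the modulus over 1 and the slope
    |Im|/Re of the sector, starting from slope 1 after the first root. *)
Lemma iter_sqrt_sector k (z : C) : 0 < Re z -> modulus z < 2 ->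
  [/\ 0 < Re (iter_sqrt k z), modulus (iter_sqrt k z) <= 1 + 2^-1 ^+ k,
      exists d, hasder (iter_sqrt k) z d &
      ((0 < k)%N -> `|Im (iter_sqrt k z)| <= 2 * 2^-1 ^+ k * Re (iter_sqrt k z))].
Proof.
move=> z0 z2; elim: k => [|k [IH1 IH2 [d IH3] IH4]].
  rewrite /iter_sqrt /= expr0; split => //; first by lra.
  by exists 1; exact: hasder_id.
have E : iter_sqrt k.+1 z = hsqrt (iter_sqrt k z) by [].
have S1 : 0 < Re (iter_sqrt k.+1 z) by rewrite E hsqrt_Re_gt0.
split => //.
- have q1 : (0 : R) <= 1 + 2^-1 ^+ k.+1 by rewrite addr_ge0// exprn_ge0.
  rewrite -(ler_pXn2r (n:=2)) ?nnegrE ?md_ge0//.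
  rewrite E hsqrt_md; apply: (le_trans IH2); rewrite [2^-1 ^+ k.+1]exprS.
  have : (0 : R) < 2^-1 ^+ k by rewrite exprn_gt0.
  by move: (2^-1 ^+ k) => y y0; nra.
- have [d' Hd'] := hsqrt_der IH1; exists (d' * d); exact: hasder_comp Hd' IH3.
move=> _; set y := iter_sqrt k.+1 z in S1 *.
have yy : y * y = iter_sqrt k z by rewrite /y E hsqrtK.
have r1 : Re (iter_sqrt k z) = Re y ^+ 2 - Im y ^+ 2 by rewrite -yy cReM; ring.
have r2 : Im (iter_sqrt k z) = 2 * Re y * Im y by rewrite -yy cImM; ring.
have i2 : `|Im y| ^+ 2 = Im y ^+ 2 by rewrite real_normK ?num_real.
case: k IH1 IH2 IH3 IH4 E @y yy r1 r2 i2 S1 => [|k] IH1 IH2 IH3 IH4 E y yy r1 r2 i2 S1.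
  have H : 0 < Re y ^+ 2 - Im y ^+ 2 by rewrite -r1.
  rewrite expr1 divff// mul1r -(ler_pXn2r (n:=2)) ?nnegrE ?(ltW S1)// i2; lra.
have := IH4 isT; rewrite r1 r2 !normrM ger0_norm// (ger0_norm (ltW S1)).
rewrite [2^-1 ^+ k.+2]exprS.
have : (0 : R) < 2^-1 ^+ k.+1 by rewrite exprn_gt0.
move: (2^-1 ^+ k.+1) => t t0 H.
rewrite -(ler_pM2l S1).
have : 0 <= t * Im y ^+ 2 by rewrite mulr_ge0 ?sqr_ge0// ltW.
lra.
Qed.

(** The 2^k-th root of 1 + z lies in the thin sector |Im| <= 2^(1-k) Re and has
    modulus at most 1 + 2^-k, so that it is close to [0,1]; stretching it
    slightly puts 0 and 1 among its values at real points. *)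
Lemma thin_map (eta : R) : 0 < eta -> exists (h : C -> C) (b c : R),
  [/\ -1 < b < 1, -1 < c < 1, h (ofR b) = 0, h (ofR c) = 1 &
   forall z, modulus z < 1 -> (exists d, hasder h z d) /\
     exists2 t : R, 0 <= t <= 1 & modulus (h z - ofR t) < eta].
Proof.
move=> eta0.
pose e := Num.min 1 (eta / 8).
have e0 : 0 < e by rewrite lt_min ltr01 divr_gt0.
have e1 : e <= 1 by rewrite ge_min lexx.
have e8 : e <= eta / 8 by rewrite ge_min lexx orbT.
have [k ke] : exists k, (2^-1 : R) ^+ k < e / 12.
  by have [k] := exists_half_pow_lt 1 (divr_gt0 e0 (ltr0Sn _ 11)); rewrite mul1r; exists k.
have k0 : (0 < k)%N.
  by case: k ke => //; rewrite expr0; lra.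
pose q0 := 1 + 2 * e.
have q00 : 0 < q0 by rewrite /q0; lra.
pose s0 := e / q0; pose s1 := (1 + e) / q0.
have s00 : 0 < s0 by rewrite divr_gt0.
have s10 : 0 < s1 by rewrite divr_gt0//; lra.
have s01 : s0 < 1 by rewrite ltr_pdivrMr//; rewrite /q0; lra.
have s11 : s1 < 1 by rewrite ltr_pdivrMr//; rewrite /q0; lra.
have N0 : (2 ^ k != 0)%N by rewrite -lt0n expn_gt0.
exists (fun z => ofR q0 * iter_sqrt k (1 + 1 * z) - ofR e), (s0 ^+ (2 ^ k) - 1), (s1 ^+ (2 ^ k) - 1).
have p0 : 0 < s0 ^+ (2 ^ k) < 1 by rewrite exprn_gt0//= exprn_ilt1 ?(ltW s00).
have p1 : 0 < s1 ^+ (2 ^ k) < 1 by rewrite exprn_gt0//= exprn_ilt1 ?(ltW s10).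
have E (x : R) : 1 + 1 * ofR (x - 1) = ofR x by rewrite ofRD ofRN ofR1; ring.
split.
- lra.
- lra.
- by rewrite E iter_sqrt_real ?(ltW s00)// -ofRM /s0 mulrC divfK ?gt_eqF// subrr.
- by rewrite E iter_sqrt_real ?(ltW s10)// -ofRM /s1 mulrC divfK ?gt_eqF// -ofRN -ofRD addrK.
move=> z z1.
have zRe : 0 < Re (1 + 1 * z).
  rewrite mul1r cReD /=; have := le_trans (Re_le_md z) (ltW z1).
  have := le_lt_trans (Re_le_md z) z1; rewrite ltr_norml => /andP[]; lra.
have z2 : modulus (1 + 1 * z) < 2.
  by rewrite mul1r; apply: (le_lt_trans (mdD _ _)); rewrite md1; lra.
have [r1 r2 [d r3] /(_ k0) r4] := iter_sqrt_sector k zRe z2.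
split.
  eexists; apply: hasderD; last exact: hasder_cst.
  apply: hasderM; first exact: hasder_cst.
  exact: hasder_aff r3.
set s := iter_sqrt k _ in r1 r2 r4 *.
set t := 2^-1 ^+ k in ke r2 r4.
have t0 : 0 < t by rewrite exprn_gt0.
have R1 : Re s <= 1 + t by apply: le_trans r2; apply: le_trans (Re_le_md s); exact: ler_norm.
have I1 : `|Im s| <= e / 3.
  apply: (le_trans r4); nra.
pose x := q0 * Re s - e.
have xlo : - e < x by rewrite /x; have := mulr_gt0 q00 r1; lra.
have xhi : x <= 1 + 2 * e.
  have : q0 * Re s <= 3 * t + q0.
    have : q0 * Re s <= q0 * (1 + t) by rewrite ler_wpM2l// ltW.
    have : q0 * t <= 3 * t by rewrite ler_wpM2r ?(ltW t0)// /q0; lra.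
    lra.
  by rewrite /x /q0; lra.
have [t' t'01 t'x] : exists2 t' : R, 0 <= t' <= 1 & `|x - t'| <= 2 * e.
  have [x0|x0] := lerP x 0.
    by exists 0; [rewrite lexx ler01|rewrite subr0 ler_norml; lra].
  have [x1|x1] := lerP 1 x; first by exists 1; [rewrite lexx ler01|rewrite ler_norml; lra].
  by exists x; [rewrite !ltW|rewrite subrr normr0; lra].
exists t' => //; apply: (le_lt_trans (md_le_ReIm _)).
rewrite !(cReD, cImD, cReN, cImN, cReM, cImM) /=.
have -> : q0 * Re s - 0 * Im s - e - t' = x - t' by rewrite /x; ring.
have -> : q0 * Im s + 0 * Re s - 0 - 0 = q0 * Im s by ring.
rewrite normrM (ger0_norm (ltW q00)).
have : q0 * `|Im s| <= 3 * (e / 3).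
  apply: ler_pM => //; first exact: ltW.
  by rewrite /q0; lra.
lra.
Qed.
End IteratedRoots.

(** * Discs through two points *)

Section TwoPoints.
Variable R : realType.
Local Notation C := (Cplx R).
Variable n : nat.
Local Notation Cn := 'rV[C]_n.
Local Notation Re := complex.Re.
Local Notation Im := complex.Im.
Implicit Types (D : set Cn).

(** Sequential closedness along the ultrafilter, which is all that the
    compactness arguments use. *)
Definition uclosed (S : set C) := forall (x : nat -> C) l, (forall k, S (x k)) ->
  ulim0 (fun k => modulus (x k - l)) -> S l.

Lemma uclosed_ball (r : R) : uclosed [set z | modulus z <= r].
Proof.
move=> x l Sx H; apply: (ulim0_close (d := fun k => modulus (x k - l))) => //= [k|k].
  exact: md_ge0.
have := mdBl l (x k); have := Sx k; rewrite /= mdB; lra.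
Qed.

Lemma uclosed_seg : uclosed [set z | exists2 t : R, 0 <= t <= 1 & z = ofR t].
Proof.
move=> x l Sx H; exists (Re l); last first.
  apply: CE => //=; apply/eqP; rewrite -normr_eq0 eq_le normr_ge0 andbT; apply/eqP.
  apply/eqP; apply: (ulim0_close (d := fun k => modulus (x k - l))) => // [k|k]; first exact: md_ge0.
  have [t _ xt] := Sx k; rewrite add0r; apply: le_trans (Im_le_md _).
  by rewrite xt cImD cImN /= sub0r normrN.
have cv := H.
apply/andP; split; apply: (ulim0_close (d := fun k => modulus (x k - l))) => // [k|k];
  try exact: md_ge0; have [t /andP[t0 t1] xt] := Sx k;
  have := Re_le_md (x k - l); rewrite cReD cReN xt /= ler_norml => /andP[]; lra.
Qed.

(** Otherwise there are points of S near which f comes closer and closer to leaving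
    D; by compactness of S they accumulate at a point of S, whose image is not
    interior to D. *)
Lemma compact_depth D (f : C -> Cn) (S : set C) (M : R) : open D -> uclosed S ->
  (forall z, S z -> modulus z <= M) ->
  (forall z, S z -> (exists d : Cn, vder f z d) /\ D (f z)) ->
  exists2 eta : R, 0 < eta & forall z, S z ->
    forall w x, modulus (w - z) < eta -> nrm (x - f w) < eta -> D x.
Proof.
move=> oD cS bS H; apply: contrapT => no.
have bad k : exists zwx : C * C * Cn, [/\ S zwx.1.1, modulus (zwx.1.2 - zwx.1.1) < k.+1%:R^-1,
    nrm (zwx.2 - f zwx.1.2) < k.+1%:R^-1 & ~ D zwx.2].
  apply: contrapT => H'; apply: no; exists k.+1%:R^-1; first by rewrite invr_gt0.
  move=> z Sz w x wz xf; apply: contrapT => Nx; apply: H'.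
  by exists (z, w, x).
have [y Hy] := choice bad.
pose z k := (y k).1.1; pose w k := (y k).1.2; pose x k := (y k).2.
have [l Hl] : exists l, ulim0 (fun k => modulus (z k - l)).
  by apply: (ulim_cplx (M := M)); apply: nearW => k; apply: bS; have [] := Hy k.
have Sl : S l by apply: cS Hl => k; have [] := Hy k.
have [[d Hd] Dl] := H l Sl.
have [e e0 He] := open_nrm oD Dl.
have [r r0 Hr] := vder_cont Hd (divr_gt0 e0 (ltr0Sn _ 1)).
have c1 := Hl _ (divr_gt0 r0 (ltr0Sn _ 1)).
have c2 := ulim0_inv (divr_gt0 r0 (ltr0Sn _ 1)).
have c3 := ulim0_inv (divr_gt0 e0 (ltr0Sn _ 1)).
near free_uf => k.
have [_ a1 a2 a3] := Hy k; apply: a3; apply: He.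
have b1 : modulus (z k - l) < r / 2 by near: k.
have b2 : k.+1%:R^-1 < r / 2 by near: k.
have b3 : k.+1%:R^-1 < e / 2 by near: k.
have b4 : nrm (f (w k) - f l) < e / 2.
  apply: Hr; have -> : w k - l = (w k - z k) + (z k - l) by ring.
  apply: (le_lt_trans (mdD _ _)); rewrite [r]splitr; apply: ltrD => //.
  exact: lt_trans a1 b2.
apply: (le_lt_trans (nrm_tri _ (f (w k)) _)); rewrite [e]splitr; apply: ltrD => //.
exact: lt_trans a2 b3.
Unshelve. all: by end_near. Qed.

Definition entire_path D (P : C -> Cn) := (forall z, exists d : Cn, vder P z d) /\
  (forall t : R, 0 <= t <= 1 -> D (P (ofR t))).

(** Let Q t = P (1 - (1 - t)^N) + t^N (w' - P 1).  For t <= 1/2 the second term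
    is tiny and Q is near the old curve; for t >= 1/2 the argument of P is near
    1 and Q is near the segment from P 1 to w'.  Hence Q stays in D over [0,1] for
    large N, and it is entire as P is. *)
Lemma path_extend D P (w' : Cn) : open D -> entire_path D P ->
  (forall t : R, 0 <= t <= 1 -> D (P 1 + ofR t *: (w' - P 1))) ->
  exists Q, [/\ entire_path D Q, Q 0 = P 0 & Q 1 = w'].
Proof.
move=> oD [hP DP] Dseg.
set v := w' - P 1 in Dseg *.
have hL z : vder (fun u => P 1 + u *: v) z v.
  move=> j; apply: (hasder_ext (f := fun u => P 1 0 j + u * v 0 j)) => [u|]; first by rewrite !mxE.
  apply: hasder_eq (hasderD (hasder_cst _ _) (hasderM (hasder_id _) (hasder_cst _ _))).
  by rewrite add0r mul1r mulr0 addr0.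
pose S := [set z : C | exists2 t : R, 0 <= t <= 1 & z = ofR t].
have bS z : S z -> modulus z <= 1.
  by move=> [t /andP[t0 t1] ->]; rewrite md_real ger0_norm.
have [e1 e10 H1] : exists2 eta : R, 0 < eta & forall z, S z ->
    forall w x, modulus (w - z) < eta -> nrm (x - P w) < eta -> D x.
  apply: (compact_depth (M := 1)) => //; first exact: uclosed_seg.
  by move=> z [t t01 ->]; split => //; exact: DP.
have [e2 e20 H2] : exists2 eta : R, 0 < eta & forall z, S z ->
    forall w x, modulus (w - z) < eta -> nrm (x - (P 1 + w *: v)) < eta -> D x.
  apply: (compact_depth (f := fun u => P 1 + u *: v) (M := 1)) => //; first exact: uclosed_seg.
  by move=> z [t t01 ->]; split; [exists v; exact: hL|exact: Dseg].
have [d1 Hd1] := hP 1.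
have [r r0 Hr] := vder_cont Hd1 e20.
pose eta := Num.min (e1 / (nrm v + 1)) r.
have v0 : 0 < nrm v + 1 by rewrite ltr_wpDl ?nrm_ge0.
have eta0 : 0 < eta by rewrite lt_min divr_gt0.
have [N HN] : exists N, (2^-1 : R) ^+ N.+1 < eta.
  by have [k] := exists_half_pow_lt 2^-1 eta0; rewrite -exprS; exists k.
exists (fun u => P (1 - (1 + (-1) * u) ^+ N.+1) + u ^+ N.+1 *: v); split.
- split.
    move=> z; have [d Hd] := hP (1 - (1 + (-1) * z) ^+ N.+1).
    have [g Hg] : exists g, hasder (fun u => 1 - (1 + (-1) * u) ^+ N.+1) z g.
      eexists; apply: (hasder_ext (f := fun u => 1 + (-1) * (1 + (-1) * u) ^+ N.+1)).
        by move=> w; rewrite mulN1r.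
      apply: hasderD; first exact: hasder_cst.
      apply: hasderM; first exact: hasder_cst.
      apply: (hasder_aff (f := fun u => u ^+ N.+1)); exact: hasderX.
    exists (g *: d + (N.+1%:R * z ^+ N : C) *: v) => j.
    apply: (hasder_ext (f := fun u => P (1 - (1 + (-1) * u) ^+ N.+1) 0 j + u ^+ N.+1 * v 0 j)).
      by move=> u; rewrite [RHS]mxE [in RHS]mxE.
    rewrite !mxE; apply: hasderD.
      exact: (hasder_eq (mulrC _ _) (hasder_comp (f := fun u => P u 0 j)
        (g := fun u => 1 - (1 + (-1) * u) ^+ N.+1) (Hd j) Hg)).
    apply: hasder_eq (hasderM (hasderX _ _) (hasder_cst _ _)).
    by rewrite mulr0 addr0.
  move=> t /andP[t0 t1].
  have -> : 1 - (1 + -1 * ofR t) ^+ N.+1 = ofR (1 - (1 - t) ^+ N.+1).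
    rewrite ofRD ofRN ofR1; congr (1 - _); rewrite mulN1r -ofR1 -ofRN -ofRD.
    by elim: (N.+1) => [|k IH]; rewrite ?expr0// !exprS IH ofRM.
  have -> : ofR t ^+ N.+1 = ofR (t ^+ N.+1).
    by elim: (N.+1) => [|k IH]; rewrite ?expr0// !exprS IH ofRM.
  have u0 : 0 <= 1 - t by lra.
  have a0 : 0 <= (1 - t) ^+ N.+1 <= 1 by rewrite exprn_ge0//= exprn_ile1//; lra.
  have b0 : 0 <= t ^+ N.+1 <= 1 by rewrite exprn_ge0//= exprn_ile1.
  have [th|th] := lerP t 2^-1.
    apply: (H1 (ofR (1 - (1 - t) ^+ N.+1)) _ (ofR (1 - (1 - t) ^+ N.+1))).
    - by exists (1 - (1 - t) ^+ N.+1) => //; lra.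
    - by rewrite subrr md0.
    - rewrite addrC addKr nrmZ md_real ger0_norm; last by case/andP: b0.
      have : t ^+ N.+1 <= 2^-1 ^+ N.+1 by rewrite lerXn2r ?nnegrE.
      move=> /le_lt_trans /(_ HN); rewrite lt_min => /andP[+ _].
      rewrite ltr_pdivlMr//; apply: le_lt_trans; rewrite ler_wpM2l ?lerDl//; by case/andP: b0.
  apply: (H2 (ofR (t ^+ N.+1)) _ (ofR (t ^+ N.+1))).
  - by exists (t ^+ N.+1).
  - by rewrite subrr md0.
  - rewrite opprD addrACA subrr addr0; apply: Hr.
    have -> : ofR (1 - (1 - t) ^+ N.+1) - 1 = - ofR ((1 - t) ^+ N.+1).
      by rewrite ofRD ofRN ofR1; ring.
    rewrite mdN md_real ger0_norm; last by case/andP: a0.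
    have : (1 - t) ^+ N.+1 <= 2^-1 ^+ N.+1 by rewrite lerXn2r ?nnegrE//; lra.
    by move=> /le_lt_trans /(_ HN); rewrite lt_min => /andP[].
- by rewrite mulr0 addr0 expr1n subrr expr0n /= scale0r addr0.
- by rewrite mulr1 subrr expr0n /= subr0 expr1n scale1r /v addrC subrK.
Qed.

Lemma ball_segment D (x w w' : Cn) (e : R) (t : R) :
  (forall y, nrm (y - x) < e -> D y) -> nrm (w - x) < e -> nrm (w' - x) < e ->
  0 <= t <= 1 -> D (w + ofR t *: (w' - w)).
Proof.
move=> H hw hw' /andP[t0 t1]; apply: H.
have -> : w + ofR t *: (w' - w) - x = ofR (1 - t) *: (w - x) + ofR t *: (w' - x).
  by rewrite ofRD ofRN ofR1; apply/rowP => j; rewrite !mxE; ring.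
apply: (le_lt_trans (nrmD _ _)); rewrite !nrmZ !md_real !ger0_norm//; last lra.
pose m := Num.max (nrm (w - x)) (nrm (w' - x)).
have me : m < e by rewrite gt_max hw hw'.
apply: le_lt_trans me; have -> : m = (1 - t) * m + t * m by ring.
by apply: lerD; apply: ler_wpM2l; rewrite ?subr_ge0// le_max lexx ?orbT.
Qed.

(** The set of points that an entire curve can reach is open and closed in D, since
    path_extend appends segments inside balls of D. *)
Lemma entire_path_exists D z w : domain D -> D z -> D w ->
  exists P, [/\ entire_path D P, P 0 = z & P 1 = w].
Proof.
move=> [oD cD _] Dz Dw.
pose W := [set w | D w /\ exists P, [/\ entire_path D P, P 0 = z & P 1 = w]].
have WD : W `<=` D by move=> x [].
have ext x (e : R) y y' : (forall y, nrm (y - x) < e -> D y) -> W y ->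
    nrm (y - x) < e -> nrm (y' - x) < e -> W y'.
  move=> He [Dy [P [hP P0 P1]]] hy hy'; split; first exact: He.
  have [|Q [hQ Q0 Q1]] := @path_extend D P y' oD hP; last by exists Q; rewrite Q0.
  by move=> t t01; rewrite P1; exact: ball_segment He hy hy' t01.
have oW : open W.
  rewrite openE => x Wx; apply/nbhs_nrm; have [e e0 He] := open_nrm oD (WD _ Wx).
  by exists e => // y yx; apply: ext He Wx _ yx; rewrite subrr nrm0.
have oN : open (D `\` W).
  rewrite openE => x [Dx NWx]; apply/nbhs_nrm; have [e e0 He] := open_nrm oD Dx.
  exists e => // y yx; split; first exact: He.
  by move=> Wy; apply: NWx; apply: ext He Wy yx _; rewrite subrr nrm0.
have E : W = D.
  apply: cD.
  - exists z; split => //; exists (fun=> z); split => //; split => // u.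
    exists 0 => j; rewrite mxE; exact: hasder_cst.
  - exists W => //; apply/seteqP; split => [x Wx|x [_]//]; split => //; exact: WD.
  - exists (~` (D `\` W)); first exact: open_closedC.
    apply/seteqP; split => [x Wx|x [Dx NN]]; first by split; [exact: WD|move=> [_]].
    by apply: contrapT => NW; exact: NN.
by have [] : W w by rewrite E.
Qed.

(** The automorphisms of the disc that preserve the real axis. *)
Lemma moebius_real (b : R) (z : C) : -1 < b < 1 -> modulus z < 1 ->
  1 + ofR b * z != 0 /\ modulus ((z + ofR b) / (1 + ofR b * z)) < 1.
Proof.
move=> /andP[b1 b2] z1.
have bz : modulus (ofR b * z) < 1.
  rewrite mdM md_real; apply: (@le_lt_trans _ _ (1 * modulus z)); last by rewrite mul1r.
  by rewrite ler_wpM2r ?md_ge0// ler_norml; lra.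
have nz : 1 + ofR b * z != 0.
  rewrite -md_gt0; have := mdBl 1 (- (ofR b * z)); rewrite opprK mdN md1; lra.
split => //; rewrite mdM mdV ltr_pdivrMr ?md_gt0// mul1r.
rewrite -(ltr_pXn2r (n:=2)) ?nnegrE ?md_ge0// !sqr_md !(cReD, cImD, cReM, cImM) /=.
have : Re z ^+ 2 + Im z ^+ 2 < 1.
  by rewrite -sqr_md -[ltRHS](expr1n _ 2) ltr_pXn2r ?nnegrE ?md_ge0.
have : 0 < (1 - b ^+ 2) by nra.
set x := Re z; set y := Im z => b3 xy.
have := mulr_gt0 b3 (_ : 0 < 1 - (x ^+ 2 + y ^+ 2)); rewrite subr_gt0 => /(_ xy); nra.
Qed.

(** An entire curve P joining the points stays in D near [0,1] by compact_depth;
    the disc is P composed with a thin map, recentred by a Moebius map so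
    that the origin goes to the first point. *)
Lemma disc_through D z w : domain D -> D z -> D w ->
  exists phi a, [/\ hdisc D phi, modulus a < 1, phi 0 = z & phi a = w].
Proof.
move=> dD Dz Dw; have [oD _ _] := dD.
have [P [[hP DP] P0 P1]] := entire_path_exists dD Dz Dw.
pose S := [set z : C | exists2 t : R, 0 <= t <= 1 & z = ofR t].
have [eta eta0 H] : exists2 eta : R, 0 < eta & forall z, S z ->
    forall w x, modulus (w - z) < eta -> nrm (x - P w) < eta -> D x.
  apply: (compact_depth (M := 1)) => //; first exact: uclosed_seg.
    by move=> _ [t /andP[t0 t1] ->]; rewrite md_real ger0_norm.
  by move=> _ [t t01 ->]; split => //; exact: DP.
have [h [b [c [b1 c1 hb hc hh]]]] := thin_map eta0.
pose m z := (z + ofR b) / (1 + ofR b * z).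
have bc : 0 < 1 - b * c.
  by case/andP: b1 => ? ?; case/andP: c1 => ? ?; nra.
pose a := (c - b) / (1 - b * c).
have ma : m (ofR a) = ofR c.
  rewrite /m -ofRM -ofR1 -!ofRD -ofRV -ofRM; congr ofR.
  have q0 : 1 - b * c != 0 by rewrite gt_eqF.
  have b2 : 1 - b ^+ 2 != 0.
    by case/andP: b1 => ? ?; rewrite gt_eqF//; nra.
  have n1 : a + b = c * (1 - b ^+ 2) / (1 - b * c) by rewrite /a; field.
  have n2 : 1 + b * a = (1 - b ^+ 2) / (1 - b * c) by rewrite /a; field.
  by rewrite n1 n2; field; rewrite b2 q0.
exists (fun u => P (h (m u))), (ofR a); split.
- move=> u u1; have [nz mu1] := moebius_real b1 u1.
  have [[dh Hdh] [t t01 ht]] := hh _ mu1.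
  split; last first.
    by apply: (H (ofR t) _ (h (m u))) => //; [exists t|rewrite subrr nrm0].
  have [d Hd] := hP (h (m u)).
  have [g Hg] : exists g, hasder m u g.
    eexists; apply: hasderM; first exact: hasderD (hasder_id _) (hasder_cst _ _).
    apply: (hasder_comp (f := fun v => v^-1) (g := fun z => 1 + ofR b * z)); first exact: hasder_inv.
    exact: hasderD (hasder_cst _ _) (hasderM (hasder_cst _ _) (hasder_id _)).
  exists ((dh * g) *: d) => j; rewrite mxE.
  apply: (hasder_eq (mulrC _ _)).
  apply: (hasder_comp (f := fun v => P v 0 j) (g := fun u => h (m u)) (Hd j)).
  exact: (hasder_comp (f := h) (g := m) Hdh Hg).
- have : `|a| < 1.
    rewrite /a normrM normfV (gtr0_norm bc) ltr_pdivrMr// mul1r ltr_norml.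
    by case/andP: b1 => ? ?; case/andP: c1 => ? ?; nra.
  by rewrite md_real.
- by rewrite /m add0r mulr0 addr0 divr1 hb P0.
- by rewrite ma hc P1.
Qed.
End TwoPoints.

(** * Competing discs and their normal speed *)

Section Taut.
Variable R : realType.
Local Notation C := (Cplx R).
Variable n : nat.
Local Notation Cn := 'rV[C]_n.
Local Notation Re := complex.Re.
Local Notation Im := complex.Im.
Implicit Types (D : set Cn).

Definition taut D := forall Phi : C -> Cn,
  (forall z, modulus z < 1 -> exists d : Cn, vder Phi z d) ->
  (forall z, modulus z < 1 -> clos D (Phi z)) -> D (Phi 0) ->
  forall z, modulus z < 1 -> D (Phi z).

Lemma bounded_nrm D : bounded_set D -> exists B : R, forall z, D z -> nrm z <= B.
Proof.
move=> [M [Mr HM]].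
have [N [N0 N1]] : exists N : R, 0 < N /\ M < ofR N.
  have [m mE] : exists m : R, M = ofR m.
    by exists (Re M); apply: CE => //=; move: Mr; rewrite realE !lecE /= => /orP[] /andP[/eqP].
  by exists (`|m| + 1); split; [rewrite ltr_wpDl|rewrite mE lt_ofR (le_lt_trans (ler_norm _))// ltrDl].
exists (n%:R * (N + 1)) => z Dz; apply: nrm_le => j; apply/ltW.
have Nz : `|z| < ofR (N + 1).
  by apply: le_lt_trans (HM _ N1 z Dz) _; rewrite lt_ofR ltrDl.
exact: (mxnorm_lt z (ltr_wpDl (ltW N0) ltr01)).1 Nz j.
Qed.

Lemma line_disc D z v (e : R) : 0 < e -> (forall y, nrm (y - z) < e -> D y) -> nrm v <= e ->
  hdisc D (fun u => z + u *: v) /\ derive1 (fun u : C => z + u *: v) 0 = v.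
Proof.
move=> e0 He ve.
have hL u : vder (fun u => z + u *: v) u v.
  move=> j; apply: (hasder_ext (f := fun u => z 0 j + u * v 0 j)) => [w|]; first by rewrite !mxE.
  apply: hasder_eq (hasderD (hasder_cst _ _) (hasderM (hasder_id _) (hasder_cst _ _))).
  by rewrite add0r mul1r mulr0 addr0.
split; last exact: vder_derive1.
move=> u u1; split; first by exists v.
apply: He; rewrite addrC addKr nrmZ.
by have := nrm_ge0 v; have := md_ge0 u; nra.
Qed.

Lemma inf_ge0 (S : set R) : (forall x, S x -> 0 <= x) -> 0 <= inf S.
Proof.
move=> H; have [->|/set0P S0] := eqVneq S set0; first by rewrite inf0.
exact: lb_le_inf.
Qed.

Lemma inf_nneg_lt (S : set R) (c : R) : (exists x, S x) -> (forall x, S x -> 0 <= x) ->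
  inf S < c -> exists2 x, S x & x < c.
Proof.
move=> S0 Sge lt; have c0 : 0 < c - inf S by rewrite subr_gt0.
have [|x Sx] := inf_adherent c0 (_ : has_inf S); first by split => //; exists 0.
by rewrite addrC subrK => ?; exists x.
Qed.

Lemma ell_ge0 D z w : 0 <= ell D z w.
Proof. by apply: inf_ge0 => _ [a _ <-]; exact: md_ge0. Qed.

Lemma ell_le D z w phi a : hdisc D phi -> modulus a < 1 -> phi 0 = z -> phi a = w ->
  ell D z w <= modulus a.
Proof.
move=> /hdiscP H a1 p0 pa; apply: ge_inf; first by exists 0 => _ [b _ <-]; exact: md_ge0.
by exists a => //; split => //; exists phi.
Qed.

Lemma ell_lt D z w (c : R) : domain D -> D z -> D w -> ell D z w < c ->
  exists phi a, [/\ hdisc D phi, modulus a < 1, phi 0 = z, phi a = w & modulus a < c].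
Proof.
move=> dD Dz Dw lt; have [phi [a [h1 h2 h3 h4]]] := disc_through dD Dz Dw.
have [|_ [b _ <-]|_ [b [b1 [f [/hdiscP f1 f2 f3]]] <-] bc] := inf_nneg_lt _ _ lt.
- by exists (modulus a), a => //; split => //; exists phi; split => //; apply/hdiscP.
- exact: md_ge0.
by exists f, b.
Qed.

Lemma ell_lt1 D z w : domain D -> D z -> D w -> ell D z w < 1.
Proof.
move=> dD Dz Dw; have [phi [a [h1 h2 h3 h4]]] := disc_through dD Dz Dw.
exact: le_lt_trans (ell_le h1 h2 h3 h4) h2.
Qed.

Lemma kappa_ge0 D z X : 0 <= kappa D z X.
Proof. by apply: inf_ge0 => _ [a _ <-]; exact: md_ge0. Qed.

Lemma kappa_le D z X phi a : hdisc D phi -> phi 0 = z -> a *: derive1 phi 0 = X ->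
  kappa D z X <= modulus a.
Proof.
move=> /hdiscP H p0 pa; apply: ge_inf; first by exists 0 => _ [b _ <-]; exact: md_ge0.
by exists a => //; exists phi.
Qed.

(** An affine disc shows that the infimum is over a nonempty set. *)
Lemma kappa_lt D z X (c : R) : open D -> D z -> kappa D z X < c ->
  exists phi a, [/\ hdisc D phi, phi 0 = z, a *: derive1 phi 0 = X & modulus a < c].
Proof.
move=> oD Dz lt.
have [e e0 He] := open_nrm oD Dz.
pose k : R := (nrm X + 1) / e.
have X0 : 0 < nrm X + 1 by rewrite ltr_wpDl ?nrm_ge0.
have k0 : 0 < k by rewrite divr_gt0.
have kC : ofR k != 0 by rewrite -md_eq0 md_real normr_eq0 gt_eqF.
have [|h1 h2] := @line_disc D z ((ofR k)^-1 *: X) e e0 He.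
  rewrite nrmZ mdV md_real gtr0_norm// mulrC ler_pdivrMr// /k mulrC divfK ?gt_eqF//.
  by rewrite lerDl.
have [|_ [b _ <-]|_ [b [f [/hdiscP f1 f2 f3]] <-] bc] := inf_nneg_lt _ _ lt.
- exists (modulus (ofR k)), (ofR k) => //; exists (fun u => z + u *: ((ofR k)^-1 *: X)); split.
  + exact/hdiscP.
  + by rewrite scale0r addr0.
  + by rewrite h2 scalerA divff// scale1r.
- exact: md_ge0.
by exists f, b.
Qed.

Lemma hdisc_aff D phi (a b : C) : hdisc D phi ->
  (forall z, modulus z < 1 -> modulus (a + b * z) < 1) ->
  hdisc D (fun z => phi (a + b * z)) /\
  forall z, modulus z < 1 -> derive1 (fun z => phi (a + b * z)) z = b *: derive1 phi (a + b * z).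
Proof.
move=> H ab.
have V z : modulus z < 1 -> vder (fun z => phi (a + b * z)) z (b *: derive1 phi (a + b * z)).
  move=> /ab z1 j; rewrite mxE mulrC.
  exact: (hasder_aff (f := fun z => phi z 0 j) (hdisc_vder H z1 j)).
split=> z z1; last exact: vder_derive1 (V z z1).
by split; [eexists; exact: V|have [] := H _ (ab z z1)].
Qed.

Lemma vder_lin (f : C -> Cn) (L : Cn -> C) z (d : Cn) : clinear L -> vder f z d ->
  hasder (fun w => L (f w)) z (L d).
Proof.
move=> cL /vder_nrm H e e0; have [M M0 HM] := clinear_bound cL.
have M1 : 0 < M + 1 by rewrite ltr_wpDl.
have [r r0 Hr] := H _ (divr_gt0 e0 M1); exists r => // w /Hr {}Hr.
have [LD LZ] := cL.
have -> : L (f w) - L (f z) - L d * (w - z) = L (f w - f z - (w - z) *: d).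
  have LN v : L (- v) = - L v by rewrite -[- v]scaleN1r LZ mulN1r.
  by rewrite !LD !LN LZ; ring.
apply: (le_trans (HM _)); apply: (le_trans (ler_wpM2l M0 Hr)).
rewrite mulrA ler_wpM2r ?md_ge0// mulrCA -[leRHS]mulr1 ler_wpM2l ?(ltW e0)//.
by rewrite ler_pdivrMr// mul1r lerDl.
Qed.

(** With G = L (f - p) + 2 s^2, the Taylor estimate gives |f w - p| = O(s^2) for
    |w| < m s, so that Re L (f - p) >= -s^2 for s small and Re G > 0 there.  By
    Borel-Caratheodory |L f'(0)| <= 24 Re (G 0)/(m s) = O(s)/m, which is less
    than c s once m is large. *)
Lemma normal_speed D (B : R) (L : Cn -> C) p (K c : R) :
  (forall z, D z -> nrm z <= B) -> clinear L -> 0 <= B ->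
  (forall eta : R, 0 < eta -> exists2 tau : R, 0 < tau &
      forall x, D x -> nrm (x - p) < tau -> - (eta * nrm (x - p)) <= Re (L (x - p))) ->
  0 <= K -> 0 < c ->
  exists2 s1 : R, 0 < s1 & forall s f, 0 < s < s1 -> hdisc D f ->
    nrm (f 0 - p) <= K * s ^+ 2 -> nrm (derive1 f 0) <= K * s ->
    c * s <= modulus (L (derive1 f 0)) -> False.
Proof.
move=> DB cL B0 HL K0 c0; have [ML ML0 HML] := clinear_bound cL.
pose m := 24 * (ML * K + 2) / c + 1.
have MK : 0 <= ML * K by rewrite mulr_ge0.
have m0 : 0 < m by rewrite ltr_wpDl// divr_ge0 ?(ltW c0)// mulr_ge0//; lra.
pose CT : R := n%:R * (24 * 48 * B).
have CT0 : 0 <= CT by rewrite /CT mulr_ge0// mulr_ge0.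
pose K2 := K + K * m + CT * m ^+ 2.
have K20 : 0 <= K2.
  by rewrite /K2 !addr_ge0// mulr_ge0 ?sqr_ge0// ltW.
have k2 : 0 < K2 + 1 by rewrite ltr_wpDl.
have [tau tau0 Htau] := HL (K2 + 1)^-1 ltac:(by rewrite invr_gt0).
exists (Num.min (Num.min 1 m^-1) (tau / (K2 + 1))).
  by rewrite !lt_min ltr01 invr_gt0 m0 divr_gt0.
move=> s f /andP[s0]; rewrite !lt_min => /andP[/andP[s1 sm] st] hf f0 f1 Lf.
have ms0 : 0 < m * s by rewrite mulr_gt0.
have ms1 : m * s < 1 by rewrite mulrC -ltr_pdivlMr// mul1r.
have s20 : 0 < s ^+ 2 by rewrite exprn_gt0.
have w1 w : modulus w < m * s -> modulus w < 1 by move=> ?; lra.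
have nf w : modulus w < m * s -> nrm (f w - p) <= K2 * s ^+ 2.
  move=> wm; have := hdisc_taylor DB hf (z := 0) (w := w).
  rewrite md0 subr0 subr0 expr1n divr1 => /(_ ltr01 (w1 w wm)); rewrite mulrA -/CT => T.
  have -> : f w - p = (f w - f 0 - w *: derive1 f 0) + ((f 0 - p) + w *: derive1 f 0).
    by apply/rowP => j; rewrite !mxE; ring.
  have wm2 : modulus w ^+ 2 <= (m * s) ^+ 2.
    by rewrite lerXn2r ?nnegrE ?md_ge0 ?(ltW ms0)// ltW.
  have wf : modulus w * nrm (derive1 f 0) <= (m * s) * (K * s).
    by apply: ler_pM; rewrite ?md_ge0 ?nrm_ge0// ltW.
  have CTw := ler_wpM2l CT0 wm2.
  have E : K2 * s ^+ 2 = CT * (m * s) ^+ 2 + (K * s ^+ 2 + (m * s) * (K * s)).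
    by rewrite /K2; ring.
  rewrite E; apply: (le_trans (nrmD _ _)); apply: lerD; first exact: le_trans T CTw.
  by apply: (le_trans (nrmD _ _)); rewrite nrmZ; apply: lerD.
have taus : K2 * s ^+ 2 < tau.
  have : s * (K2 + 1) < tau by rewrite -ltr_pdivlMr.
  have : s ^+ 2 <= s by rewrite expr2 ler_piMl ?ltW.
  move=> h1 h2; have := ler_wpM2l K20 h1; lra.
pose G w := L (f w - p) + ofR (2 * s ^+ 2).
have GRe w : modulus w < m * s -> 0 < Re (G w).
  move=> wm; have [_ Dw] := hf w (w1 w wm).
  have := Htau _ Dw (le_lt_trans (nf w wm) taus).
  have : (K2 + 1)^-1 * nrm (f w - p) <= s ^+ 2.
    rewrite mulrC ler_pdivrMr//; have := nf w wm; lra.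
  rewrite /G cReD /=; lra.
have hG w : modulus w < m * s -> hasder G w (L (derive1 f w)).
  move=> wm; rewrite -[L _]addr0; apply: hasderD; last exact: hasder_cst.
  apply: (vder_lin (f := fun w => f w - p)) => // j.
  apply: (hasder_ext (f := fun w => f w 0 j + - p 0 j)); first by move=> u; rewrite !mxE.
  apply: hasder_eq (hasderD (hdisc_vder hf (w1 w wm) j) (hasder_cst _ _)).
  by rewrite addr0.
have := @borel_caratheodory R G (m * s) (L (derive1 f 0)) ms0 _ GRe (hG 0 _).
rewrite md0 => /(_ _ ms0) H.
have {}H : modulus (L (derive1 f 0)) <= 24 * Re (G 0) / (m * s).
  by apply: H => w; rewrite subr0 => /hG ?; eexists; eassumption.
have G0 : Re (G 0) <= (ML * K + 2) * s ^+ 2.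
  rewrite /G cReD /= [leRHS]mulrDl lerD2r; apply: le_trans (ler_norm _) _.
  apply: (le_trans (Re_le_md _)); apply: (le_trans (HML _)).
  by rewrite -mulrA ler_wpM2l.
have : c * s * (m * s) <= 24 * ((ML * K + 2) * s ^+ 2).
  rewrite -ler_pdivlMr//; apply: (le_trans Lf); apply: (le_trans H).
  by rewrite ler_wpM2r ?invr_ge0 ?(ltW ms0)// ler_wpM2l.
have -> : c * s * (m * s) = (24 * (ML * K + 2) + c) * s ^+ 2.
  by rewrite /m; field; rewrite gt_eqF.
have : 0 < c * s ^+ 2 by rewrite mulr_gt0.
lra.
Qed.
End Taut.

(** * Quasi triangle inequalities force tautness *)

Section QuasiTaut.
Variable R : realType.
Local Notation C := (Cplx R).
Variable n : nat.
Local Notation Cn := 'rV[C]_n.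
Local Notation Re := complex.Re.
Local Notation Im := complex.Im.
Implicit Types (D : set Cn).

(** The disc f0, raised by s^2 nu and tilted by the slope sg c s along nu. *)
Definition sheared (f0 : C -> Cn) (nu : Cn) (c s : R) (sg : C) (u : C) : Cn :=
  f0 u + (ofR (s ^+ 2) + sg * ofR (c * s) * u) *: nu.

Lemma vder_sheared f0 nu c s sg u (d : Cn) : vder f0 u d ->
  vder (sheared f0 nu c s sg) u (d + (sg * ofR (c * s)) *: nu).
Proof.
move=> H j.
apply: (hasder_ext (f := fun u => f0 u 0 j + (ofR (s ^+ 2) + sg * ofR (c * s) * u) * nu 0 j)).
  by move=> w; rewrite /sheared !mxE.
rewrite !mxE; apply: hasderD; first exact: H.
apply: hasder_eq (hasderM (hasderD (hasder_cst _ _) (hasderM (hasder_cst _ _) (hasder_id _))) (hasder_cst _ _)).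
by rewrite mul0r !add0r mulr1 mulr0 addr0.
Qed.

Lemma sheared0 f0 nu c s sg : sheared f0 nu c s sg 0 = f0 0 + ofR (s ^+ 2) *: nu.
Proof. by rewrite /sheared mulr0 addr0. Qed.

(** The discs of contact_discs, with parameter rescaled to the unit disc. *)
Lemma nontaut_discs D : domain D -> C1_smooth D -> ~ taut D ->
  exists (p nu : Cn) (L : Cn -> C) (f0 : C -> Cn) (d0 : Cn) (c s0 : R),
   [/\ clinear L, L nu != 0,
    forall eta : R, 0 < eta -> exists2 tau : R, 0 < tau &
      forall x, D x -> nrm (x - p) < tau -> - (eta * nrm (x - p)) <= Re (L (x - p)) &
    [/\ f0 0 = p, vder f0 0 d0, 0 < c, 0 < s0 &
     forall s sg, 0 < s < s0 -> modulus sg = 1 -> hdisc D (sheared f0 nu c s sg)]].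
Proof.
move=> [oD _ _] sD NT.
have [Phi [z1 [hol cl D0 [z11 N1]]]] : exists Phi z1, [/\ forall z, modulus z < 1 -> exists d : Cn, vder Phi z d,
  forall z, modulus z < 1 -> clos D (Phi z), D (Phi 0) & modulus z1 < 1 /\ ~ D (Phi z1)].
  apply: contrapT => H; apply: NT => Phi hol cl D0 z z1; apply: contrapT => Nz.
  by apply: H; exists Phi, z.
have [p [nu [phi [rho [kap [r [c [[clp Np] [L [cL Lnu HL]] cone [[phi0 rho0 kap0 r0 c0] [hphi Dphi]]]]]]]]]] :=
  touching_disc oD sD hol cl D0 z11 N1.
have [r' [c' [s0 [/andP[r'0 r'r] c'0 s00 H]]]] := contact_discs clp cone phi0 rho0 kap0 r0 c0 hphi Dphi.
have rr z : modulus z < 1 -> modulus (0 + ofR r' * z) < r'.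
  by move=> z1'; rewrite add0r mdM md_real gtr0_norm// gtr_pMr.
have [d Hd] := hphi 0 ltac:(by rewrite md0).
have V z (dz : Cn) : vder phi (0 + ofR r' * z) dz -> vder (fun z => phi (0 + ofR r' * z)) z (ofR r' *: dz).
  by move=> Hz j; rewrite mxE; apply: (hasder_eq (mulrC _ _)); exact: (hasder_aff (f := fun z => phi z 0 j) (Hz j)).
exists p, nu, L, (fun z => phi (0 + ofR r' * z)), (ofR r' *: d), (c' * r'), s0; split => //.
split => //.
- by rewrite mulr0 addr0.
- by apply: V; rewrite mulr0 addr0.
- by rewrite mulr_gt0.
move=> s sg ss sg1 z z1'; split.
  have [dz Hz] := hphi (0 + ofR r' * z) (lt_le_trans (rr _ z1') r'r).
  by eexists; apply: vder_sheared; exact: V Hz.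
rewrite /sheared.
have -> : sg * ofR (c' * r' * s) * z = sg * ofR (c' * s) * (0 + ofR r' * z) by rewrite !ofRM; ring.
by apply: H => //; exact: rr.
Qed.

Lemma hdisc_scale D phi (a : C) (K : R) : hdisc D phi -> modulus a <= K -> 0 < K ->
  exists g, [/\ hdisc D g, g 0 = phi 0, derive1 g 0 = (a / ofR K) *: derive1 phi 0 &
    g (ofR K) = phi a].
Proof.
move=> H aK K0; have KC : ofR K != 0 by rewrite -md_eq0 md_real normr_eq0 gt_eqF.
have [|h1 h2] := @hdisc_aff R n D phi 0 (a / ofR K) H.
  move=> z z1; rewrite add0r; apply: le_lt_trans z1; rewrite mdM ler_piMl ?md_ge0//.
  by rewrite mdM mdV md_real gtr0_norm// ler_pdivrMr// mul1r.
exists (fun z => phi (0 + a / ofR K * z)); split => //.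
- by rewrite mulr0 addr0.
- have z0 : modulus (0 : C) < 1 by rewrite md0.
  by rewrite (h2 0 z0) mulr0 addr0.
- by rewrite divfK// add0r.
Qed.

Lemma pick_small (a b c d : R) : 0 < a -> 0 < b -> 0 < c -> 0 < d ->
  exists s : R, [/\ 0 < s < a, s < b, s < c & s < d].
Proof.
move=> a0 b0 c0 d0; pose m := Num.min (Num.min a b) (Num.min c d).
have m0 : 0 < m by rewrite !lt_min a0 b0 c0.
have [ma mb mc md] : [/\ m <= a, m <= b, m <= c & m <= d].
  by rewrite /m !ge_min !lexx !orbT.
exists (m / 2); split; lra.
Qed.

(** At z = p + s^2 nu the vectors d0 + c s nu and -(d0 - c s nu) have kappa at most
    1, being derivatives of discs up to sign.  Their sum 2 c s nu has kappa at
    most 2 Cq, hence is, up to a fixed factor, the derivative of a disc at z,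
    against normal_speed. *)
Lemma kappa_quasi_taut D : domain D -> bounded_set D -> C1_smooth D ->
  kappa_quasi_triangle D -> taut D.
Proof.
move=> dD bD sD [Cq [Cq0 HC]]; apply: contrapT => NT; have [oD _ [x0 Dx0]] := dD.
have [B DB] := bounded_nrm bD.
have B0 : 0 <= B by apply: le_trans (DB _ Dx0); exact: nrm_ge0.
have [p [nu [L [f0 [d0 [c [s0 [cL Lnu HL [f00 fd0 c0 s00 Hpsi]]]]]]]]] := nontaut_discs dD sD NT.
pose K := 2 * Cq + 1.
have K0 : 0 < K by rewrite /K; lra.
pose K1 := nrm nu + 2 * c / K * nrm nu.
have nn := nrm_ge0 nu.
have ck : 0 < 2 * c / K by rewrite divr_gt0// mulr_gt0.
have K10 : 0 <= K1 by rewrite addr_ge0// mulr_ge0// ltW.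
have Ln : 0 < modulus (L nu) by rewrite md_gt0.
have [s1 s10 Hs1] := normal_speed DB cL B0 HL K10 (mulr_gt0 ck Ln).
have [s [s01 _ ss1 _]] := pick_small s00 s00 s10 s10.
have sgt0 : 0 < s by case/andP: s01.
have h1 := Hpsi s 1 s01 (md1 R).
have h2 := Hpsi s (-1) s01 ltac:(by rewrite mdN md1).
have D1 : derive1 (sheared f0 nu c s 1) 0 = d0 + ofR (c * s) *: nu.
  by rewrite (vder_derive1 (vder_sheared nu c s 1 fd0)) mul1r.
have D2 : derive1 (sheared f0 nu c s (-1)) 0 = d0 - ofR (c * s) *: nu.
  by rewrite (vder_derive1 (vder_sheared nu c s (-1) fd0)) mulN1r scaleNr.
pose z := p + ofR (s ^+ 2) *: nu.
have P0 sg : sheared f0 nu c s sg 0 = z by exact: (etrans (sheared0 f0 nu c s sg) (congr1 (fun v => v + ofR (s ^+ 2) *: nu) f00)).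
have Dz : D z by rewrite -(P0 1); have [] := h1 0; rewrite ?md0.
have k1 : kappa D z (d0 + ofR (c * s) *: nu) <= 1.
  by rewrite -(md1 R); apply: kappa_le h1 (P0 _) _; rewrite scale1r.
have k2 : kappa D z (- d0 + ofR (c * s) *: nu) <= 1.
  have <- : modulus (-1 : C) = 1 by rewrite mdN md1.
  by apply: kappa_le h2 (P0 _) _; rewrite D2 scaleN1r opprB addrC.
have k3 : kappa D z (ofR (2 * c * s) *: nu) < K.
  have -> : ofR (2 * c * s) *: nu = (d0 + ofR (c * s) *: nu) + (- d0 + ofR (c * s) *: nu).
    rewrite -mulrA ofRM (ofR_nat R 2); apply/rowP => j; rewrite !mxE; ring.
  apply: (le_lt_trans (HC _ _ _ Dz)).
  apply: (le_lt_trans (ler_wpM2l (ltW Cq0) (lerD k1 k2))).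
  by rewrite /K; clear; lra.
have [phi [a [f1 f2 f3 f4]]] := kappa_lt oD Dz k3.
have [g [g1 g2 g3 _]] := hdisc_scale f1 (ltW f4) K0.
have {}g3 : derive1 g 0 = ofR (2 * c / K * s) *: nu.
  rewrite g3 mulrC -scalerA f3 scalerA -ofRV -ofRM; congr (ofR _ *: _); ring.
have cks : 0 < 2 * c / K * s by rewrite mulr_gt0.
apply: (Hs1 s g _ g1).
- by rewrite sgt0.
- rewrite g2 f2 /z addrC addKr nrmZ md_real ger0_norm ?sqr_ge0// mulrC ler_wpM2r ?sqr_ge0//.
  by rewrite /K1 lerDl mulr_ge0// ltW.
- rewrite g3 nrmZ md_real gtr0_norm// mulrAC ler_wpM2r ?(ltW sgt0)//.
  by rewrite /K1 lerDr.
- have [_ LZ] := cL; rewrite g3 LZ mdM md_real gtr0_norm//.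
  by rewrite mulrAC.
Qed.

(** Let x and y be the points with parameter s^2 on the two sheared discs through
    z.  Both are within 2 s^2 of z for ell, hence within beta = 4 Cq s^2 of each
    other, so that a disc g has g 0 = x and g beta = y.  Since
    x - y = 2 c s^3 nu = beta b s nu with b = c/(2 Cq), Taylor's formula gives
    g'(0) = -b s nu + O(s^2), against normal_speed. *)
Lemma ell_quasi_taut D : domain D -> bounded_set D -> C1_smooth D ->
  ell_quasi_triangle D -> taut D.
Proof.
move=> dD bD sD [Cq [Cq1 HC]]; apply: contrapT => NT; have [oD _ [x0 Dx0]] := dD.
have [B DB] := bounded_nrm bD.
have B0 : 0 <= B by apply: le_trans (DB _ Dx0); exact: nrm_ge0.
have [p [nu [L [f0 [d0 [c [s0 [cL Lnu HL [f00 fd0 c0 s00 Hpsi]]]]]]]]] := nontaut_discs dD sD NT.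
have Cq0 : 0 < Cq by lra.
have nn := nrm_ge0 nu; have nd := nrm_ge0 d0.
have Ln : 0 < modulus (L nu) by rewrite md_gt0.
have [cL1 LZ] := cL; have [ML ML0 HML] := clinear_bound cL.
pose CT : R := n%:R * (24 * 48 * B).
have CT0 : 0 <= CT by rewrite /CT mulr_ge0// mulr_ge0.
pose b := c / (2 * Cq).
have b0 : 0 < b by rewrite divr_gt0// mulr_gt0.
pose K1 := (nrm d0 + 1) + (1 + c) * nrm nu + b * nrm nu + CT * (4 * Cq).
have c1n : 0 <= (1 + c) * nrm nu by rewrite mulr_ge0//; lra.
have bn : 0 <= b * nrm nu by rewrite mulr_ge0// ltW.
have CTC : 0 <= CT * (4 * Cq) by rewrite mulr_ge0//; lra.
have [K10 K1a K1b] : [/\ 0 <= K1, nrm d0 + 1 + (1 + c) * nrm nu <= K1 &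
    b * nrm nu + CT * (4 * Cq) <= K1] by rewrite /K1; move: nn nd b0 c1n bn CTC; clear; split; lra.
have [s1 s10 Hs1] := normal_speed DB cL B0 HL K10 (divr_gt0 (mulr_gt0 b0 Ln) (ltr0Sn _ 1)).
have [r2 r20 Hr2] := (vder_nrm f0 0 d0).1 fd0 1 ltr01.
pose q := ML * (CT * (4 * Cq)) + 1.
have q0 : 0 < q by rewrite ltr_wpDl// mulr_ge0.
have q1 : 0 < b * modulus (L nu) / 2 / q by rewrite !divr_gt0// mulr_gt0.
pose m1 := Num.min (Num.min r2 (8 * Cq)^-1) (b * modulus (L nu) / 2 / q).
have m10 : 0 < m1 by rewrite !lt_min r20 invr_gt0 mulr_gt0//= q1.
have [s [s01 sm ss1 sh]] := pick_small s00 m10 s10 (ltac:(lra) : 0 < 2^-1 :> R).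
have sgt0 : 0 < s by case/andP: s01.
move: sm; rewrite !lt_min => /andP[/andP[sr2 sC] sqq].
have ssl : s ^+ 2 <= s by rewrite expr2 ler_piMl ?(ltW sgt0)//; move: sh; clear; lra.
have s20 : 0 < s ^+ 2 by rewrite exprn_gt0.
have h1 := Hpsi s 1 s01 (md1 R).
have h2 := Hpsi s (-1) s01 ltac:(by rewrite mdN md1).
pose z := p + ofR (s ^+ 2) *: nu.
have P0 sg : sheared f0 nu c s sg 0 = z by exact: (etrans (sheared0 f0 nu c s sg) (congr1 (fun v => v + ofR (s ^+ 2) *: nu) f00)).
have Dz : D z by rewrite -(P0 1); have [] := h1 0; rewrite ?md0.
pose t := ofR (s ^+ 2).
have mt : modulus t = s ^+ 2 by rewrite md_real gtr0_norm.
have t1 : modulus t < 1 by rewrite mt; move: ssl sh; clear; lra.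
pose x := sheared f0 nu c s 1 t; pose y := sheared f0 nu c s (-1) t.
have Dx : D x by have [] := h1 t t1.
have Dy : D y by have [] := h2 t t1.
have e2 : ell D z y <= s ^+ 2.
  by rewrite -mt; exact: ell_le h2 t1 (P0 _) _.
have e1 : ell D x z <= 2 * s ^+ 2.
  have u0 : 0 < 1 - s ^+ 2 by move: ssl sh; clear; lra.
  have [|H1 _] := @hdisc_aff R n D (sheared f0 nu c s 1) t (ofR (1 - s ^+ 2)) h1.
    move=> u u1; apply: (le_lt_trans (mdD _ _)); rewrite mt mdM md_real gtr0_norm//.
    have : (1 - s ^+ 2) * modulus u < 1 - s ^+ 2 by rewrite gtr_pMr.
    by clear; lra.
  pose a := - ofR (s ^+ 2 / (1 - s ^+ 2)).
  have ma : modulus a = s ^+ 2 / (1 - s ^+ 2) by rewrite mdN md_real gtr0_norm// divr_gt0.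
  have ma2 : modulus a <= 2 * s ^+ 2.
    by rewrite ma ler_pdivrMr//; move: s20 ssl sh; clear; nra.
  apply: le_trans ma2; apply: (ell_le H1).
  - by rewrite ma ltr_pdivrMr// mul1r; move: ssl sh; clear; lra.
  - by rewrite mulr0 addr0.
  - have -> : t + ofR (1 - s ^+ 2) * a = 0.
      by rewrite /a mulrN -ofRM mulrC divfK ?gt_eqF// subrr.
    exact: P0.
pose beta := 4 * Cq * s ^+ 2.
have beta0 : 0 < beta by rewrite !mulr_gt0.
have e3 : ell D x y < beta.
  apply: (le_lt_trans (HC x z y Dx Dz Dy)).
  apply: (le_lt_trans (ler_wpM2l (ltW Cq0) (lerD e1 e2))).
  have cs := mulr_gt0 Cq0 s20.
  by rewrite /beta; clear - cs; lra.
have [phi [a [f1 f2 f3 f4 f5]]] := ell_lt dD Dx Dy e3.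
clear e1 e2 e3.
have [g [g1 g2 _ g4]] := hdisc_scale f1 (ltW f5) beta0.
rewrite f3 in g2; rewrite f4 in g4.
have beta1 : beta < 1.
  have : s * (8 * Cq) < 1 by rewrite -ltr_pdivlMr ?mulr_gt0// div1r.
  have : Cq * s ^+ 2 <= Cq * s by rewrite ler_wpM2l// ltW.
  by rewrite /beta; clear; lra.
have mb : modulus (ofR beta) = beta by rewrite md_real gtr0_norm.
have T := hdisc_taylor DB g1 (z := 0) (w := ofR beta).
move: T; rewrite md0 !subr0 expr1n divr1 mb => /(_ ltr01 beta1); rewrite mulrA -/CT g2 g4 => T.
(* The error term of the expansion of the derivative of g. *)
pose E := derive1 g 0 + ofR (b * s) *: nu.
have xy : y - x = - (ofR (2 * c * s * s ^+ 2) *: nu).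
  rewrite /x /y /sheared; apply/rowP => j; rewrite !mxE /t !ofRM (ofR_nat R 2); ring.
have EE : ofR beta *: E = - (y - x - ofR beta *: derive1 g 0).
  rewrite /E scalerDr scalerA -ofRM xy.
  have -> : beta * (b * s) = 2 * c * s * s ^+ 2 by rewrite /beta /b; field; rewrite gt_eqF.
  have gen (u v : Cn) : u + v = - (- v - u) by rewrite opprB opprK.
  exact: gen.
have nE : nrm E <= CT * beta.
  rewrite -(ler_pM2l beta0); have -> : beta * nrm E = nrm (ofR beta *: E) by rewrite nrmZ mb.
  rewrite EE nrmN; apply: (le_trans T); rewrite le_eqVlt; apply/orP; left; apply/eqP; ring.
have dgE : derive1 g 0 = E - ofR (b * s) *: nu by rewrite /E addrK.
have bs : 0 < b * s by rewrite mulr_gt0.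
have CTb : CT * beta = CT * (4 * Cq) * s ^+ 2 by rewrite /beta; ring.
have CTbs : CT * beta <= CT * (4 * Cq) * s by rewrite CTb ler_wpM2l.
apply: (Hs1 s g _ g1).
- by rewrite sgt0.
- rewrite g2 /x /sheared mul1r.
  have -> : f0 t + (ofR (s ^+ 2) + ofR (c * s) * t) *: nu - p =
    (f0 t - p - t *: d0) + (t *: d0 + ofR (s ^+ 2 + c * s * s ^+ 2) *: nu).
    by apply/rowP => j; rewrite !mxE /t ofRD !ofRM; ring.
  have tr : modulus (t - 0) < r2 by rewrite subr0 mt; move: ssl sr2; clear; lra.
  have := Hr2 _ tr; rewrite f00 subr0 mul1r mt => H1.
  have H2 : s ^+ 2 + c * s * s ^+ 2 <= (1 + c) * s ^+ 2.
    rewrite mulrDl mul1r lerD2l ler_wpM2r ?(ltW s20)// ler_piMr ?(ltW c0)//; move: sh; clear; lra.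
  have H3 : 0 <= s ^+ 2 + c * s * s ^+ 2.
    by rewrite addr_ge0 ?(ltW s20)// !mulr_ge0 ?(ltW s20) ?(ltW c0) ?(ltW sgt0).
  apply: (le_trans (nrmD _ _)).
  have := nrmD (t *: d0) (ofR (s ^+ 2 + c * s * s ^+ 2) *: nu).
  rewrite !nrmZ mt md_real ger0_norm// => H4.
  have H5 := ler_wpM2r nn H2.
  have H6 : (nrm d0 + 1 + (1 + c) * nrm nu) * s ^+ 2 <= K1 * s ^+ 2.
    by apply: ler_wpM2r K1a; exact: ltW.
  apply: le_trans H6; rewrite !mulrDl mul1r.
  move: H1 H4 H5; rewrite !mulrDl mul1r [s ^+ 2 * nrm d0]mulrC.
  move: (nrm _) (nrm (t *: d0 + _)) => A1 A2; clear; lra.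
- rewrite dgE; apply: (le_trans (nrmD _ _)); rewrite nrmN nrmZ md_real gtr0_norm//.
  have : (b * nrm nu + CT * (4 * Cq)) * s <= K1 * s.
    by apply: ler_wpM2r K1b; exact: ltW.
  apply: le_trans; rewrite mulrDl; have -> : b * nrm nu * s = b * s * nrm nu by ring.
  rewrite addrC lerD2l; exact: le_trans nE CTbs.
- have LE : L (derive1 g 0) = L E - ofR (b * s) * L nu.
    by rewrite dgE cL1 -scaleNr LZ mulNr.
  have H1 : modulus (L E) <= b * modulus (L nu) / 2 * s.
    apply: (le_trans (HML _)); apply: (le_trans (ler_wpM2l ML0 nE)).
    rewrite CTb; have : s * q < b * modulus (L nu) / 2 by rewrite -ltr_pdivlMr.
    move=> /ltW /(ler_wpM2r (ltW sgt0)); apply: le_trans.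
    have -> : s * q * s = q * s ^+ 2 by ring.
    rewrite [leLHS]mulrA; apply: ler_wpM2r; first exact: ltW.
    by rewrite /q lerDl.
  have H2 : modulus (ofR (b * s) * L nu) = b * modulus (L nu) * s.
    by rewrite mdM md_real gtr0_norm//; ring.
  have := mdBl (ofR (b * s) * L nu) (L E); rewrite mdB -LE H2; move: H1; clear; lra.
Qed.
End QuasiTaut.

(** * Semicontinuity of ell and kappa *)

Section Semicontinuity.
Variable R : realType.
Local Notation C := (Cplx R).
Variable n : nat.
Local Notation Cn := 'rV[C]_n.
Local Notation Re := complex.Re.
Local Notation Im := complex.Im.
Implicit Types (D : set Cn).

(** A shrunk disc has relatively compact image in D, which leaves room for a small
    translation u and a small shear z v. *)
Lemma perturb_disc D phi (rho : R) : open D -> hdisc D phi -> 0 < rho < 1 ->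
  exists2 eta : R, 0 < eta & forall u v : Cn, nrm u + nrm v < eta ->
    hdisc D (fun z => phi (0 + ofR rho * z) + (u + z *: v)) /\
    derive1 (fun z => phi (0 + ofR rho * z) + (u + z *: v)) 0 = ofR rho *: derive1 phi 0 + v.
Proof.
move=> oD hphi /andP[rho0 rho1].
have in1 z : modulus z <= rho -> modulus z < 1 by move=> ?; exact: le_lt_trans rho1.
have [eta eta0 H] : exists2 eta : R, 0 < eta & forall z, [set z | modulus z <= rho] z ->
    forall w x, modulus (w - z) < eta -> nrm (x - phi w) < eta -> D x.
  apply: (compact_depth (M := rho)) => //; first exact: uclosed_ball.
  by move=> z /= /in1/hphi.
exists eta => // u v uv.
have rr z : modulus z < 1 -> modulus (0 + ofR rho * z) < rho.
  by move=> z1'; rewrite add0r mdM md_real gtr0_norm// gtr_pMr.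
have V z : modulus z < 1 -> vder (fun z => phi (0 + ofR rho * z) + (u + z *: v)) z
    (ofR rho *: derive1 phi (0 + ofR rho * z) + v).
  move=> z1 j.
  apply: (hasder_ext (f := fun z => phi (0 + ofR rho * z) 0 j + (u 0 j + z * v 0 j))).
    by move=> w; rewrite !mxE.
  rewrite !mxE; apply: hasderD.
    apply: (hasder_eq (mulrC _ _)).
    apply: (hasder_aff (f := fun z => phi z 0 j)).
    by apply: (hdisc_vder hphi); exact: lt_trans (rr z z1) rho1.
  apply: hasder_eq (hasderD (hasder_cst _ _) (hasderM (hasder_id _) (hasder_cst _ _))).
  by rewrite add0r mul1r mulr0 addr0.
have z0 : modulus (0 : C) < 1 by rewrite md0.
split; last by rewrite (vder_derive1 (V 0 z0)) mulr0 addr0.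
move=> z z1; split; first by eexists; exact: V.
apply: (H (0 + ofR rho * z) _ (0 + ofR rho * z)).
- by apply/ltW; exact: rr.
- by rewrite subrr md0.
- rewrite addrC addKr; apply: le_lt_trans uv; apply: (le_trans (nrmD _ _)).
  by rewrite lerD2l nrmZ ler_piMl ?nrm_ge0// ltW.
Qed.

Lemma pick_rho (m c : R) : 0 <= m -> m < 1 -> m < c -> exists rho : R,
  [/\ 0 < rho < 1, m < rho & m / rho < c].
Proof.
move=> m0 m1 mc; have c0 : 0 < c by lra.
pose l := Num.max m (m / c).
have l1 : l < 1 by rewrite gt_max m1 ltr_pdivrMr ?mul1r.
have [lm lmc] : m <= l /\ m / c <= l by rewrite /l !le_max !lexx !orbT.
pose rho := (1 + l) / 2.
have r0 : 0 < rho by rewrite /rho; lra.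
have rl : l < rho by rewrite /rho; lra.
exists rho; split.
- by rewrite r0 /rho; lra.
- exact: le_lt_trans rl.
- rewrite ltr_pdivrMr// mulrC -ltr_pdivrMr//; exact: le_lt_trans rl.
Qed.

(** Short affine discs through every point near z; they serve for the degenerate
    cases z = w and X = 0, where the parameter of a competing disc may be 0. *)
Lemma near_line D z (r : R) : open D -> D z -> 0 < r ->
  exists2 del : R, 0 < del & forall z' X, nrm (z' - z) < del -> nrm X < del ->
    exists phi, [/\ hdisc D phi, phi 0 = z', phi (ofR r) = z' + X & ofR r *: derive1 phi 0 = X].
Proof.
move=> oD Dz r0; have [e e0 He] := open_nrm oD Dz.
have rC : ofR r != 0 by rewrite -md_eq0 md_real normr_eq0 gt_eqF.
exists (Num.min (e / 2) (r * (e / 2))); first by rewrite lt_min !divr_gt0//= mulr_gt0 ?divr_gt0.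
move=> z' X; rewrite !lt_min => /andP[z1 _] /andP[_ X1].
have [|||h1 h2] := @line_disc R n D z' ((ofR r)^-1 *: X) (e / 2).
- by rewrite divr_gt0.
- move=> y yz; apply: He; have := nrm_tri y z' z; lra.
- by rewrite nrmZ mdV md_real gtr0_norm// mulrC ler_pdivrMr// mulrC ltW.
exists (fun u => z' + u *: ((ofR r)^-1 *: X)); split => //.
- by rewrite scale0r addr0.
- by rewrite scalerA divff// scale1r.
- by rewrite h2 scalerA divff// scale1r.
Qed.

(** Shrink a competing disc through z and w by rho < 1 and correct its values at 0
    and at the preimage of w by an affine map; the parameter only grows to
    |a|/rho < c. *)
Lemma ell_usc D z w (c : R) : domain D -> D z -> D w -> ell D z w < c ->
  exists2 del : R, 0 < del & forall z' w', nrm (z' - z) < del -> nrm (w' - w) < del ->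
    ell D z' w' < c.
Proof.
move=> dD Dz Dw lt; have [oD _ _] := dD.
have c0 : 0 < c := le_lt_trans (ell_ge0 D z w) lt.
have [zw|zw] := eqVneq z w.
  pose r := Num.min c 1 / 2.
  have m0 : 0 < Num.min c 1 by rewrite lt_min c0 ltr01.
  have r0 : 0 < r by rewrite divr_gt0.
  have [rc r1] : r < c /\ r < 1.
    have h1 : Num.min c 1 <= c by rewrite ge_min lexx.
    have h2 : Num.min c 1 <= 1 by rewrite ge_min lexx orbT.
    by rewrite /r; move: (Num.min c 1) m0 h1 h2; clear; move=> m *; split; lra.
  have [del del0 H] := near_line oD Dz r0.
  exists (del / 2); first by rewrite divr_gt0.
  move=> z' w' hz hw; rewrite -zw in hw.
  have [||phi [p1 p2 p3 _]] := H z' (w' - z').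
  - by clear - hz del0; lra.
  - have tri := nrm_tri w' z z'; rewrite [nrm (z - z')]nrmB in tri.
    by clear - hz hw tri; lra.
  rewrite addrC subrK in p3.
  have mr : modulus (ofR r) = r by rewrite md_real gtr0_norm.
  by apply: le_lt_trans rc; rewrite -mr; apply: ell_le p1 _ p2 p3; rewrite mr.
have [phi [a [f1 f2 f3 f4 f5]]] := ell_lt dD Dz Dw lt.
have a0 : a != 0 by apply: contraNneq zw => a0; rewrite -f3 -f4 a0.
have ma : 0 < modulus a by rewrite md_gt0.
have [rho [rho01 arho rhoc]] := pick_rho (md_ge0 a) f2 f5.
have rho0 : 0 < rho by case/andP: rho01.
have rC : ofR rho != 0 by rewrite -md_eq0 md_real normr_eq0 gt_eqF.
have [eta eta0 H] := perturb_disc oD f1 rho01.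
pose k := 1 + 2 * (rho / modulus a).
have k0 : 0 < k by rewrite ltr_wpDr// mulr_ge0// divr_ge0// ltW.
exists (eta / k); first by rewrite divr_gt0.
move=> z' w' hz hw.
pose u := z' - z; pose v := (ofR rho / a) *: ((w' - w) - u).
have [|h1 _] := H u v.
  have mv : nrm v <= rho / modulus a * (2 * (eta / k)).
    rewrite /v nrmZ mdM mdV md_real gtr0_norm//; apply: ler_wpM2l; first by rewrite divr_ge0// ltW.
    apply: (le_trans (nrmD _ _)); rewrite nrmN.
    by rewrite mulr2n mulrDl mul1r; apply: lerD; apply: ltW.
  apply: (@lt_le_trans _ _ (eta / k + rho / modulus a * (2 * (eta / k)))).
    by apply: ltr_leD.
  have -> : eta / k + rho / modulus a * (2 * (eta / k)) = eta / k * k by rewrite /k; ring.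
  by rewrite divfK// gt_eqF.
have mar : modulus (a / ofR rho) = modulus a / rho by rewrite mdM mdV md_real gtr0_norm.
apply: le_lt_trans rhoc; rewrite -mar; apply: (ell_le h1).
- by rewrite mar ltr_pdivrMr// mul1r.
- by rewrite mulr0 addr0 scale0r addr0 f3 /u addrC subrK.
- rewrite add0r mulrC divfK// f4 /v scalerA.
  have -> : a / ofR rho * (ofR rho / a) = 1 by field; rewrite a0 rC.
  by rewrite scale1r [u + _]addrC subrK addrC subrK.
Qed.

(** As in ell_usc, correcting the value and the derivative at 0. *)
Lemma kappa_usc D z X (c : R) : open D -> D z -> kappa D z X < c ->
  exists2 del : R, 0 < del & forall z' X', nrm (z' - z) < del -> nrm (X' - X) < del ->
    kappa D z' X' < c.
Proof.
move=> oD Dz lt.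
have c0 : 0 < c := le_lt_trans (kappa_ge0 D z X) lt.
have [X0|X0] := eqVneq X 0.
  have r0 : 0 < c / 2 by rewrite divr_gt0.
  have [del del0 H] := near_line oD Dz r0.
  exists del => // z' X'; rewrite X0 subr0 => hz hX.
  have [phi [p1 p2 _ p4]] := H z' X' hz hX.
  apply: (le_lt_trans (kappa_le p1 p2 p4)); rewrite md_real gtr0_norm//.
  by rewrite ltr_pdivrMr// ltr_pMr// ltr1n.
have [phi [a [f1 f2 f3 f4]]] := kappa_lt oD Dz lt.
have a0 : a != 0 by apply: contraNneq X0 => a0; rewrite -f3 a0 scale0r.
have ma : 0 < modulus a by rewrite md_gt0.
have [rho [rho0 rho1 rhoc]] : exists rho : R, [/\ 0 < rho, rho < 1 & modulus a / rho < c].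
  have ac : modulus a / c < 1 by rewrite ltr_pdivrMr// mul1r.
  have ac0 : 0 < modulus a / c by rewrite divr_gt0.
  exists ((1 + modulus a / c) / 2); split.
  - by clear - ac0; lra.
  - by clear - ac; lra.
  - rewrite ltr_pdivrMr; last by clear - ac0; lra.
    rewrite mulrC -ltr_pdivrMr//; by clear - ac; lra.
have rho01 : 0 < rho < 1 by rewrite rho0.
have rC : ofR rho != 0 by rewrite -md_eq0 md_real normr_eq0 gt_eqF.
have [eta eta0 H] := perturb_disc oD f1 rho01.
pose k := 1 + rho / modulus a.
have k0 : 0 < k by rewrite ltr_wpDr// divr_ge0// ltW.
exists (eta / k); first by rewrite divr_gt0.
move=> z' X' hz hX.
pose u := z' - z; pose v := (ofR rho / a) *: (X' - X).
have [|h1 h2] := H u v.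
  have mv : nrm v <= rho / modulus a * (eta / k).
    rewrite /v nrmZ mdM mdV md_real gtr0_norm//; apply: ler_wpM2l; last exact: ltW.
    by rewrite divr_ge0// ltW.
  apply: (@lt_le_trans _ _ (eta / k + rho / modulus a * (eta / k))).
    by apply: ltr_leD.
  have -> : eta / k + rho / modulus a * (eta / k) = eta / k * k by rewrite /k; ring.
  by rewrite divfK// gt_eqF.
have mar : modulus (a / ofR rho) = modulus a / rho by rewrite mdM mdV md_real gtr0_norm.
apply: le_lt_trans rhoc; rewrite -mar; apply: (kappa_le h1).
- by rewrite mulr0 addr0 scale0r addr0 f2 /u addrC subrK.
- rewrite h2 scalerDr scalerA divfK// f3 /v scalerA.
  have -> : a / ofR rho * (ofR rho / a) = 1 by field; rewrite a0 rC.
  by rewrite scale1r addrC subrK.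
Qed.

(** Montel's theorem puts the limit disc in the closure of D, and tautness in D. *)
Lemma taut_limit D z (phi : nat -> C -> Cn) : bounded_set D -> taut D ->
  (forall k, hdisc D (phi k)) -> ulim0 (fun k => nrm (phi k 0 - z)) -> D z ->
  exists Phi : C -> Cn, [/\ hdisc D Phi, Phi 0 = z,
    ulim0 (fun k => nrm (derive1 (phi k) 0 - derive1 Phi 0)) &
    forall (a : nat -> C) b, modulus b < 1 -> ulim0 (fun k => modulus (a k - b)) ->
      ulim0 (fun k => nrm (phi k (a k) - Phi b))].
Proof.
move=> bD tD hphi Hz Dz; have [B DB] := bounded_nrm bD.
have [Phi [P1 P2 P3]] := limit_disc DB hphi.
have z01 : modulus (0 : C) < 1 by rewrite md0.
have cst v : ulim0 (fun _ : nat => modulus (v - v : C)).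
  by apply: ulim0_le_all (@ulim0_cst R) => _; rewrite subrr md0.
have Phi0 : Phi 0 = z by exact: ulim0_uniq (P3 (fun=> 0) 0 z01 (cst 0)) Hz.
exists Phi; split => //; last exact: P2.
move=> u u1; split; first exact: P1.
apply: tD u1 => //; last by rewrite Phi0.
move=> v v1 e e0.
have /filter_ex[k Hk] := P3 (fun=> v) v v1 (cst v) e e0.
by exists (phi k v) => //; have [] := hphi k v v1.
Qed.

(** The endpoint w is only known as a limit of points of D: that it lies in D is
    part of the conclusion and uses s < 1, which keeps the limit parameter in
    the open disc. *)
Lemma ell_limit D z w (s : R) (zk wk : nat -> Cn) : domain D -> bounded_set D -> taut D ->
  s < 1 -> (forall k, D (zk k)) -> (forall k, D (wk k)) ->
  ulim0 (fun k => nrm (zk k - z)) -> ulim0 (fun k => nrm (wk k - w)) -> D z ->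
  (\forall k \near free_uf, ell D (zk k) (wk k) < s) -> D w /\ ell D z w <= s.
Proof.
move=> dD bD tD s1 Dzk Dwk Hz Hw Dz Hs.
have sel k : exists pa : (C -> Cn) * C, [/\ hdisc D pa.1, modulus pa.2 < 1, pa.1 0 = zk k, pa.1 pa.2 = wk k &
    ell D (zk k) (wk k) < s -> modulus pa.2 < s].
  have [lt|ge] := ltrP (ell D (zk k) (wk k)) s.
    by have [phi [a [h1 h2 h3 h4 h5]]] := ell_lt dD (Dzk k) (Dwk k) lt; exists (phi, a).
  by have [phi [a [h1 h2 h3 h4]]] := disc_through dD (Dzk k) (Dwk k); exists (phi, a).
have [pa Hpa] := choice sel.
pose phi k := (pa k).1; pose a k := (pa k).2.
have hphi k : hdisc D (phi k) by have [] := Hpa k.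
have [|Phi [hPhi Phi0 _ P3]] := taut_limit (z := z) bD tD hphi _ Dz.
  by apply: ulim0_le_all Hz => k; have [_ _ E _ _] := Hpa k; rewrite /phi E.
have as_ : \forall k \near free_uf, modulus (a k) < s.
  by apply: filterS Hs => k h; have [_ _ _ _] := Hpa k; apply.
have [b Hb] : exists b, ulim0 (fun k => modulus (a k - b)).
  by apply: (ulim_cplx (M := s)); apply: filterS as_ => k /ltW.
have bs : modulus b <= s.
  have := ulim0_md (a := 0) Hb; rewrite subr0; under eq_fun do rewrite subr0.
  by move=> /cvgr_to_le; apply; apply: filterS as_ => k /ltW.
have b1 : modulus b < 1 := le_lt_trans bs s1.
have Phib : Phi b = w.
  apply: ulim0_uniq (P3 a b b1 Hb) _.
  by apply: ulim0_le_all Hw => k; have [_ _ _ E _] := Hpa k; rewrite /= /phi /a E.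
split; first by rewrite -Phib; have [] := hPhi b b1.
by apply: le_trans bs; exact: ell_le hPhi b1 Phi0 Phib.
Qed.

Lemma kappa_limit D z X (s : R) (zk Xk : nat -> Cn) : open D -> bounded_set D -> taut D ->
  (forall k, D (zk k)) ->
  ulim0 (fun k => nrm (zk k - z)) -> ulim0 (fun k => nrm (Xk k - X)) -> D z ->
  (\forall k \near free_uf, kappa D (zk k) (Xk k) < s) -> kappa D z X <= s.
Proof.
move=> oD bD tD Dzk Hz HX Dz Hs.
have sel k : exists pa : (C -> Cn) * C, [/\ hdisc D pa.1, pa.1 0 = zk k, pa.2 *: derive1 pa.1 0 = Xk k &
    kappa D (zk k) (Xk k) < s -> modulus pa.2 < s].
  have [lt|ge] := ltrP (kappa D (zk k) (Xk k)) s.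
    by have [phi [a [h1 h2 h3 h4]]] := kappa_lt oD (Dzk k) lt; exists (phi, a).
  have lt : kappa D (zk k) (Xk k) < kappa D (zk k) (Xk k) + 1 by rewrite ltrDl.
  by have [phi [a [h1 h2 h3 h4]]] := kappa_lt oD (Dzk k) lt; exists (phi, a).
have [pa Hpa] := choice sel.
pose phi k := (pa k).1; pose a k := (pa k).2.
have hphi k : hdisc D (phi k) by have [] := Hpa k.
have [|Phi [hPhi Phi0 P2 _]] := taut_limit (z := z) bD tD hphi _ Dz.
  by apply: ulim0_le_all Hz => k; have [_ E _ _] := Hpa k; rewrite /phi E.
have as_ : \forall k \near free_uf, modulus (a k) < s.
  by apply: filterS Hs => k h; have [_ _ _] := Hpa k; apply.
have [b Hb] : exists b, ulim0 (fun k => modulus (a k - b)).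
  by apply: (ulim_cplx (M := s)); apply: filterS as_ => k /ltW.
have bs : modulus b <= s.
  have := ulim0_md (a := 0) Hb; rewrite subr0; under eq_fun do rewrite subr0.
  by move=> /cvgr_to_le; apply; apply: filterS as_ => k /ltW.
apply: le_trans bs; apply: (kappa_le hPhi Phi0).
apply: (ulim0_uniq (x := Xk)) => //.
have H1 := ulim0Z (nrm_ge0 (derive1 Phi 0)) Hb.
have H2 : ulim0 (fun k => (modulus b + 1) * nrm (derive1 (phi k) 0 - derive1 Phi 0)).
  by apply: ulim0Z P2; rewrite addr_ge0 ?md_ge0.
apply: ulim0_le (ulim0D H1 H2).
have Hb1 := Hb 1 ltr01; apply: filterS Hb1 => k hk.
have [_ _ <- _] := Hpa k; rewrite -/(a k) -/(phi k).
have -> : a k *: derive1 (phi k) 0 - b *: derive1 Phi 0 =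
  (a k - b) *: derive1 Phi 0 + a k *: (derive1 (phi k) 0 - derive1 Phi 0).
  have gen (x y : C) (u v : Cn) : x *: u - y *: v = (x - y) *: v + x *: (u - v).
    by rewrite scalerBl scalerBr [RHS]addrC addrA subrK.
  exact: gen.
apply: (le_trans (nrmD _ _)); rewrite !nrmZ; apply: lerD; first by rewrite mulrC.
apply: ler_wpM2r; first exact: nrm_ge0.
have tri := mdBl (a k) b; clear - hk tri; lra.
Qed.
End Semicontinuity.

(** * Continuity along the ultrafilter and chains *)

Section UltraContinuity.
Variable R : realType.
Local Notation C := (Cplx R).
Variable n : nat.
Local Notation Cn := 'rV[C]_n.
Implicit Types (D : set Cn).

(** Continuity tested on sequences converging along the ultrafilter. *)
Definition ucont (P Q : set Cn) (F : Cn -> Cn -> R) := forall z w (zk wk : nat -> Cn),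
  P z -> Q w -> (forall k, P (zk k)) -> (forall k, Q (wk k)) ->
  ulim0 (fun k => nrm (zk k - z)) -> ulim0 (fun k => nrm (wk k - w)) ->
  ulim0 (fun k => `|F (zk k) (wk k) - F z w|).

Lemma ucont_within P Q F : ucont P Q F ->
  {within P `*` Q, continuous (fun p : Cn * Cn => F p.1 p.2)}.
Proof.
move=> H; apply/subspace_continuousP => -[z w] [/= Pz Qw].
apply/cvgrPdist_lt => e e0 /=.
suff [d d0 Hd] : exists2 d : R, 0 < d & forall z' w', P z' -> Q w' -> nrm (z' - z) < d ->
    nrm (w' - w) < d -> `|F z w - F z' w'| < e.
  exists ([set z' | nrm (z' - z) < d], [set w' | nrm (w' - w) < d]) => /=.
    by split; apply/nbhs_nrm; exists d.
  by move=> -[z' w'] [/= h1 h2] [/= Pz' Qw']; exact: Hd.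
apply: contrapT => no.
have bad k : exists p : Cn * Cn, [/\ P p.1, Q p.2, nrm (p.1 - z) < k.+1%:R^-1, nrm (p.2 - w) < k.+1%:R^-1 &
    ~ (`|F z w - F p.1 p.2| < e)].
  apply: contrapT => H'; apply: no; exists k.+1%:R^-1; first by rewrite invr_gt0.
  by move=> z' w' Pz' Qw' h1 h2; apply: contrapT => h3; apply: H'; exists (z', w').
have [p Hp] := choice bad.
have cz : ulim0 (fun k => nrm ((p k).1 - z)).
  by apply: ulim0_le_all (@ulim0_inv R) => k; have [_ _ /ltW] := Hp k.
have cw : ulim0 (fun k => nrm ((p k).2 - w)).
  by apply: ulim0_le_all (@ulim0_inv R) => k; have [_ _ _ /ltW] := Hp k.
have Pp k : P (p k).1 by have [] := Hp k.
have Qp k : Q (p k).2 by have [] := Hp k.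
have /filter_ex[k Hk] := H z w _ _ Pz Qw Pp Qp cz cw e e0.
by have [_ _ _ _] := Hp k; apply; rewrite distrC.
Qed.

(** An ultrafilter decides between x k <= l - e and its negation, so that a lower
    bound follows by refuting the former. *)
Lemma ultra_lt (x : nat -> R) (l : R) :
  (forall s, s < l -> (\forall k \near free_uf, x k <= s) -> False) ->
  forall e, 0 < e -> \forall k \near free_uf, l - e < x k.
Proof.
move=> H e e0.
have [//|He] := in_ultra_setVsetC [set k | l - e < x k] free_uf_ultra.
exfalso; apply: (H (l - e)); first by rewrite gtrBl.
by apply: filterS He => k /= /negP; rewrite -leNgt.
Qed.

Lemma ulim0_sandwich (x : nat -> R) l :
  (forall e, 0 < e -> \forall k \near free_uf, x k < l + e) ->
  (forall e, 0 < e -> \forall k \near free_uf, l - e < x k) -> ulim0 (fun k => `|x k - l|).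
Proof.
move=> H1 H2 e e0; have h1 := H1 e e0; have h2 := H2 e e0; near=> k.
have k1 : x k < l + e by near: k.
have k2 : l - e < x k by near: k.
by rewrite ltr_norml; clear - k1 k2; lra.
Unshelve. all: by end_near. Qed.

Lemma ulim0_of_cvg (x : nat -> R) l : x @ free_uf --> l -> ulim0 (fun k => `|x k - l|).
Proof.
move=> /cvgrPdist_lt H e /H; by apply: filterS => k; rewrite distrC.
Qed.

Section Chains.
Variable D : set Cn.
Hypotheses (dD : domain D) (bD : bounded_set D) (tD : taut D).

Let oD : open D. Proof. by case: dD. Qed.

Lemma ell_refl w : D w -> ell D w w = 0.
Proof.
move=> Dw; have [phi [a [h1 h2 h3 h4]]] := disc_through dD Dw Dw.
apply/eqP; rewrite eq_le ell_ge0 andbT -(md0 R).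
by apply: (ell_le h1 _ h3 h3); rewrite md0.
Qed.

Lemma ell_ucont : ucont D D (ell D).
Proof.
move=> z w zk wk Dz Dw Dzk Dwk Hz Hw; apply: ulim0_sandwich => [e e0|].
  have [|del del0 H] := @ell_usc R n D z w (ell D z w + e) dD Dz Dw; first by rewrite ltrDl.
  by have h1 := Hz _ del0; have h2 := Hw _ del0; near=> k; apply: H; near: k.
apply: ultra_lt => s sl Hs.
have l1 := ell_lt1 dD Dz Dw.
pose s' := (s + ell D z w) / 2.
have ss' : s < s' by rewrite /s' midf_lt.
have s'l : s' < ell D z w by rewrite /s' midf_lt.
have Hs' : \forall k \near free_uf, ell D (zk k) (wk k) < s'.
  by apply: filterS Hs => k h; exact: le_lt_trans h ss'.
have [_] := ell_limit dD bD tD (lt_trans s'l l1) Dzk Dwk Hz Hw Dz Hs'.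
by rewrite leNgt s'l.
Unshelve. all: by end_near. Qed.

(** Points at bounded F-distance from a sequence converging in D cannot approach the
    boundary, as long as the bound is below some value of F.  For ell the
    proviso is necessary: all its values are below 1. *)
Definition escape (F : Cn -> Cn -> R) := forall z0 w0, D z0 -> D w0 -> forall s, s < F z0 w0 ->
  forall z w (zk wk : nat -> Cn), D z -> (forall k, D (zk k)) -> (forall k, D (wk k)) ->
  ulim0 (fun k => nrm (zk k - z)) -> ulim0 (fun k => nrm (wk k - w)) ->
  (\forall k \near free_uf, F (zk k) (wk k) <= s) -> D w.

Lemma ell_escape_lt z w (zk wk : nat -> Cn) (s : R) : s < 1 ->
  D z -> (forall k, D (zk k)) -> (forall k, D (wk k)) ->
  ulim0 (fun k => nrm (zk k - z)) -> ulim0 (fun k => nrm (wk k - w)) ->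
  (\forall k \near free_uf, ell D (zk k) (wk k) <= s) -> D w.
Proof.
move=> s1 Dz Dzk Dwk Hz Hw Hs.
pose s' := (s + 1) / 2.
have ss' : s < s' by rewrite /s' midf_lt.
have s'1 : s' < 1 by rewrite /s' midf_lt.
have Hs' : \forall k \near free_uf, ell D (zk k) (wk k) < s'.
  by apply: filterS Hs => k h; exact: le_lt_trans h ss'.
by have [] := ell_limit dD bD tD s'1 Dzk Dwk Hz Hw Dz Hs'.
Qed.

Lemma ell_escape : escape (ell D).
Proof.
move=> z0 w0 Dz0 Dw0 s sl z w zk wk; apply: ell_escape_lt.
exact: lt_trans sl (ell_lt1 dD Dz0 Dw0).
Qed.

Lemma artanh0 : artanh (0 : R) = 0.
Proof. by rewrite /artanh addr0 subr0 divr1 ln1 mul0r. Qed.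

Lemma artanh_ge0 (t : R) : 0 <= t -> t < 1 -> 0 <= artanh t.
Proof.
move=> t0 t1; rewrite /artanh divr_ge0// ln_ge0// ler_pdivlMr ?subr_gt0//; lra.
Qed.

Lemma artanh_bound (t s : R) : 0 <= t -> t < 1 -> artanh t <= s ->
  t <= (expR (2 * s) - 1) / (expR (2 * s) + 1).
Proof.
move=> t0 t1 H; have E0 := expR_gt0 (2 * s); set E := expR _ in E0 *.
have u0 : 0 < (1 + t) / (1 - t) by rewrite divr_gt0 ?subr_gt0//; lra.
have : (1 + t) / (1 - t) <= E.
  rewrite -(lnK u0) /E ler_expR; move: H; rewrite /artanh ler_pdivrMr//; lra.
rewrite ler_pdivrMr ?subr_gt0// => h.
rewrite ler_pdivlMr; [lra|lra].
Qed.

Lemma artanh_cvg (x : nat -> R) (t : R) : 0 <= t -> t < 1 -> x @ free_uf --> t ->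
  (fun k => artanh (x k)) @ free_uf --> artanh t.
Proof.
move=> t0 t1 H; rewrite /artanh; apply: cvgMl.
have u0 : 0 < (1 + t) / (1 - t) by rewrite divr_gt0 ?subr_gt0//; lra.
apply: (@cvg_comp _ _ _ (fun k => (1 + x k) / (1 - x k)) (@ln R) _ _ _ _ (continuous_ln u0)).
apply: cvgM; first by apply: cvgD => //; exact: cvg_cst.
apply: cvgV; first by rewrite gt_eqF// subr_gt0.
by apply: cvgB => //; exact: cvg_cst.
Qed.

Lemma lempert_ge0 z w : D z -> D w -> 0 <= lempert D z w.
Proof. by move=> Dz Dw; apply: artanh_ge0; [exact: ell_ge0|exact: ell_lt1]. Qed.

Lemma lempert_refl w : D w -> lempert D w w = 0.
Proof. by move=> Dw; rewrite /lempert ell_refl// artanh0. Qed.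

Lemma lempert_ucont : ucont D D (lempert D).
Proof.
move=> z w zk wk Dz Dw Dzk Dwk Hz Hw; apply: ulim0_of_cvg; apply: artanh_cvg.
- exact: ell_ge0.
- exact: ell_lt1.
- by apply: cvg_of_ulim0; exact: ell_ucont.
Qed.

(** A bound on artanh (ell) is a bound on ell by a constant less than 1. *)
Lemma lempert_escape : escape (lempert D).
Proof.
move=> z0 w0 Dz0 Dw0 s _ z w zk wk Dz Dzk Dwk Hz Hw Hs.
have E0 := expR_gt0 (2 * s).
apply: (ell_escape_lt (s := (expR (2 * s) - 1) / (expR (2 * s) + 1)) _ Dz Dzk Dwk Hz Hw).
  by rewrite ltr_pdivrMr; lra.
by apply: filterS Hs => k; apply: artanh_bound; [exact: ell_ge0|exact: ell_lt1].
Qed.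

Lemma chain_le (F : Cn -> Cn -> R) m (y : nat -> Cn) :
  (forall z w, D z -> D w -> 0 <= F z w) -> (forall j, (j <= m)%N -> D (y j)) ->
  chain_inf D F m (y 0%N) (y m) <= \sum_(j < m) F (y j) (y j.+1).
Proof.
move=> F0 Dy; apply: ge_inf; last by exists y.
exists 0 => _ [y' [Dy' _ _] <-]; apply: sumr_ge0 => j _.
by apply: F0; apply: Dy'; [exact: ltnW|].
Qed.

(** Above: move only the endpoints of an almost minimal chain.  Below: choose
    almost minimal chains from zk to wk and let each vertex converge.  A link is
    at most the whole sum, which is below s' < F z w, so that escape puts the
    limit vertices in D one after the other, and continuity of F on D applies to
    every link. *)
Lemma chain_inf_ucont (F : Cn -> Cn -> R) m : (0 < m)%N ->
  (forall z w, D z -> D w -> 0 <= F z w) -> (forall w, D w -> F w w = 0) ->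
  ucont D D F -> escape F -> ucont D D (chain_inf D F m).
Proof.
move=> m0 F0 Frefl Fc Fe z w zk wk Dz Dw Dzk Dwk Hz Hw.
have [B DB] := bounded_nrm bD.
(* The constant tail makes z, w a chain of every length m >= 1. *)
pose y0 z w := fun j : nat => if j is 0%N then z else w : Cn.
have y0m z' w' : y0 z' w' m = w' by case: m m0.
have Dy0 z' w' j : D z' -> D w' -> D (y0 z' w' j) by case: j.
have y0sum z' w' : D w' -> \sum_(j < m) F (y0 z' w' j) (y0 z' w' j.+1) = F z' w'.
  move=> Dw'; case: m m0 {y0m} => // m' _; rewrite big_ord_recl /= big1 ?addr0// => i _.
  exact: Frefl.
have ex z' w' (c : R) : D z' -> D w' -> chain_inf D F m z' w' < c ->
    exists y, [/\ forall j, (j <= m)%N -> D (y j), y 0%N = z', y m = w' &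
      \sum_(j < m) F (y j) (y j.+1) < c].
  move=> Dz' Dw' lt; have [||_ [y [h1 h2 h3] <-] h4] := inf_nneg_lt _ _ lt.
  - exists (\sum_(j < m) F (y0 z' w' j) (y0 z' w' j.+1)), (y0 z' w') => //; split => // j _.
    exact: Dy0.
  - move=> _ [y [h1 _ _] <-]; apply: sumr_ge0 => j _; apply: F0; apply: h1 => //; exact: ltnW.
  by exists y.
apply: ulim0_sandwich => [e e0|].
  have [|y [h1 h2 h3 h4]] := ex z w (chain_inf D F m z w + e / 2) Dz Dw.
    by rewrite ltrDl divr_gt0.
  pose yk k j := if j == 0%N then zk k else if j == m then wk k else y j.
  have Dyk k j : (j <= m)%N -> D (yk k j).
    by rewrite /yk; case: eqP => // _; case: eqP => // _; exact: h1.
  have cyk j : ulim0 (fun k => nrm (yk k j - y j)).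
    rewrite /yk; case: eqP => [->|_]; first by rewrite h2.
    case: eqP => [->|_]; first by rewrite h3.
    by apply: ulim0_le_all (@ulim0_cst R) => k; rewrite subrr nrm0.
  have cs : ulim0 (fun k => \sum_(j < m) `|F (yk k j) (yk k j.+1) - F (y j) (y j.+1)|).
    apply: (ulim0_sum (d := fun j k => `|F (yk k j) (yk k j.+1) - F (y j) (y j.+1)|)) => j.
    by apply: Fc => //; [apply: h1; exact: ltnW|exact: h1|move=> k; apply: Dyk; exact: ltnW|move=> k; exact: Dyk].
  have := cs (e / 2) (divr_gt0 e0 (ltr0Sn _ 1)); apply: filterS => k hk.
  have := chain_le F0 (Dyk k); rewrite {1 2}/yk eqxx eqxx (gtn_eqF m0) => /le_lt_trans; apply.
  apply: (@le_lt_trans _ _ (\sum_(j < m) F (y j) (y j.+1) +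
      \sum_(j < m) `|F (yk k j) (yk k j.+1) - F (y j) (y j.+1)|)).
    rewrite -big_split /=; apply: ler_sum => j _; rewrite -lerBlDl; exact: ler_norm.
  by have -> : e = e / 2 + e / 2 by [rewrite -splitr]; rewrite addrA; apply: ltrD.
apply: ultra_lt => s sl Hs.
pose s' := (s + chain_inf D F m z w) / 2.
have ss' : s < s' by rewrite /s' midf_lt.
have s'l : s' < chain_inf D F m z w by rewrite /s' midf_lt.
have le1 : chain_inf D F m z w <= F z w.
  have := @chain_le F m (y0 z w) F0; rewrite y0m y0sum//; apply=> j _; exact: Dy0.
have sel k : exists y, [/\ forall j, (j <= m)%N -> D (y j), y 0%N = zk k, y m = wk k &
    chain_inf D F m (zk k) (wk k) < s' -> \sum_(j < m) F (y j) (y j.+1) < s'].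
  have [lt|ge] := ltrP (chain_inf D F m (zk k) (wk k)) s'.
    by have [y [? ? ? ?]] := ex _ _ _ (Dzk k) (Dwk k) lt; exists y.
  by exists (y0 (zk k) (wk k)); split => // j _; exact: Dy0.
have [yk Hyk] := choice sel.
have Dyk k j : (j <= m)%N -> D (yk k j) by have [h _ _ _] := Hyk k; exact: h.
have sums : \forall k \near free_uf, \sum_(j < m) F (yk k j) (yk k j.+1) < s'.
  by apply: filterS Hs => k h; have [_ _ _] := Hyk k; apply; exact: le_lt_trans h ss'.
have lim j : exists l, (j <= m)%N -> ulim0 (fun k => nrm (yk k j - l)).
  have [jm|jm] := leqP j m; last by exists 0.
  have [l Hl] : exists l, ulim0 (fun k => nrm (yk k j - l)).
    by apply: (ulim_vec (M := B)); apply: nearW => k; apply: DB; exact: Dyk.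
  by exists l.
have [y Hy] := choice lim.
have y0z : y 0%N = z.
  by apply: ulim0_uniq (Hy 0%N (leq0n _)) _; apply: ulim0_le_all Hz => k; have [_ -> _ _] := Hyk k.
have ymw : y m = w.
  by apply: ulim0_uniq (Hy m (leqnn _)) _; apply: ulim0_le_all Hw => k; have [_ _ -> _] := Hyk k.
have Dy j : (j <= m)%N -> D (y j).
  elim: j => [_|j IH jm]; first by rewrite y0z.
  have jm' := ltnW jm.
  apply: (Fe z w Dz Dw s' (lt_le_trans s'l le1) (y j) (y j.+1) (fun k => yk k j) (fun k => yk k j.+1)).
  - exact: IH.
  - by move=> k; exact: Dyk.
  - by move=> k; exact: Dyk.
  - exact: Hy.
  - exact: Hy.
  apply: filterS sums => k /ltW; apply: le_trans.
  rewrite (bigD1 (Ordinal jm)) //= lerDl; apply: sumr_ge0 => i _.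
  by apply: F0; apply: Dyk; [exact: ltnW|].
have cs : ulim0 (fun k => \sum_(j < m) `|F (yk k j) (yk k j.+1) - F (y j) (y j.+1)|).
  apply: (ulim0_sum (d := fun j k => `|F (yk k j) (yk k j.+1) - F (y j) (y j.+1)|)) => j.
  have j1 : (j <= m)%N by exact: ltnW.
  by apply: Fc => //; [exact: Dy|exact: Dy|move=> k; exact: Dyk|move=> k; exact: Dyk|exact: Hy|exact: Hy].
have := chain_le F0 Dy; rewrite y0z ymw leNgt => /negP; apply.
pose e := chain_inf D F m z w - s'.
have e0 : 0 < e by rewrite subr_gt0.
have hcs := cs e e0.
have /filter_ex[k [h1 h2]] : free_uf ([set k | \sum_(j < m) F (yk k j) (yk k j.+1) < s'] `&`
   [set k | \sum_(j < m) `|F (yk k j) (yk k j.+1) - F (y j) (y j.+1)| < e]) by exact: filterI.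
apply: (@le_lt_trans _ _ (\sum_(j < m) F (yk k j) (yk k j.+1) +
      \sum_(j < m) `|F (yk k j) (yk k j.+1) - F (y j) (y j.+1)|)).
  by rewrite -big_split /=; apply: ler_sum => j _; rewrite -lerBlDl distrC ler_norm.
have -> : chain_inf D F m z w = s' + e by rewrite /e addrC subrK.
exact: ltrD.
Qed.
End Chains.
End UltraContinuity.

(** * Decompositions of a tangent vector *)

Section Kappa.
Variable R : realType.
Local Notation C := (Cplx R).
Variable n : nat.
Local Notation Cn := 'rV[C]_n.
Variable D : set Cn.
Hypotheses (dD : domain D) (bD : bounded_set D) (tD : taut D).

Let oD : open D. Proof. by case: dD. Qed.

Lemma nrm_sum (I : Type) (r : seq I) (P : pred I) (F : I -> Cn) :
  nrm (\sum_(i <- r | P i) F i) <= \sum_(i <- r | P i) nrm (F i).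
Proof.
elim/big_rec2 : _ => [|i y1 y2 _ H]; first by rewrite nrm0.
by apply: (le_trans (nrmD _ _)); rewrite lerD2l.
Qed.

Lemma free_uf_ex2 (P Q : nat -> Prop) : (\forall k \near free_uf, P k) ->
  (\forall k \near free_uf, Q k) -> exists k, P k /\ Q k.
Proof.
move=> HP HQ; have /filter_ex[k] : free_uf ([set k | P k] `&` [set k | Q k]) by exact: filterI.
by exists k.
Qed.

Lemma free_uf_ex3 (P Q S : nat -> Prop) : (\forall k \near free_uf, P k) ->
  (\forall k \near free_uf, Q k) -> (\forall k \near free_uf, S k) -> exists k, [/\ P k, Q k & S k].
Proof.
move=> HP HQ HS.
have /filter_ex[k [[? ?] ?]] : free_uf (([set k | P k] `&` [set k | Q k]) `&` [set k | S k]).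
  by apply: filterI => //; exact: filterI.
by exists k.
Qed.

Lemma kappa0 z : D z -> kappa D z 0 = 0.
Proof.
move=> Dz; apply/eqP; rewrite eq_le kappa_ge0 andbT.
have lt : kappa D z 0 < kappa D z 0 + 1 by rewrite ltrDl.
have [phi [a [h1 h2 _ _]]] := kappa_lt oD Dz lt.
by rewrite -(md0 R); apply: (kappa_le h1 h2); rewrite scale0r.
Qed.

Lemma kappa_scale z X (l : C) : D z -> kappa D z (l *: X) <= modulus l * kappa D z X.
Proof.
move=> Dz; have [->|l0] := eqVneq l 0; first by rewrite scale0r kappa0// md0 mul0r.
have ml : 0 < modulus l by rewrite md_gt0.
rewrite mulrC -ler_pdivrMr//; apply/ler_addgt0Pr => e e0.
have lt : kappa D z X < kappa D z X + e by rewrite ltrDl.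
have [phi [a [h1 h2 h3 /ltW h4]]] := kappa_lt oD Dz lt.
apply: le_trans h4; rewrite ler_pdivrMr// mulrC -mdM; apply: (kappa_le h1 h2).
by rewrite -scalerA h3.
Qed.

(** The Cauchy estimate bounds the derivative at 0 of every disc in D. *)
Lemma kappa_lower : exists2 K : R, 0 < K & forall z X, D z -> nrm X <= K * kappa D z X.
Proof.
have [B DB] := bounded_nrm bD; have [_ _ [x0 Dx0]] := dD.
have B0 : 0 <= B by apply: le_trans (DB _ Dx0); exact: nrm_ge0.
have K0 : 0 <= n%:R * (12 * B) :> R by rewrite mulr_ge0// mulr_ge0.
exists (n%:R * (12 * B) + 1); first by rewrite ltr_wpDl.
have Kp : 0 < n%:R * (12 * B) + 1 :> R by rewrite ltr_wpDl.
move=> z X Dz; rewrite mulrC -ler_pdivrMr//; apply/ler_addgt0Pr => e e0.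
have lt : kappa D z X < kappa D z X + e by rewrite ltrDl.
have [phi [a [h1 h2 h3 /ltW h4]]] := kappa_lt oD Dz lt.
apply: le_trans h4; rewrite ler_pdivrMr// -h3 nrmZ; apply: ler_wpM2l; first exact: md_ge0.
have z0 : modulus (0 : C) < 1 by rewrite md0.
by apply: (le_trans (hdisc_der DB h1 z0)); rewrite md0 subr0 divr1 lerDl.
Qed.

Lemma kappa_ucont : ucont D setT (kappa D).
Proof.
move=> z X zk Xk Dz _ Dzk _ Hz HX; apply: ulim0_sandwich => [e e0|].
  have [|del del0 H] := @kappa_usc R n D z X (kappa D z X + e) oD Dz; first by rewrite ltrDl.
  by have h1 := Hz _ del0; have h2 := HX _ del0; near=> k; apply: H; near: k.
apply: ultra_lt => s sl Hs.
pose s' := (s + kappa D z X) / 2.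
have ss' : s < s' by rewrite /s' midf_lt.
have s'l : s' < kappa D z X by rewrite /s' midf_lt.
have Hs' : \forall k \near free_uf, kappa D (zk k) (Xk k) < s'.
  by apply: filterS Hs => k h; exact: le_lt_trans h ss'.
have := kappa_limit oD bD tD Dzk Hz HX Dz Hs'.
by rewrite leNgt s'l.
Unshelve. all: by end_near. Qed.

(** By homogeneity the offending directions may be normalized to unit vectors X k,
    which have a limit X0 with kappa D z X0 > 0 by kappa_lower.  Continuity of kappa
    at (z, X0) makes both kappa D (zk k) (X k) and kappa D z (X k) close to this
    positive number, against the factor 1 - e. *)
Lemma kappa_unif z (zk : nat -> Cn) (e : R) : D z -> (forall k, D (zk k)) ->
  ulim0 (fun k => nrm (zk k - z)) -> 0 < e < 1 ->
  \forall k \near free_uf, forall Y, (1 - e) * kappa D z Y <= kappa D (zk k) Y.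
Proof.
move=> Dz Dzk Hz /andP[e0 e1].
have [//|He] := in_ultra_setVsetC [set k | forall Y, (1 - e) * kappa D z Y <= kappa D (zk k) Y] free_uf_ultra.
exfalso.
have sel k : exists Y : Cn, ~ (forall Y, (1 - e) * kappa D z Y <= kappa D (zk k) Y) ->
    kappa D (zk k) Y < (1 - e) * kappa D z Y.
  have [H|/existsNP[Y /negP]] := pselect (forall Y, (1 - e) * kappa D z Y <= kappa D (zk k) Y).
    by exists 0 => /(_ H).
  by rewrite -ltNge; exists Y.
have [Y HY] := choice sel.
have Ybad : \forall k \near free_uf, kappa D (zk k) (Y k) < (1 - e) * kappa D z (Y k).
  by apply: filterS He => k /HY.
have Y0 k : kappa D (zk k) (Y k) < (1 - e) * kappa D z (Y k) -> 0 < nrm (Y k).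
  move=> H; apply: nrm_gt0; apply: contraTneq H => ->.
  by rewrite !kappa0// mulr0 ltxx.
pose X k := ofR (nrm (Y k))^-1 *: Y k.
have nX k : 0 < nrm (Y k) -> nrm (X k) = 1.
  by move=> Yk; rewrite /X nrmZ md_real gtr0_norm ?invr_gt0// mulVf// gt_eqF.
have Xbad : \forall k \near free_uf, nrm (X k) = 1 /\ kappa D (zk k) (X k) <= (1 - e) * kappa D z (X k).
  apply: filterS Ybad => k h; have Yk := Y0 k h; split; first exact: nX.
  have YC : ofR (nrm (Y k)) != 0 by rewrite -md_eq0 md_real normr_eq0 gt_eqF.
  apply: (le_trans (kappa_scale _ _ (Dzk k))); rewrite md_real gtr0_norm ?invr_gt0//.
  rewrite mulrC ler_pdivrMr//; apply: (le_trans (ltW h)); rewrite -mulrA.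
  apply: ler_wpM2l; first by rewrite subr_ge0 ltW.
  have {1}-> : Y k = ofR (nrm (Y k)) *: X k by rewrite /X scalerA -ofRM divff ?gt_eqF// scale1r.
  by apply: (le_trans (kappa_scale _ _ Dz)); rewrite md_real gtr0_norm// mulrC.
have [X0 HX0] : exists l, ulim0 (fun k => nrm (X k - l)).
  by apply: (ulim_vec (M := 1)); apply: filterS Xbad => k [-> _].
have cz : ulim0 (fun _ : nat => nrm (z - z)) by apply: ulim0_le_all (@ulim0_cst R) => k; rewrite subrr nrm0.
have k1 := kappa_ucont Dz I Dzk (fun=> I) Hz HX0.
have k2 := @kappa_ucont z X0 (fun=> z) X Dz I (fun=> Dz) (fun=> I) cz HX0.
have [K K0 HK] := kappa_lower.
have kp : 0 < kappa D z X0.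
  have n1 : 1 <= nrm X0.
    rewrite leNgt; apply/negP => lt1.
    have lt0 : 0 < 1 - nrm X0 by rewrite subr_gt0.
    have h := HX0 _ lt0.
    have [k [h1 [h2 _]]] := free_uf_ex2 h Xbad.
    have := nrmD (X k - X0) X0; rewrite subrK h2.
    by move: h1 => /= h1; clear - h1; lra.
  have := le_trans n1 (HK z X0 Dz).
  by move=> h; rewrite -(pmulr_rgt0 _ K0); apply: lt_le_trans h.
set kx := kappa D z X0 in kp k1 k2.
have g0 : 0 < e * kx / 4 by rewrite divr_gt0// mulr_gt0.
have [k [h1 h2 [_ h3]]] := free_uf_ex3 (k1 _ g0) (k2 _ g0) Xbad.
move: h1 h2 => /=; rewrite !ltr_norml => /andP[h1 _] /andP[_ h2].
have h4 : (1 - e) * kappa D z (X k) <= (1 - e) * (kx + e * kx / 4).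
  by apply: ler_wpM2l; [rewrite subr_ge0 ltW|rewrite -lerBlDl ltW].
have := le_trans h3 h4; move: h1; move: (kappa D (zk k) (X k)) => t h1 h5.
have ee : 0 < e * e * kx by rewrite !mulr_gt0.
have ek : 0 < e * kx by rewrite mulr_gt0.
by clear - h1 h5 ee ek; lra.
Qed.

(** A decomposition of X that depends continuously on X. *)
Definition concentrated m (X : Cn) (j : 'I_m) : Cn := if val j == 0%N then X else 0.
Lemma concentrated_sum m X : (0 < m)%N -> \sum_(j < m) concentrated X j = X.
Proof.
case: m => // m _; rewrite big_ord_recl /= big1 ?addr0// => i _.
Qed.

Lemma kappa_m_le m z X (Y : 'I_m -> Cn) : \sum_j Y j = X ->
  kappa_m m D z X <= \sum_j kappa D z (Y j).
Proof.
move=> H; apply: ge_inf; last by exists Y.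
by exists 0 => _ [Y' _ <-]; apply: sumr_ge0 => j _; exact: kappa_ge0.
Qed.

Lemma kappa_m_lt m z X (c : R) : (0 < m)%N -> kappa_m m D z X < c ->
  exists Y : 'I_m -> Cn, \sum_j Y j = X /\ \sum_j kappa D z (Y j) < c.
Proof.
move=> m0 lt; have [||_ [Y h1 <-] h2] := inf_nneg_lt _ _ lt.
- by exists (\sum_(j < m) kappa D z (concentrated X j)), (concentrated X) => //; exact: concentrated_sum.
- by move=> _ [Y _ <-]; apply: sumr_ge0 => j _; exact: kappa_ge0.
by exists Y.
Qed.

Lemma kappa_m_ge0 m z X : 0 <= kappa_m m D z X.
Proof. by apply: inf_ge0 => _ [Y _ <-]; apply: sumr_ge0 => j _; exact: kappa_ge0. Qed.

(** Above: absorb Xk - X in the first summand of an almost minimal decomposition.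
    Below: by kappa_lower the summands of almost minimal decompositions of Xk are
    bounded, and their limits decompose X. *)
Lemma kappa_m_ucont m : (0 < m)%N -> ucont D setT (kappa_m m D).
Proof.
move=> m0 z X zk Xk Dz _ Dzk _ Hz HX; apply: ulim0_sandwich => [e e0|].
  have [|Y [YX Ylt]] := @kappa_m_lt m z X (kappa_m m D z X + e / 2) m0.
    by rewrite ltrDl divr_gt0.
  pose Yk k j := Y j + concentrated (Xk k - X) j.
  have cY j : ulim0 (fun k => nrm (Yk k j - Y j)).
    apply: ulim0_le_all HX => k; rewrite /Yk addrC addKr /concentrated; case: ifP => // _.
    by rewrite nrm0 nrm_ge0.
  have cs : ulim0 (fun k => \sum_(j < m) `|kappa D (zk k) (Yk k j) - kappa D z (Y j)|).
    apply: (ulim0_sum (d := fun j k => `|kappa D (zk k) (Yk k j) - kappa D z (Y j)|)) => j.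
    exact: kappa_ucont.
  have := cs (e / 2) (divr_gt0 e0 (ltr0Sn _ 1)); apply: filterS => k hk.
  have Ys : \sum_j Yk k j = Xk k.
    by rewrite big_split /= YX concentrated_sum// addrC subrK.
  apply: (le_lt_trans (kappa_m_le _ Ys)).
  apply: (@le_lt_trans _ _ (\sum_(j < m) kappa D z (Y j) +
      \sum_(j < m) `|kappa D (zk k) (Yk k j) - kappa D z (Y j)|)).
    rewrite -big_split /=; apply: ler_sum => j _; rewrite -lerBlDl; exact: ler_norm.
  by have -> : e = e / 2 + e / 2 by [rewrite -splitr]; rewrite addrA; apply: ltrD.
apply: ultra_lt => s sl Hs.
pose s' := (s + kappa_m m D z X) / 2.
have ss' : s < s' by rewrite /s' midf_lt.
have s'l : s' < kappa_m m D z X by rewrite /s' midf_lt.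
have sel k : exists Y : 'I_m -> Cn, \sum_j Y j = Xk k /\
    (kappa_m m D (zk k) (Xk k) < s' -> \sum_j kappa D (zk k) (Y j) < s').
  have [lt|ge] := ltrP (kappa_m m D (zk k) (Xk k)) s'.
    by have [Y [h1 h2]] := kappa_m_lt m0 lt; exists Y.
  by exists (concentrated (Xk k)); split => //; exact: concentrated_sum.
have [Y HY] := choice sel.
have sums : \forall k \near free_uf, \sum_(j < m) kappa D (zk k) (Y k j) < s'.
  by apply: filterS Hs => k h; have [_] := HY k; apply; exact: le_lt_trans h ss'.
have [K K0 HK] := kappa_lower.
have lim j : exists l, ulim0 (fun k => nrm (Y k j - l)).
  apply: (ulim_vec (M := K * s')); apply: filterS sums => k h.
  apply: (le_trans (HK _ _ (Dzk k))); apply: ler_wpM2l; first exact: ltW.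
  apply: le_trans (ltW h); rewrite (bigD1 j) //= lerDl.
  by apply: sumr_ge0 => i _; exact: kappa_ge0.
have [Y0 HY0] := choice lim.
have YX : \sum_j Y0 j = X.
  apply: (ulim0_uniq (x := Xk)) => //.
  have cs : ulim0 (fun k => \sum_(j < m) nrm (Y k j - Y0 j)).
    exact: (ulim0_sum (d := fun j k => nrm (Y k j - Y0 j))).
  by apply: ulim0_le_all cs => k; have [<- _] := HY k; rewrite -sumrB; exact: nrm_sum.
have cs : ulim0 (fun k => \sum_(j < m) `|kappa D (zk k) (Y k j) - kappa D z (Y0 j)|).
  apply: (ulim0_sum (d := fun j k => `|kappa D (zk k) (Y k j) - kappa D z (Y0 j)|)) => j.
  exact: (kappa_ucont Dz I Dzk (fun=> I) Hz (HY0 j)).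
have := @kappa_m_le m z X Y0 YX; rewrite leNgt => /negP; apply.
pose e := kappa_m m D z X - s'.
have e0 : 0 < e by rewrite subr_gt0.
have hcs := cs e e0.
have [k [h1 h2]] := free_uf_ex2 sums hcs.
apply: (@le_lt_trans _ _ (\sum_(j < m) kappa D (zk k) (Y k j) +
      \sum_(j < m) `|kappa D (zk k) (Y k j) - kappa D z (Y0 j)|)).
  by rewrite -big_split /=; apply: ler_sum => j _; rewrite -lerBlDl distrC ler_norm.
have -> : kappa_m m D z X = s' + e by rewrite /e addrC subrK.
exact: ltrD.
Qed.

Lemma kappa_hat_le m z X : (0 < m)%N -> kappa_hat D z X <= kappa_m m D z X.
Proof.
move=> m0; apply: ge_inf; last by exists m.
by exists 0 => _ [k _ <-]; exact: kappa_m_ge0.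
Qed.

Lemma kappa_hat_lt z X (c : R) : kappa_hat D z X < c ->
  exists2 m, (0 < m)%N & kappa_m m D z X < c.
Proof.
move=> lt; have [||_ [m m0 <-] h] := inf_nneg_lt _ _ lt; last by exists m.
- by exists (kappa_m 1 D z X), 1%N.
- by move=> _ [k _ <-]; exact: kappa_m_ge0.
Qed.

Lemma kappa_hat_ge0 z X : 0 <= kappa_hat D z X.
Proof. by apply: inf_ge0 => _ [m _ <-]; exact: kappa_m_ge0. Qed.

(** Above: kappa_m for a fixed m.  Below: an almost minimal decomposition of Xk at
    zk, of any length, is almost as good at z by kappa_unif; adding the
    summand X - Xk, which has small kappa, decomposes X at z. *)
Lemma kappa_hat_ucont : ucont D setT (kappa_hat D).
Proof.
move=> z X zk Xk Dz _ Dzk _ Hz HX; apply: ulim0_sandwich => [e e0|].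
  have [|m m0 lt] := @kappa_hat_lt z X (kappa_hat D z X + e / 2).
    by rewrite ltrDl divr_gt0.
  have := kappa_m_ucont m0 Dz I Dzk (fun=> I) Hz HX (divr_gt0 e0 (ltr0Sn _ 1)).
  apply: filterS => k /ltr_normlW h; apply: (le_lt_trans (kappa_hat_le _ _ m0)).
  have := ltrD h lt; rewrite subrK => /lt_le_trans; apply.
  by rewrite addrC -addrA -splitr.
apply: ultra_lt => s sl Hs.
pose s' := (s + kappa_hat D z X) / 2.
have ss' : s < s' by rewrite /s' midf_lt.
have s'l : s' < kappa_hat D z X by rewrite /s' midf_lt.
have s0 : 0 <= s by have /filter_ex[k hk] := Hs; apply: le_trans hk; exact: kappa_hat_ge0.
have s'0 : 0 < s' := le_lt_trans s0 ss'.
pose g := (kappa_hat D z X - s') / 2.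
have g0 : 0 < g by rewrite divr_gt0// subr_gt0.
have gE : kappa_hat D z X = s' + g + g by rewrite /g -addrA -splitr addrC subrK.
pose e := g / (s' + g).
have sg : 0 < s' + g by rewrite addr_gt0.
have e01 : 0 < e < 1 by rewrite divr_gt0//= ltr_pdivrMr// mul1r ltrDr.
have H1 := kappa_unif Dz Dzk Hz e01.
have cz : ulim0 (fun _ : nat => nrm (z - z)) by apply: ulim0_le_all (@ulim0_cst R) => k; rewrite subrr nrm0.
have cX : ulim0 (fun k => nrm ((X - Xk k) - 0)).
  by apply: ulim0_le_all HX => k; rewrite subr0 nrmB.
have H2 := @kappa_ucont z 0 (fun=> z) (fun k => X - Xk k) Dz I (fun=> Dz) (fun=> I) cz cX g g0.
have [k [h1 h2 h3]] := free_uf_ex3 H1 H2 Hs.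
move: h1 h2 h3 => /= h1 /ltr_normlW; rewrite kappa0// subr0 => h2 h3.
have [m m0 lt] := kappa_hat_lt (le_lt_trans h3 ss').
have [Y [YX Ylt]] := kappa_m_lt m0 lt.
pose Y' (j : 'I_m.+1) := if unlift ord0 j is Some i then Y i else X - Xk k.
have Y'X : \sum_j Y' j = X.
  rewrite big_ord_recl /Y' unlift_none (eq_bigr Y) ?YX ?subrK// => i _.
  by rewrite liftK.
have le1 : kappa_hat D z X <= kappa D z (X - Xk k) + \sum_j kappa D z (Y j).
  apply: (le_trans (kappa_hat_le z X (ltn0Sn m))); apply: (le_trans (kappa_m_le z Y'X)).
  rewrite big_ord_recl /Y' unlift_none lerD2l le_eqVlt; apply/orP; left; apply/eqP.
  by apply: eq_bigr => i _; rewrite liftK.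
have le2 : (1 - e) * \sum_j kappa D z (Y j) < s'.
  by apply: le_lt_trans Ylt; rewrite mulr_sumr; apply: ler_sum => j _; exact: h1.
have le3 : s' + g < \sum_j kappa D z (Y j).
  move: le1 h2; rewrite gE; move: (kappa _ _ _) (\sum_j _) => u v; clear; lra.
have e1 : 0 < 1 - e by case/andP: e01 => _; rewrite subr_gt0.
have : (1 - e) * (s' + g) < s' by apply: lt_trans le2; rewrite ltr_pM2l.
have -> : (1 - e) * (s' + g) = s' by rewrite /e; field; rewrite gt_eqF.
by rewrite ltxx.
Qed.
End Kappa.

(** * Continuity from quasi triangle inequalities *)

Theorem corollary3 (R : realType) (n : nat) (n_gt0 : (0 < n)%N)
    (D : set 'rV[Cplx R]_n)
    (D_domain : domain D) (D_bounded : bounded_set D) (D_smooth : C1_smooth D) :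
  (ell_quasi_triangle D ->
     forall m : nat, (0 < m)%N ->
       {within D `*` D,
         continuous (fun p : 'rV[Cplx R]_n * 'rV[Cplx R]_n =>
                       ell_m m D p.1 p.2)} /\
       {within D `*` D,
         continuous (fun p : 'rV[Cplx R]_n * 'rV[Cplx R]_n =>
                       lempert_m m D p.1 p.2)})
  /\
  (kappa_quasi_triangle D ->
     (forall m : nat, (0 < m)%N ->
        {within D `*` [set: 'rV[Cplx R]_n],
          continuous (fun p : 'rV[Cplx R]_n * 'rV[Cplx R]_n =>
                        kappa_m m D p.1 p.2)}) /\
     {within D `*` [set: 'rV[Cplx R]_n],
       continuous (fun p : 'rV[Cplx R]_n * 'rV[Cplx R]_n =>
                     kappa_hat D p.1 p.2)}).
Proof.
split=> [qt m m0|qt].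
  have tD := ell_quasi_taut D_domain D_bounded D_smooth qt.
  split; apply: ucont_within; apply: chain_inf_ucont => //.
  - by move=> z w _ _; exact: ell_ge0.
  - by move=> w; exact: ell_refl.
  - exact: ell_ucont.
  - exact: ell_escape.
  - by move=> z w; exact: lempert_ge0.
  - by move=> w; exact: lempert_refl.
  - exact: lempert_ucont.
  - exact: lempert_escape.
have tD := kappa_quasi_taut D_domain D_bounded D_smooth qt.
split=> [m m0|]; apply: ucont_within; first exact: kappa_m_ucont.
exact: kappa_hat_ucont.
Qed.
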